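(* Let $(R,\mathfrak{m})$ be a $d$-dimensional Noetherian local ring with infinite residue field, let $F=R^p$ with $p>0$, and let $M$ be a finitely generated $R$-submodule of $F$ with $\ell_R(F/M)<\infty$ and analytic spread $s=s(M)\geq 1$. Let $I(M)=\operatorname{Fitt}_0(F/M)$ and let $k\in\{1,\ldots,s\}$. Then $$M_{[k]}=\bigcup_{n_0,\ \underline{x}} M\cap\left(I(M)M^{n_0+1}:_F x_1,\ldots,x_k\right),$$ where the union ranges over all integers $n_0\geq1$ and all $\underline{x}=(x_1,\ldots,x_k,\ldots,x_s)$ such that $x_1,\ldots,x_s\in M^{n_0}$ generate a minimal reduction of $M^{n_0}$.
   Context: $F=R^p$ is free of rank $p>0$ and $S=\operatorname{Sym}_R(F)=R[t_1,\ldots,t_p]$ with $F=S_1$, $F^n=S_n$. For an $R$-submodule $N\subseteq F$, the Rees algebra $\mathscr{R}(N)=\bigoplus_{n\ge 0}N^n$ is the $R$-subalgebra of $S$ generated by $N$ in degree 1; $N^n\subseteq F^n$ is its degree $n$ component. All products are taken in $S$. The analytic spread is $s(N)=\dim\left(\mathscr{R}(N)/\mathfrak{m}\mathscr{R}(N)\right)$. $I(M)=\operatorname{Fitt}_0(F/M)$ is the $0$-th Fitting ideal of $F/M$. For $x_1,\ldots,x_k\in M^{n_0}$, $(I(M)M^{n_0+1}:_Fx_1,\ldots,x_k)=\{y\in F: yx_i\in I(M)M^{n_0+1}\text{ for }i=1,\ldots,k\}$. For $n_0\ge1$, an $R$-submodule $U\subseteq M^{n_0}$ is a reduction of $M^{n_0}$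 if $U\,(M^{n_0})^{n}=(M^{n_0})^{n+1}$ for all large $n$; it is a minimal reduction if it properly contains no other reduction of $M^{n_0}$. For an $R$-module $L$ with $I(M)M\subseteq L\subseteq M$, the function $n\mapsto \ell_R(LM^{n-1}/I(M)M^n)$ agrees for all large $n$ with a polynomial in $n$; its degree is denoted $\deg[\ell_R(LM^{n-1}/I(M)M^n)]$, the zero polynomial having degree $-1$. For $1\le k\le s$, $M_{[k]}$ (the $k$-th coefficient module of the associated graded ring $G_{I(M)}(\mathscr{R}(M))=\mathscr{R}(M)/I(M)\mathscr{R}(M)$) is the unique largest $R$-module $L$ with $I(M)M\subseteq L\subseteq M$ and $\deg[\ell_R(LM^{n-1}/I(M)M^n)]\le s-(k+1)$ (such a largest module exists under the stated hypotheses). *)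

(* Defs.v *)
From HB Require Import structures.
From mathcomp Require Import all_boot all_order all_algebra.
From mathcomp Require Import boolp classical_sets cardinality.
From mathcomp Require Import mpoly.

Set Implicit Arguments.
Unset Strict Implicit.
Unset Printing Implicit Defensive.

Import Order.TTheory GRing.Theory Num.Theory.

Local Open Scope classical_set_scope.
Local Open Scope ring_scope.

(** Submodules, ideals and subalgebras are [Prop]-valued sets.  Quotients are
    not formed as types: submodules of [A / B] (resp. primes of [A / J]) are
    the submodules between [B] and [A] (resp. the primes of [A] containing
    [J]). *)

Section Chains.
Variable T : Type.
Implicit Type C : set (set T).

Definition has_chain C (n : nat) : Prop :=
  exists2 N : nat -> set T, (forall i, (i <= n)%N -> C (N i))
                          & (forall i, (i < n)%N -> N i `<` N i.+1).

Definition max_chain C (n : nat) : Prop :=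
  has_chain C n /\ (forall n', has_chain C n' -> (n' <= n)%N).

End Chains.

Section Modules.
Variables (R : comNzRingType) (V : lmodType R).
Implicit Types (A B N X : set V) (I : set R).

Definition submodule N : Prop :=
  N 0 /\ forall (a : R) u v, N u -> N v -> N (a *: u + v).

Definition span X : set V := smallest submodule X.

Definition fin_gen N : Prop :=
  exists (n : nat) (x : 'I_n -> V), N = span (range x).

Definition scale_mod I N : set V := span [set a *: v | a in I & v in N].

(* [length_quot A B n]: the R-module [A / B] has (finite) length [n]. *)
Definition length_quot A B (n : nat) : Prop :=
  max_chain [set N | [/\ submodule N, B `<=` N & N `<=` A]] n.

End Modules.

Section Rings.
Variable R : comNzRingType.
Implicit Types (I J P m A : set R).

Definition ideal I : Prop := @submodule R R^o I.

Definition noetherian : Prop := forall I, ideal I -> @fin_gen R R^o I.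

Definition maximal_ideal m : Prop :=
  [/\ ideal m, m <> setT &
      forall J, ideal J -> m `<=` J -> J = m \/ J = setT].

Definition local_ring m : Prop :=
  maximal_ideal m /\ forall J, maximal_ideal J -> J = m.

Definition residue_class m (a : R) : set R := [set b | m (b - a)].

Definition infinite_residue_field m : Prop :=
  infinite_set (range (residue_class m)).

(* [J] is an ideal of the subring [A]. *)
Definition ideal_in A J : Prop :=
  [/\ J `<=` A, J 0, forall a b, J a -> J b -> J (a + b) &
      forall a b, A a -> J b -> J (a * b)].

Definition prime_in A P : Prop :=
  [/\ ideal_in A P, ~ P 1 &
      forall a b, A a -> A b -> P (a * b) -> P a \/ P b].

(* [krull_dim_quot A J n]: the ring [A / J] has Krull dimension [n], where
   [J] is an ideal of the subring [A]. *)
Definition krull_dim_quot A J (n : nat) : Prop :=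
  max_chain [set P | prime_in A P /\ J `<=` P] n.

Definition krull_dim (n : nat) : Prop := krull_dim_quot setT [set 0] n.

End Rings.

Section ReesAlgebra.
Variables (R : comNzRingType) (p : nat).
Local Notation F := 'rV[R]_p.
Local Notation S := {mpoly R[p]}.
Implicit Types (A B U W : set S) (M L : set F).

(* The identification of [F] with [S_1]. *)
Definition linform (v : F) : S := \sum_(i < p) v 0 i *: 'X_i.

Definition mul_mod A B : set S := span [set a * b | a in A & b in B].

Fixpoint exp_mod A (n : nat) : set S :=
  if n is n'.+1 then mul_mod A (exp_mod A n') else span [set 1].

Definition mpow M (n : nat) : set S := exp_mod (linform @` M) n.

Definition subalgebra A : Prop :=
  [/\ submodule A, A 1 & forall a b, A a -> A b -> A (a * b)].

Definition rees M : set S := smallest subalgebra (linform @` M).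

Definition analytic_spread (m : set R) M (s : nat) : Prop :=
  krull_dim_quot (rees M) (scale_mod m (rees M)) s.

(* The ideal of maximal minors of the presentation of [F / M] whose relations
   are all the elements of [M]. *)
Definition fitting0 M : set R :=
  @span R R^o [set \det B | B in [set B : 'M[R]_p | forall i, M (row i B)]].

Definition reduction W U : Prop :=
  [/\ submodule U, U `<=` W &
      exists N, forall n, (N <= n)%N ->
        mul_mod U (exp_mod W n) = exp_mod W n.+1].

Definition minimal_reduction W U : Prop :=
  reduction W U /\ forall U', reduction W U' -> U' `<=` U -> U' = U.

Definition length_poly M L (q : {poly rat}) : Prop :=
  exists N, forall n, (N <= n)%N ->
    exists2 l, length_quot (mul_mod (linform @` L) (mpow M n.-1))
                           (scale_mod (fitting0 M) (mpow M n)) l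
             & q.[n%:R] = l%:R.

(* The zero polynomial has degree -1. *)
Definition pdegree (q : {poly rat}) : int := (size q)%:Z - 1.

Definition coef_candidate (s k : nat) M L : Prop :=
  [/\ submodule L, scale_mod (fitting0 M) M `<=` L, L `<=` M &
      exists2 q, length_poly M L q & pdegree q <= s%:Z - (k%:Z + 1)].

Definition is_coef_module (s k : nat) M L : Prop :=
  coef_candidate s k M L /\
  forall L', coef_candidate s k M L' -> L' `<=` L.

(* The k-th coefficient module; [set0] is a junk value, never a submodule, in
   case there is no largest candidate. *)
Definition coef_module (s k : nat) M : set F :=
  xget set0 [set L | is_coef_module s k M L].

Lemma coef_moduleE (s k : nat) M L :
  is_coef_module s k M L -> coef_module s k M = L.
Proof.
move=> hL; rewrite /coef_module; case: xgetP => [L' _ hL'|/(_ L)//].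
by apply/seteqP; split; [apply: hL.2 hL'.1|apply: hL'.2 hL.1].
Qed.

Definition colonF (N : set S) (s k : nat) (x : 'I_s -> S) : set F :=
  [set y | forall i : 'I_s, (i < k)%N -> N (linform y * x i)].

Definition generates_min_reduction (W : set S) (s : nat) (x : 'I_s -> S) :
    Prop :=
  (forall i, W (x i)) /\ minimal_reduction W (span (range x)).

End ReesAlgebra.

(* Main.v *)
(** Let [A] be the Rees algebra, [A_n = M^n] and [I = I(M)].  For [y] in [M] the
    module [(y M^n + I M^(n+1)) / I M^(n+1)] is [A_n / ann(y)_n], where [ann(y)]
    is the annihilator of [y] modulo [I A].  So [y] lies in the [k]-th coefficient
    module iff these lengths grow like a polynomial of degree at most [s - k - 1].
    If [x_1, ..., x_s] generate a reduction of [M^n0] and [x_1, ..., x_k] are in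
    [ann(y)], then [y A] is, modulo [I A], finite over [x_(k+1), ..., x_s], which
    bounds its growth.
    Conversely, a chain of primes [P_0 < ... < P_r] over a homogeneous ideal [J]
    forces the lengths of [A_i / J_i], [i <= e n], to add up to at least
    [binomial(n, r)] for some fixed [e], so small growth gives
    [dim A / ann(y) <= s - k].  Homogeneous prime avoidance then yields a
    homogeneous system of parameters whose first [k] members are in [ann(y)];
    powers bring its members to a common degree [n0], and by Nakayama's lemma it
    generates a reduction of [M^n0].  The reduction is minimal because fewer than
    [s] generators would bound the dimension of the fiber ring below [s]. *)

Require Import Defs.
From HB Require Import structures.
From mathcomp Require Import all_boot all_order all_algebra.
From mathcomp Require Import boolp classical_sets cardinality.
From mathcomp Require Import mpoly zify ring lra.

Set Implicit Arguments.
Unset Strict Implicit.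
Unset Printing Implicit Defensive.

Import Order.TTheory GRing.Theory Num.Theory.

Local Open Scope classical_set_scope.
Local Open Scope ring_scope.

(* [span] would otherwise be the one of [vector]. *)
Local Notation span := Defs.span.

(** * Submodules, chains and lengths *)

(** The degree condition is turned into a condition on single elements: the partial sums of the
    lengths are O(n^(s-k)). Such bounds pass to sums and to smaller lengths, so the elements that
    satisfy one form a module, and this module is the largest candidate. As a candidate is defined
    through a polynomial, the existence of Hilbert polynomials has to be established too. Dimension
    occurs in two guises. [analytic_spread] counts chains of arbitrary primes, so the lower bound on
    growth must hold for primes that are not graded; it is obtained on the filtration by degree,
    where multiplication by an element of the larger prime produces Pascal's rule, hence the
    binomials. The choice of parameters works with chains of homogeneous primes over [m], counted
    upwards from a given prime. A homogeneous chain is a chain, which bounds the second count by the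
    first. Parameters found by prime avoidance come in uncontrolled degrees; the freedom of [n0] in
    the union absorbs this. *)

Section Submodules.
Variables (R : comNzRingType) (V : lmodType R).
Implicit Types (A B C N X : set V).

Lemma sub0 N : submodule N -> N 0. Proof. by case. Qed.

Lemma subD N u v : submodule N -> N u -> N v -> N (u + v).
Proof. by case=> _ h hu hv; have := h 1 u v hu hv; rewrite scale1r. Qed.

Lemma subZ N a u : submodule N -> N u -> N (a *: u).
Proof. by case=> h0 h hu; have := h a u 0 hu h0; rewrite addr0. Qed.

Lemma subN N u : submodule N -> N u -> N (- u).
Proof. by move=> hN hu; rewrite -scaleN1r; exact: subZ. Qed.

Lemma subB N u v : submodule N -> N u -> N v -> N (u - v).
Proof. by move=> hN hu hv; apply: subD => //; exact: subN. Qed.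

Lemma subDr N u v : submodule N -> N u -> N (u + v) -> N v.
Proof. by move=> hN hu huv; rewrite -(addKr u v) addrC; apply: subB. Qed.

Lemma sub_sum N (I : Type) (r : seq I) (P : pred I) (F : I -> V) :
  submodule N -> (forall i, P i -> N (F i)) -> N (\sum_(i <- r | P i) F i).
Proof.
move=> hN hF; elim/big_ind: _ => //; first exact: sub0.
by move=> x y; exact: subD.
Qed.

Lemma submodule_span X : submodule (span X).
Proof.
split=> [N [hN _]|a u v hu hv N hN]; first exact: sub0.
by case: (hN) => hs _; apply: hs.2; [exact: hu|exact: hv].
Qed.

Lemma span_gen X : X `<=` span X. Proof. exact: sub_gen_smallest. Qed.

Lemma span_min N X : submodule N -> X `<=` N -> span X `<=` N.
Proof. by move=> hN hX; exact: smallest_sub. Qed.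

Lemma span_mono X Y : X `<=` Y -> span X `<=` span Y.
Proof.
move=> h; apply: span_min; first exact: submodule_span.
by move=> x /h; exact: span_gen.
Qed.

Lemma submoduleI A B : submodule A -> submodule B -> submodule (A `&` B).
Proof.
move=> hA hB; split=> [|a u v [Au Bu] [Av Bv]]; first by split; apply: sub0.
by split; [apply: hA.2|apply: hB.2].
Qed.

Lemma submoduleT : submodule [set: V]. Proof. by []. Qed.

Lemma submodule1 : submodule [set (0 : V)].
Proof. by split=> // a u v -> ->; rewrite /= scaler0 addr0. Qed.

Definition addS A B : set V := [set a + b | a in A & b in B].

Lemma submodule_addS A B : submodule A -> submodule B -> submodule (addS A B).
Proof.
move=> hA hB; split; first by exists 0; [exact: sub0|exists 0; [exact: sub0|rewrite addr0]].
move=> a u v [u1 hu1 [u2 hu2 <-]] [v1 hv1 [v2 hv2 <-]].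
exists (a *: u1 + v1); first exact: hA.2.
exists (a *: u2 + v2); first exact: hB.2.
by rewrite scalerDr addrACA.
Qed.

Lemma addSl A B : submodule B -> A `<=` addS A B.
Proof. by move=> hB a ha; exists a => //; exists 0; rewrite ?addr0 //; exact: sub0. Qed.

Lemma addSr A B : submodule A -> B `<=` addS A B.
Proof. by move=> hB a ha; exists 0; [exact: sub0|exists a; rewrite ?add0r]. Qed.

Lemma addS_min A B N : submodule N -> A `<=` N -> B `<=` N -> addS A B `<=` N.
Proof. by move=> hN hA hB _ [a /hA ha [b /hB hb <-]]; exact: subD. Qed.

Lemma addS_mono A B A' B' : A `<=` A' -> B `<=` B' -> addS A B `<=` addS A' B'.
Proof. by move=> hA hB _ [a /hA ha [b /hB hb <-]]; exists a => //; exists b. Qed.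

Lemma span_ordP n (x : 'I_n -> V) v :
  span (range x) v <-> exists c : 'I_n -> R, v = \sum_i c i *: x i.
Proof.
split=> [|[c ->]]; last first.
  apply: (sub_sum _ (submodule_span _)) => i _.
  by apply: (subZ _ (submodule_span _)); apply: span_gen; exists i.
suff h : span (range x) `<=` [set v | exists c : 'I_n -> R, v = \sum_i c i *: x i].
  exact: h.
apply: span_min; last first.
  move=> _ [i _ <-]; exists (fun j => (j == i)%:R).
  rewrite (bigD1 i) //= eqxx scale1r big1 ?addr0 // => j /negPf ->.
  by rewrite scale0r.
split; first by exists (fun=> 0); rewrite big1 // => i _; rewrite scale0r.
move=> a u w [c ->] [c' ->]; exists (fun i => a * c i + c' i).
rewrite scaler_sumr -big_split /=; apply: eq_bigr => i _.
by rewrite scalerDl scalerA.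
Qed.

End Submodules.

Section Images.
Variables (R : comNzRingType) (V W : lmodType R) (f : V -> W).
Hypothesis hf : linear f.

Lemma linear_fun0 : f 0 = 0.
Proof. by have := hf (-1) 0 0; rewrite scaler0 addr0 scaleN1r addNr. Qed.

Lemma linear_funZ a u : f (a *: u) = a *: f u.
Proof. by have := hf a u 0; rewrite linear_fun0 !addr0. Qed.

Lemma linear_funD u v : f (u + v) = f u + f v.
Proof. by have := hf 1 u v; rewrite !scale1r. Qed.

Lemma linear_funB u v : f (u - v) = f u - f v.
Proof. by rewrite linear_funD -!scaleN1r linear_funZ. Qed.

Lemma submodule_image (A : set V) : submodule A -> submodule (f @` A).
Proof.
move=> hA; split; first by exists 0; [exact: sub0|exact: linear_fun0].
move=> a _ _ [u hu <-] [v hv <-]; exists (a *: u + v); first exact: hA.2.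
exact: hf.
Qed.

Lemma submodule_preimage (B : set W) : submodule B -> submodule (f @^-1` B).
Proof.
move=> hB; split; first by rewrite /preimage /= linear_fun0; exact: sub0.
by move=> a u v hu hv; rewrite /preimage /= hf; exact: hB.2.
Qed.

Lemma span_image (X : set V) : span (f @` X) = f @` (span X).
Proof.
apply/seteqP; split.
  apply: span_min; first by apply: submodule_image; exact: submodule_span.
  by move=> _ [x hx <-]; exists x => //; exact: span_gen.
suff h : span X `<=` f @^-1` (span (f @` X)) by move=> _ [x /h hx <-].
apply: span_min; first by apply: submodule_preimage; exact: submodule_span.
by move=> x hx; apply: span_gen; exists x.
Qed.

End Images.

Section UpChains.
Variable T : Type.
Implicit Types (C : set (set T)) (x y z : set T).

(** Chains are indexed by their least member so that they can be transformed by induction from the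
    bottom, without an indexing function; [has_chainP] is the bridge to [has_chain]. *)
Inductive uchain C : set T -> nat -> Prop :=
| UChain0 x : C x -> uchain C x 0
| UChainS x y n : C x -> x `<` y -> uchain C y n -> uchain C x n.+1.

Lemma uchain_mem C x n : uchain C x n -> C x. Proof. by case. Qed.

Lemma has_chainP C n : has_chain C n <-> exists x, uchain C x n.
Proof.
split.
- elim: n => [|n IH] in C *; first by case=> N hN _; exists (N 0); constructor; exact: hN.
  case=> N hN hs.
  suff h : forall j i, (i + j = n.+1)%N -> uchain C (N i) j.
    by exists (N 0); exact: h.
  elim=> [|j IHj] i hij; first by constructor; apply: hN; rewrite -hij addn0.
  apply: (@UChainS _ _ (N i.+1)).
  + by apply: hN; rewrite -hij leq_addr.
  + by apply: hs; rewrite -hij addnS ltnS leq_addr.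
  + by apply: IHj; rewrite addSn -addnS.
- case=> x h.
  suff [N [N0 hN hs]] : exists N : nat -> set T, [/\ N 0%N = x,
      (forall i, (i <= n)%N -> C (N i)) & forall i, (i < n)%N -> N i `<` N i.+1].
    by exists N.
  elim: h => {x n} [x hx|x y n hx xy _ [N [N0 hN hs]]].
    by exists (fun=> x); split.
  exists (fun i => if i is i'.+1 then N i' else x); split=> // -[|i] hi //.
  + by apply: hN.
  + by rewrite N0.
  + exact: hs.
Qed.

Lemma uchain_sub C D x n : C `<=` D -> uchain C x n -> uchain D x n.
Proof.
move=> CD; elim=> {x n} [x hx|x y n hx xy _ IH]; first by constructor; exact: CD.
by apply: UChainS xy IH; exact: CD.
Qed.

Lemma uchain_lower C x y n : C x -> x `<=` y -> uchain C y n -> uchain C x n.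
Proof.
move=> hx xy h; case: h hx xy => {y n} [y hy hx xy|y z n hy yz h hx xy]; first by constructor.
case: yz => yz zy; apply: (UChainS hx _ h); split; first exact: subset_trans xy yz.
by move=> zx; apply: zy; exact: subset_trans zx xy.
Qed.

Lemma uchain_trunc C x n m : (m <= n)%N -> uchain C x n -> uchain C x m.
Proof.
move=> mn h; elim: h m mn => {x n} [x hx|x y n hx xy _ IH] m.
  by rewrite leqn0 => /eqP ->; constructor.
by case: m => [|m] hm; [constructor|apply: UChainS xy (IH _ _)].
Qed.

Lemma uchain_above C x n : uchain C x n -> uchain (C `&` [set y | x `<=` y]) x n.
Proof.
elim=> {x n} [x hx|x y n hx xy _ IH]; first by constructor; split.
apply: (UChainS _ xy); first by split.
apply: uchain_sub IH => z [hz yz]; split=> //=.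
exact: subset_trans (properW xy) yz.
Qed.

Lemma sub_neq_proper (x y : set T) : x `<=` y -> x <> y -> x `<` y.
Proof.
move=> xy ne; split=> // yx; apply: ne; exact/seteqP.
Qed.

Lemma proper_neq (x y : set T) : x `<` y -> x <> y.
Proof. by case=> _ h e; apply: h; rewrite e. Qed.

End UpChains.

Lemma uchain_map (T U : Type) (C : set (set T)) (D : set (set U))
    (g : set T -> set U) x n :
  (forall y, C y -> D (g y)) ->
  (forall y z, C y -> C z -> y `<` z -> g y `<` g z) ->
  uchain C x n -> uchain D (g x) n.
Proof.
move=> hC hs; elim=> {x n} [x hx|x y n hx xy h IH]; first by constructor; exact: hC.
apply: UChainS IH; first exact: hC.
by apply: hs => //; exact: uchain_mem h.
Qed.

Section Lengths.
Variables (R : comNzRingType) (V : lmodType R).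
Implicit Types (A B C N x y z : set V).

Definition ival A B : set (set V) := [set N | [/\ submodule N, B `<=` N & N `<=` A]].

Definition len_le A B n := forall x m, uchain (ival A B) x m -> (m <= n)%N.

Definition flen A B := exists n, len_le A B n.

(** The default 0 also stands for infinite length, so the comparison lemmas below carry an [flen]
    hypothesis. *)
Definition len A B : nat := xget 0%N [set n | length_quot A B n].

Lemma length_quot_len_le A B n : length_quot A B n -> len_le A B n.
Proof. by case=> _ h x m hx; apply: h; apply/has_chainP; exists x. Qed.

Lemma length_quot_uniq A B n n' : length_quot A B n -> length_quot A B n' -> n = n'.
Proof. by move=> [h1 h2] [h3 h4]; apply/eqP; rewrite eqn_leq h2 // h4. Qed.

Lemma length_quot_flen A B n : length_quot A B n -> flen A B.
Proof. by move/length_quot_len_le => h; exists n. Qed.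

Lemma lenP A B : submodule A -> submodule B -> B `<=` A -> flen A B ->
  length_quot A B (len A B).
Proof.
move=> hA hB BA [n hn]; rewrite /len; apply: xgetPex.
have h0 : exists m, `[< has_chain (ival A B) m >].
  by exists 0%N; apply/asboolP/has_chainP; exists A; constructor; split.
have h1 m : `[< has_chain (ival A B) m >] -> (m <= n)%N.
  by move=> /asboolP/has_chainP [x /hn].
case: (ex_maxnP h0 h1) => m /asboolP hm hmax; exists m; split=> // m' hm'.
by apply: hmax; apply/asboolP.
Qed.

Lemma len_eq A B n : length_quot A B n -> len A B = n.
Proof.
move=> h; apply: (length_quot_uniq _ h).
by apply: (@xgetPex _ 0%N [set n | length_quot A B n]); exists n.
Qed.

Lemma len_chain A B : submodule A -> submodule B -> B `<=` A -> flen A B ->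
  exists x, uchain (ival A B) x (len A B).
Proof. by move=> hA hB BA /(lenP hA hB BA) [/has_chainP h _]; exact: h. Qed.

Lemma len_max A B x n : submodule A -> submodule B -> B `<=` A -> flen A B ->
  uchain (ival A B) x n -> (n <= len A B)%N.
Proof. by move=> hA hB BA /(lenP hA hB BA) /length_quot_len_le h /h. Qed.

Lemma len_leP A B n : submodule A -> submodule B -> B `<=` A -> flen A B ->
  (len A B <= n)%N <-> len_le A B n.
Proof.
move=> hA hB BA h; split=> [hn x m /(len_max hA hB BA h) hm|hn]; first exact: leq_trans hm hn.
by case: (len_chain hA hB BA h) => x /hn.
Qed.

Lemma ival_sub A A' B B' : A `<=` A' -> B' `<=` B -> ival A B `<=` ival A' B'.
Proof. by move=> hA hB N [h1 h2 h3]; split=> //; [exact: subset_trans hB h2|exact: subset_trans h3 hA]. Qed.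

(** The modular law. It ensures that a strict inclusion stays strict either modulo [B] or in the
    trace on [B], which is the heart of the additivity of length. *)
Lemma modular_eq B x y : submodule B -> submodule x -> submodule y -> x `<=` y ->
  addS x B = addS y B -> x `&` B = y `&` B -> x = y.
Proof.
move=> hB hx hy xy e1 e2; apply/seteqP; split=> // v yv.
have : addS x B v by rewrite e1; exact: addSl.
case=> a xa [b Bb e]; have : (x `&` B) b.
  rewrite e2; split=> //; apply: (@subDr _ _ _ a) => //; first exact: xy.
  by rewrite e.
by case=> xb _; rewrite -e; exact: subD.
Qed.

(** By [modular_eq] each strict step survives among the [addS x B] or among the traces on [B]. It
    may survive in both, whence an inequality. *)
Lemma uchain_split A B C x n : submodule B -> C `<=` B -> B `<=` A -> submodule A ->
  submodule C -> uchain (ival A C) x n ->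
  exists a b, [/\ (n <= a + b)%N, uchain (ival A B) (addS x B) a &
                  uchain (ival B C) (x `&` B) b].
Proof.
move=> hB CB BA hA hC; elim=> {x n} [x [hx Cx xA]|x y n [hx Cx xA] xy h [a [b [hn ha hb]]]].
  exists 0%N, 0%N; split=> //; constructor.
    by split; [exact: submodule_addS|exact: addSr|exact: addS_min].
  by split; [exact: submoduleI|move=> v Cv; split; [exact: Cx|exact: CB]|move=> v []].
have [hy Cy yA] := uchain_mem h.
have i1 : ival A B (addS x B).
  by split; [exact: submodule_addS|exact: addSr|exact: addS_min].
have i2 : ival B C (x `&` B).
  by split; [exact: submoduleI|move=> v Cv; split; [exact: Cx|exact: CB]|move=> v []].
have s1 : addS x B `<=` addS y B by apply: addS_mono => //; exact: properW.
have s2 : x `&` B `<=` y `&` B by move=> v [xv Bv]; split=> //; case: xy => + _; apply.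
have [e1|ne1] := pselect (addS x B = addS y B).
  have [e2|ne2] := pselect (x `&` B = y `&` B).
    by case: (proper_neq xy); apply: (modular_eq hB) => //; exact: properW.
  exists a, b.+1; split; [by rewrite addnS|by rewrite e1|].
  by apply: UChainS hb => //; exact: sub_neq_proper.
exists a.+1, b; split; first by rewrite addSn.
  by apply: UChainS ha => //; exact: sub_neq_proper.
exact: uchain_lower hb.
Qed.

(** The top of the lower chain lies in [B], hence below the least member of the upper chain, and can
    replace it by [uchain_lower]; no step is lost at the junction. *)
Lemma uchain_cat A B C x z a b : B `<=` A -> C `<=` B ->
  uchain (ival B C) x b -> uchain (ival A B) z a -> uchain (ival A C) x (b + a).
Proof.
move=> BA CB; elim=> {x b} [x [hx Cx xB]|x y n [hx Cx xB] xy _ IH] hz.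
  rewrite add0n; have [_ Bz _] := uchain_mem hz.
  apply: uchain_lower; last by apply: uchain_sub hz; exact: ival_sub.
    by split=> //; exact: subset_trans xB BA.
  exact: subset_trans xB Bz.
by apply: UChainS xy (IH hz); split=> //; exact: subset_trans xB BA.
Qed.

Lemma flen_top A B C : C `<=` B -> flen A C -> flen A B.
Proof.
move=> CB [n hn]; exists n => x m h; apply: (hn x).
by apply: uchain_sub h; exact: ival_sub.
Qed.

Lemma flen_bot A B C : B `<=` A -> flen A C -> flen B C.
Proof.
move=> CB [n hn]; exists n => x m h; apply: (hn x).
by apply: uchain_sub h; exact: ival_sub.
Qed.

Lemma flen_trans A B C : submodule A -> submodule B -> submodule C ->
  C `<=` B -> B `<=` A -> flen A B -> flen B C -> flen A C.
Proof.
move=> hA hB hC CB BA [n hn] [m hm]; exists (n + m)%N => x k h.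
have [a [b [hk /hn ha /hm hb]]] := uchain_split hB CB BA hA hC h.
by apply: leq_trans hk _; exact: leq_add.
Qed.

Lemma lenD A B C : submodule A -> submodule B -> submodule C ->
  C `<=` B -> B `<=` A -> flen A C -> len A C = (len A B + len B C)%N.
Proof.
move=> hA hB hC CB BA h; have CA := subset_trans CB BA.
have h1 := flen_top CB h; have h2 := flen_bot BA h.
apply/eqP; rewrite eqn_leq; apply/andP; split.
  have [x /(uchain_split hB CB BA hA hC) [a [b [hn ha hb]]]] := len_chain hA hC CA h.
  apply: leq_trans hn _; apply: leq_add; first exact: len_max ha.
  exact: len_max hb.
have [x hx] := len_chain hA hB BA h1; have [y hy] := len_chain hB hC CB h2.
rewrite addnC; apply: (len_max hA hC CA h); exact: uchain_cat hy hx.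
Qed.

Lemma flen_refl A : flen A A.
Proof.
exists 0%N => x m; case=> // z y n [_ h1 h2] xy h; have [_ h3 h4] := uchain_mem h.
by case: xy => _; case; exact: subset_trans h4 h1.
Qed.

Lemma len_refl A : submodule A -> len A A = 0%N.
Proof.
move=> hA; apply/eqP; rewrite -leqn0; apply/(len_leP _ hA hA) => //; first exact: flen_refl.
move=> x m; case=> // z y n [_ h1 h2] xy h; have [_ h3 h4] := uchain_mem h.
by case: xy => _; case; exact: subset_trans h4 h1.
Qed.

Lemma len_mono A A' B B' : submodule A -> submodule A' -> submodule B -> submodule B' ->
  B' `<=` B -> B `<=` A -> A `<=` A' -> flen A' B' -> (len A B <= len A' B')%N.
Proof.
move=> hA hA' hB hB' h1 h2 h3 h; apply/len_leP => //.
  by apply: (flen_top h1); exact: flen_bot h3 h.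
move=> x m hx; apply: (@len_max _ _ x) => //; last by apply: uchain_sub hx; exact: ival_sub.
exact: subset_trans h1 (subset_trans h2 h3).
Qed.

Lemma len_proper A B C : submodule A -> submodule B -> submodule C ->
  C `<=` B -> B `<` A -> flen A C -> (len B C < len A C)%N.
Proof.
move=> hA hB hC CB BA h; rewrite (lenD hA hB hC CB (properW BA) h) -[ltnLHS]add0n ltn_add2r.
apply: (@len_max _ _ B) => //; [exact: properW|exact: flen_top h|].
apply: (@UChainS _ _ _ A) => //; last constructor.
all: by split=> //; exact: properW.
Qed.

End Lengths.

Section LengthImage.
Variables (R : comNzRingType) (V W : lmodType R) (f : V -> W).
Hypothesis hf : linear f.
Variables (A : set V) (B : set W).
Hypotheses (hA : submodule A) (hB : submodule B).

(** The first isomorphism theorem without quotients: [f] induces [A / A0 -> fA / B], and the two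
    intervals of submodules correspond by preimage and by image plus [B], both strictly monotone. *)
Let fA := addS (f @` A) B.
Let A0 := A `&` f @^-1` B.

Let hfA : submodule (f @` A). Proof. exact: submodule_image. Qed.

Let pre_ival x : ival fA B x -> ival A A0 (A `&` f @^-1` x).
Proof.
move=> [hx Bx xA]; split; first by apply: submoduleI => //; exact: submodule_preimage.
- by move=> v [Av Bv]; split=> //; exact: Bx.
- by move=> v [].
Qed.

Let im_ival x : ival A A0 x -> ival fA B (addS (f @` x) B).
Proof.
move=> [hx Bx xA]; split.
- by apply: submodule_addS => //; exact: submodule_image.
- by apply: addSr; exact: submodule_image.
- by apply: addS_mono => // _ [u /xA hu <-]; exists u.
Qed.

Let pre_proper x y : ival fA B x -> ival fA B y -> x `<` y ->
  A `&` f @^-1` x `<` A `&` f @^-1` y.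
Proof.
move=> [hx Bx xA] [hy By yA] [xy yx]; split; first by move=> v [Av xv]; split=> //; exact: xy.
move=> h; apply: yx => w yw; have [_ [v Av <-] [b Bb e]] := yA _ yw.
rewrite -e; apply: subD => //; last exact: Bx.
have : (A `&` f @^-1` y) v.
  split=> //; rewrite /preimage /= -(addrK b (f v)) e; apply: subB => //.
  exact: By.
by move/h => [].
Qed.

Let im_proper x y : ival A A0 x -> ival A A0 y -> x `<` y ->
  addS (f @` x) B `<` addS (f @` y) B.
Proof.
move=> [hx Bx xA] [hy By yA] [xy yx]; split.
  by apply: addS_mono => // _ [u /xy hu <-]; exists u.
move=> h; apply: yx => w yw.
have : addS (f @` x) B (f w) by apply: h; apply: addSl => //; exists w.
case=> _ [u xu <-] [b Bb e]; rewrite -(subrK u w); apply: subD => //.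
apply: Bx; split; first by apply: subB => //; [exact: yA|exact: xA].
by rewrite /preimage /= linear_funB // -e addrC addKr.
Qed.

Lemma uchain_image x n : uchain (ival A A0) x n -> uchain (ival fA B) (addS (f @` x) B) n.
Proof. exact: uchain_map im_ival im_proper. Qed.

Lemma len_le_image n : len_le fA B n <-> len_le A A0 n.
Proof.
split=> h x m hx.
  by apply: (h (addS (f @` x) B)); exact: uchain_image.
by apply: (h (A `&` f @^-1` x)); exact: (uchain_map pre_ival pre_proper hx).
Qed.

Lemma flen_image : flen fA B <-> flen A A0.
Proof. by split=> -[n /len_le_image h]; exists n. Qed.

Lemma len_image : flen A A0 -> len fA B = len A A0.
Proof.
move=> h; have h' := flen_image.2 h.
have i1 : submodule fA by exact: submodule_addS.
have i2 : submodule A0 by apply: submoduleI => //; exact: submodule_preimage.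
have i3 : B `<=` fA by exact: addSr.
have i4 : A0 `<=` A by move=> v [].
have H n : (len fA B <= n)%N <-> (len A A0 <= n)%N.
  by rewrite !len_leP //; exact: len_le_image.
by apply/eqP; rewrite eqn_leq; apply/andP; split; [apply/H|apply/H].
Qed.

(** When [A1] is merely contained in the kernel [A0], [A / A1] still surjects onto [fA / B]. *)
Lemma flen_image_le (A1 : set V) : submodule A1 -> A1 `<=` A -> f @` A1 `<=` B ->
  flen A A1 -> flen fA B /\ (len fA B <= len A A1)%N.
Proof.
move=> hA1 A1A fA1 h; have A10 : A1 `<=` A0.
  by move=> v v1; split; [exact: A1A|apply: fA1; exists v].
have hA0 : submodule A0 by apply: submoduleI => //; exact: submodule_preimage.
have h0 : flen A A0 by exact: flen_top h.
split; first exact/flen_image.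
by rewrite len_image //; apply: len_mono => // v [].
Qed.

End LengthImage.

(** * Growth of functions and rational polynomials *)

Section Growth.
Implicit Types (h g : nat -> nat) (t n : nat).

Lemma leq_expn_base m n k : (m <= n)%N -> (m ^ k <= n ^ k)%N.
Proof. by case: k => // k; rewrite leq_exp2r. Qed.

(* The partial sums of [h] are O(n^t); indexing by the sums makes [t = 0] mean
   that [h] is eventually zero, with no truncated exponent [t - 1]. *)
Definition cumO t h := exists C, forall n, (\sum_(i < n) h i <= C * n.+1 ^ t)%N.

Lemma cumO_zero n1 h : (forall n, n1 <= n -> h n = 0)%N -> cumO 0 h.
Proof.
move=> h0; exists (\sum_(i < n1) h i)%N => n; rewrite expn0 muln1.
elim: n => [|n IH]; first by rewrite big_ord0.
case: (leqP n1 n) => hn; first by rewrite big_ord_recr /= h0 // addn0.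
rewrite -!(big_mkord xpredT) (big_cat_nat _ hn) //= ?leq_addr //.
Qed.

Lemma cumO_le n1 t h g : (forall n, n1 <= n -> h n <= g n)%N -> cumO t g -> cumO t h.
Proof.
move=> hg [C hC]; exists (\sum_(i < n1) h i + C)%N => n.
have h1 : (\sum_(i < n) h i <= \sum_(i < n1) h i + \sum_(i < n) g i)%N.
  elim: n => [|n IH]; first by rewrite big_ord0.
  case: (leqP n1 n) => hn.
    by rewrite !big_ord_recr /= addnA; apply: leq_add IH (hg _ _).
  apply: leq_trans (leq_addr _ _).
  by rewrite -!(big_mkord xpredT) (big_cat_nat _ hn) //= ?leq_addr //.
apply: leq_trans h1 _; rewrite mulnDl leq_add //.
by rewrite leq_pmulr // expn_gt0.
Qed.

Lemma cumO_add t h g : cumO t h -> cumO t g -> cumO t (fun n => h n + g n)%N.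
Proof.
move=> [C hC] [D hD]; exists (C + D)%N => n.
by rewrite big_split mulnDl leq_add.
Qed.

Lemma cumO_bound n1 t h C : (forall n, n1 <= n -> h n <= C * n.+1 ^ t)%N -> cumO t.+1 h.
Proof.
move=> hC; apply: (cumO_le hC); exists C => n.
apply: (@leq_trans (\sum_(i < n) C * n.+1 ^ t)%N).
  apply: leq_sum => i _; rewrite leq_mul2l leq_expn_base ?orbT // ltnS ltnW //.
by rewrite sum_nat_const card_ord expnS mulnCA leq_mul2l leq_mul2r leqnSn !orbT.
Qed.

(** Descending in steps of [n0] gives [h n <= K + g 0 + ... + g n], where [K] covers the starting
    values. So [h] is pointwise O(n^t), and summation costs one more power. *)
Lemma cumO_step n0 n1 t h g : (0 < n0)%N ->
  (forall n, n1 <= n -> h (n + n0) <= g (n + n0) + h n)%N ->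
  cumO t g -> cumO t.+1 h.
Proof.
move=> n0_gt0 hh [C hC]; set K := (\sum_(i < n0 + n1) h i)%N.
have h1 n : (h n <= K + \sum_(j < n.+1) g j)%N.
  elim/ltn_ind: n => n IH; case: (ltnP n (n0 + n1)) => hn.
    apply: leq_trans (leq_addr _ _).
    by rewrite /K (bigD1 (Ordinal hn)) //= leq_addr.
  have e : n = (n - n0 + n0)%N by lia.
  have h2 : (h n <= g n + h (n - n0))%N by rewrite {1 2}e; apply: hh; lia.
  apply: leq_trans h2 _; rewrite big_ord_recr /= addnA addnC leq_add2r.
  apply: leq_trans (IH _ _) _; first by lia.
  rewrite leq_add2l; have hnn : ((n - n0).+1 <= n)%N by lia.
  by rewrite -!(big_mkord xpredT) [leqRHS](big_cat_nat _ hnn) //= leq_addr.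
apply: (@cumO_bound 0 t h (K + C * 2 ^ t)%N) => n _; apply: leq_trans (h1 n) _.
rewrite mulnDl leq_add //; first by rewrite leq_pmulr // expn_gt0.
apply: leq_trans (hC _) _; rewrite -mulnA -expnMn leq_mul2l leq_expn_base ?orbT //.
by lia.
Qed.

(** At [n = m + r] the binomial is at least [m ^ r / r!], so [m ^ r <= D * m ^ t] for all positive
    [m]; if [t < r] this fails at [m = D + 1]. *)
Lemma binomial_growth r t e C :
  (forall n, 'C(n, r) <= C * (e * n).+2 ^ t)%N -> (r <= t)%N.
Proof.
move=> H; rewrite leqNgt; apply/negP => tr.
have h1 m : (m ^ r <= 'C(m + r, r) * r`!)%N.
  rewrite bin_ffact ffact_prod -[X in (_ ^ X)%N](card_ord r) -prod_nat_const.
  by apply: leq_prod => i _; have := ltn_ord i; lia.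
(* The base comes from [e * (m + r) + 2 <= (e * r.+1 + 2) * m] for [m >= 1]; the factorial clears
   the denominator of the binomial. *)
set D := (C * (e * r.+1 + 2) ^ t * r`!)%N.
have h2 m : (0 < m)%N -> (m ^ r <= D * m ^ t)%N.
  move=> m0; apply: leq_trans (h1 m) _; rewrite /D mulnAC leq_mul //.
  apply: leq_trans (H _) _; rewrite -mulnA leq_mul // -expnMn.
  by apply: leq_expn_base; nia.
have := h2 D.+1 isT; rewrite -(subnK (ltnW tr)) expnD leq_pmul2r ?expn_gt0 //.
have -> : (r - t = (r - t).-1.+1)%N by lia.
rewrite expnS => h3; have := leq_trans (leq_pmulr D.+1 _) h3.
by rewrite expn_gt0 => /(_ isT); rewrite ltnn.
Qed.

End Growth.

Section RatPoly.
Implicit Types (p q Q : {poly rat}).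

Definition fdiff q := q \Po ('X + 1) - q.

Lemma fdiffE q x : (fdiff q).[x] = q.[x + 1] - q.[x].
Proof. by rewrite /fdiff hornerD hornerN horner_comp !hornerE. Qed.

Lemma fdiff_Xn n : fdiff 'X^n = \poly_(i < n) ('C(n, i)%:R : rat).
Proof.
rewrite /fdiff comp_Xn_poly exprD1n big_ord_recr /= binn mulr1n addrK poly_def.
by apply: eq_bigr => i _; rewrite -scaler_nat.
Qed.

Lemma fdiff_sum q : fdiff q = \sum_(i < size q) q`_i *: fdiff 'X^i.
Proof.
transitivity (\sum_(i < size q) q`_i *: ('X + 1) ^+ i - \sum_(i < size q) q`_i *: 'X^i).
  by rewrite -poly_def coefK -comp_polyE.
rewrite -sumrB; apply: eq_bigr => i _; by rewrite /fdiff comp_Xn_poly scalerBr.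
Qed.

Lemma size_fdiff q : (size (fdiff q) <= (size q).-1)%N.
Proof.
rewrite fdiff_sum; apply: leq_trans (size_sum _ _ _) _; apply/bigmax_leqP => i _.
apply: leq_trans (size_scale_leq _ _) _; rewrite fdiff_Xn.
by apply: leq_trans (size_poly _ _) _; have := ltn_ord i; lia.
Qed.

Lemma fdiffD p q : fdiff (p + q) = fdiff p + fdiff q.
Proof. by rewrite /fdiff comp_polyD; ring. Qed.

Lemma fdiffZ c q : fdiff (c *: q) = c *: fdiff q.
Proof. by rewrite /fdiff comp_polyZ scalerBr. Qed.

(** Induction on the size: the difference of [c *: 'X^n.+1] has leading coefficient [c * n.+1], so a
    suitable rational [c] cancels the leading term of [q]. *)
Lemma fdiff_surj q : exists Q, fdiff Q = q.
Proof.
have [n] := ubnP (size q); elim: n => // n IH in q *; rewrite ltnS => hq.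
case: n IH hq => [|n] IH hq.
  by exists 0; move: hq; rewrite leqn0 size_poly_eq0 => /eqP ->; rewrite /fdiff comp_poly0 subr0.
pose c := q`_n / n.+1%:R.
have [|Q hQ] := IH (q - c *: fdiff 'X^(n.+1)).
  rewrite ltnS; apply/leq_sizeP => j hj.
  rewrite coefB coefZ fdiff_Xn coef_poly; have [->|ne] := eqVneq j n.
    by rewrite ltnSn binSn /c mulfVK ?subrr // pnatr_eq0.
  have nj : (n < j)%N by rewrite ltn_neqAle eq_sym ne.
  by rewrite ltnS leqNgt nj mulr0 subr0 nth_default //; apply: leq_trans hq _.
by exists (Q + c *: 'X^(n.+1)); rewrite fdiffD fdiffZ hQ subrK.
Qed.

Lemma horner_bound q : exists2 C, 0 <= C &
  forall n : nat, `|q.[n%:R]| <= C * (n.+1 ^ (size q).-1)%:R.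
Proof.
exists (\sum_(i < size q) `|q`_i|); first by apply: sumr_ge0.
move=> n; rewrite horner_coef; apply: le_trans (ler_norm_sum _ _ _) _.
rewrite mulr_suml; apply: ler_sum => i _; rewrite normrM ler_wpM2l //.
rewrite normrX ger0_norm // -natrX ler_nat.
apply: (@leq_trans (n.+1 ^ i)%N); first exact: leq_expn_base.
by rewrite leq_pexp2l //; have := ltn_ord i; lia.
Qed.

(** If the degree [d] exceeded [t], the leading term [c * n ^ d] would be bounded by a multiple of
    [n ^ d.-1], since both [q] and its remainder [q1] are; then [n] itself would be bounded. The
    factor [2 ^+ d] passes from [n.+1] to [n]. *)
Lemma size_horner_bound q t N (C : rat) :
  (forall n : nat, (N <= n)%N -> `|q.[n%:R]| <= C * (n.+1 ^ t)%:R) ->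
  (size q <= t.+1)%N.
Proof.
move=> H; rewrite leqNgt; apply/negP => hs.
pose d := (size q).-1; have q0 : q != 0 by apply: contraTneq hs => ->; rewrite size_poly0.
pose c := lead_coef q; have c0 : c != 0 by rewrite lead_coef_eq0.
pose q1 := q - c *: 'X^d.
have [K K0 hK] := horner_bound q1.
have s1 : (size q1 <= d)%N.
  apply/leq_sizeP => j hj; rewrite coefB coefZ coefXn.
  have [->|ne] := eqVneq j d; first by rewrite mulr1 subrr.
  have dj : (d < j)%N by rewrite ltn_neqAle eq_sym ne.
  by rewrite mulr0 subr0 nth_default //; exact: leq_trans (leqSpred _) dj.
have td : (t <= d.-1)%N by rewrite /d; lia.
have d0 : (0 < d)%N by rewrite /d; lia.
have hn (n : nat) : (N <= n)%N -> (0 < n)%N -> n%:R <= (`|C| + K) * 2 ^+ d / `|c|.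
  move=> Nn n0; rewrite ler_pdivlMr ?normr_gt0 // mulrC.
  have P0 : 0 < (n ^ d.-1)%:R :> rat by rewrite ltr0n expn_gt0 n0.
  rewrite -(ler_pM2r P0) -mulrA -natrM -expnS prednK //.
  have -> : `|c| * (n ^ d)%:R = `|q.[n%:R] - q1.[n%:R]|.
    rewrite /q1 hornerD hornerN hornerZ hornerXn opprB addrC subrK normrM.
    by rewrite -natrX [`|_%:R|]ger0_norm.
  apply: le_trans (ler_normB _ _) _.
  have e (a b : nat) : (a <= d.-1)%N -> (n.+1 ^ a)%:R <= 2 ^+ d * (n ^ d.-1)%:R :> rat.
    move=> ha; rewrite -natrX -natrM ler_nat.
    apply: (@leq_trans ((2 * n) ^ d.-1)%N).
      apply: (@leq_trans (n.+1 ^ d.-1)%N); first by rewrite leq_pexp2l.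
      by apply: leq_expn_base; lia.
    by rewrite expnMn leq_mul // leq_pexp2l // leq_pred.
  rewrite -mulrA mulrDl; apply: lerD.
    apply: le_trans (H _ Nn) _.
    apply: (@le_trans _ _ (`|C| * (n.+1 ^ t)%:R)); first by rewrite ler_wpM2r // ler_norm.
    by rewrite ler_wpM2l // e.
  apply: le_trans (hK _) _; rewrite ler_wpM2l // e //.
  by move: s1; lia.
set x := (`|C| + K) * 2 ^+ d / `|c| in hn.
have x0 : 0 <= x by rewrite /x !mulr_ge0 ?addr_ge0 ?exprn_ge0 ?invr_ge0.
have := hn (maxn N (Num.bound x)).+1; rewrite ltnW ?ltnS ?leq_maxl // => /(_ isT isT).
apply/negP; rewrite -ltNge; apply: lt_le_trans (archi_boundP x0) _.
by rewrite ler_nat ltnW // ltnS leq_maxr.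
Qed.

(** An antidifference of [q] is shifted by a constant to agree with [h] at [N]; agreement then
    propagates, because both have the same increments. *)
Lemma hilb_antidiff (h : nat -> nat) N q :
  (forall n, (N <= n)%N -> (h n.+1)%:R = (h n)%:R + q.[n%:R] :> rat) ->
  exists Q, forall n, (N <= n)%N -> Q.[n%:R] = (h n)%:R.
Proof.
move=> H; have [Q hQ] := fdiff_surj q.
exists (Q + ((h N)%:R - Q.[N%:R])%:P) => n Nn.
rewrite hornerD hornerC -(subnKC Nn); elim: (n - N)%N => [|k IH].
  by rewrite addn0 addrC subrK.
have := fdiffE Q (N + k)%:R; rewrite addnS H ?leq_addr // -{1}IH hQ => ->.
by rewrite -natr1; ring.
Qed.

(** [cumO] controls sums and not values, so the bound is applied to an antidifference [Q] of [q],
    which is O(n^t); passing back to [q] lowers the size by one. *)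
Lemma hilb_degree (h : nat -> nat) N q t :
  (forall n, (N <= n)%N -> q.[n%:R] = (h n)%:R) -> cumO t h -> (size q <= t)%N.
Proof.
move=> H [C hC]; have [Q hQ] := fdiff_surj q.
suff : (size Q <= t.+1)%N by have := size_fdiff Q; rewrite hQ; lia.
apply: (@size_horner_bound Q t N (`|Q.[N%:R]| + C%:R)) => n Nn.
have -> : Q.[n%:R] = Q.[N%:R] + (\sum_(N <= i < n) h i)%:R.
  rewrite -(subnKC Nn); elim: (n - N)%N => [|k IH].
    by rewrite addn0 big_geq // addr0.
  rewrite addnS big_nat_recr ?leq_addr //= natrD addrA -IH -H ?leq_addr //.
  by rewrite -hQ fdiffE natr1; ring.
apply: le_trans (ler_normD _ _) _; rewrite mulrDl lerD //.
  by rewrite ler_peMr // ler1n expn_gt0.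
rewrite ger0_norm // -natrM ler_nat; apply: leq_trans (hC n).
by rewrite -(big_mkord xpredT) [leqRHS](big_cat_nat _ Nn) //= leq_addl.
Qed.

Lemma hilb_cumO (h : nat -> nat) N q t :
  (forall n, (N <= n)%N -> q.[n%:R] = (h n)%:R) -> (size q <= t)%N -> cumO t h.
Proof.
move=> H; case: t => [|t] hs.
  apply: (@cumO_zero N) => n Nn; apply/eqP; rewrite -(eqr_nat rat) -H //.
  by move: hs; rewrite leqn0 size_poly_eq0 => /eqP ->; rewrite horner0.
have [C C0 hC] := horner_bound q.
apply: (@cumO_bound N t h (Num.bound C)) => n Nn.
rewrite -(ler_nat rat) natrM -H //; apply: le_trans (ler_norm _) _.
apply: le_trans (hC n) _; apply: ler_pM => //; first exact: ltW (archi_boundP C0).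
by rewrite ler_nat leq_pexp2l //; lia.
Qed.

End RatPoly.

(** * Hilbert's basis theorem *)

Lemma ex_choice X Y (P : X -> Y -> Prop) :
  (forall x, exists y, P x y) -> exists f : X -> Y, forall x, P x (f x).
Proof. by move=> /choice [f hf]; exists f. Qed.

Section LinearSpan.
Variable S : comNzRingType.
Implicit Types (B J X Y : set S) (x y : S) (xs : seq S).

Definition is_subring B := [/\ B 1, forall x y, B x -> B y -> B (x - y) &
  forall x y, B x -> B y -> B (x * y)].

Lemma subring0 B : is_subring B -> B 0.
Proof. by case=> h1 hB _; rewrite -(subrr 1); apply: hB. Qed.

Lemma subringN B x : is_subring B -> B x -> B (- x).
Proof. by move=> hB hx; rewrite -sub0r; case: (hB) => _ + _; apply => //; exact: subring0. Qed.

Lemma subringD B x y : is_subring B -> B x -> B y -> B (x + y).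
Proof.
move=> hB hx hy; rewrite -[y]opprK; case: (hB) => _ + _; apply => //.
exact: subringN.
Qed.

Definition stable_by B J :=
  [/\ J 0, forall x y, J x -> J y -> J (x + y) & forall b x, B b -> J x -> J (b * x)].

(** The [B]-submodule of [S] generated by [X]. For [X] inside a subring [B] it is the ideal of [B]
    generated by [X], obtained without making [B] a type. *)
Definition lin B X : set S := smallest (stable_by B) X.

Lemma lin_stable B X : stable_by B (lin B X).
Proof.
split=> [J [[h _ _] _]//|x y hx hy J hJ|b x hb hx J hJ]; case: (hJ) => -[h0 hD hM] XJ.
  by apply: hD; [exact: hx|exact: hy].
by apply: hM => //; exact: hx.
Qed.

Lemma lin_gen B X : X `<=` lin B X. Proof. exact: sub_gen_smallest. Qed.

Lemma lin_min B X J : stable_by B J -> X `<=` J -> lin B X `<=` J.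
Proof. exact: smallest_sub. Qed.

Lemma lin_mono B X Y : X `<=` Y -> lin B X `<=` lin B Y.
Proof.
by move=> h; apply: lin_min; [exact: lin_stable|move=> x /h; exact: lin_gen].
Qed.

Lemma lin_trans B X Y : X `<=` lin B Y -> lin B X `<=` lin B Y.
Proof. by move=> h; apply: lin_min => //; exact: lin_stable. Qed.

Lemma lin_sum B X n (F : nat -> S) :
  (forall i, (i < n)%N -> lin B X (F i)) -> lin B X (\sum_(i < n) F i).
Proof.
have [h0 hD _] := lin_stable B X.
elim: n => [|n IH] h; first by rewrite big_ord0.
by rewrite big_ord_recr /=; apply: hD; [apply: IH => i hi; apply: h; exact: ltnW|exact: h].
Qed.

Lemma lin_finite B X x : lin B X x ->
  exists2 xs : seq S, [set` xs] `<=` X & lin B [set` xs] x.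
Proof.
move: x; suff h : lin B X `<=` [set x | exists2 xs : seq S, [set` xs] `<=` X & lin B [set` xs] x] by exact: h.
apply: lin_min; last first.
  move=> x hx; exists [:: x]; first by move=> y /=; rewrite inE => /eqP ->.
  by apply: lin_gen; rewrite /= inE.
split.
- by exists [::] => //; case: (lin_stable B [set` [::]]).
- move=> x y [xs hxs hx] [ys hys hy]; exists (xs ++ ys).
    by move=> z /=; rewrite mem_cat => /orP [/hxs|/hys].
  case: (lin_stable B [set` xs ++ ys]) => _ hD _; apply: hD.
    by apply: lin_mono hx => z /= hz; rewrite mem_cat hz.
  by apply: lin_mono hy => z /= hz; rewrite mem_cat hz orbT.
- move=> b x hb [xs hxs hx]; exists xs => //.
  by case: (lin_stable B [set` xs]) => _ _; apply.
Qed.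

Lemma lin_range B n (f : nat -> S) x : is_subring B ->
  lin B [set f i | i in [set i | (i < n)%N]] x ->
  exists2 c : nat -> S, (forall i, B (c i)) & x = \sum_(i < n) c i * f i.
Proof.
move=> hB; have B0 := subring0 hB; have [B1 _ BM] := hB.
suff h : lin B [set f i | i in [set i | (i < n)%N]] `<=`
  [set x | exists2 c : nat -> S, (forall i, B (c i)) & x = \sum_(i < n) c i * f i] by exact: h.
apply: lin_min; last first.
  move=> _ [i hi <-]; exists (fun j => (j == i)%:R); first by move=> j; case: (j == i).
  rewrite (bigD1 (Ordinal hi)) //= eqxx mul1r big1 ?addr0 // => j ne.
  by rewrite (_ : _ == _ = false) ?mul0r //; apply/negbTE.
split.
- by exists (fun=> 0) => //; rewrite big1 // => i _; rewrite mul0r.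
- move=> u v [c hc ->] [d hd ->]; exists (fun i => c i + d i); first by move=> i; apply: subringD.
  by rewrite -big_split; apply: eq_bigr => i _; rewrite mulrDl.
- move=> b u hb [c hc ->]; exists (fun i => b * c i); first by move=> i; apply: BM.
  by rewrite mulr_sumr; apply: eq_bigr => i _; rewrite mulrA.
Qed.

(** Stated for arbitrary subsets, with generators taken from [X] itself. Hence a sequence yields a
    relation among its terms, and a union of homogeneous pieces yields homogeneous generators. *)
Definition noeth B := forall X, X `<=` B ->
  exists2 xs : seq S, [set` xs] `<=` X & X `<=` lin B [set` xs].

Lemma noeth_sequence B (a : nat -> S) : is_subring B -> noeth B -> (forall i, B (a i)) ->
  exists m, exists2 c : nat -> S, (forall i, B (c i)) & a m = \sum_(i < m) c i * a i.
Proof.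
move=> hB hn ha.
have [|xs hxs hX] := hn (range a); first by move=> _ [i _ <-].
have [m hm] : exists m, [set` xs] `<=` [set a i | i in [set i | (i < m)%N]].
  elim: xs hxs {hX} => [|x xs IH] hxs; first by exists 0%N.
  have [|m hm] := IH; first by move=> y hy; apply: hxs; rewrite /= inE; apply/orP; right.
  have [i _ hi] : range a x by apply: hxs; rewrite /= inE eqxx.
  exists (maxn m i.+1) => y /=; rewrite inE => /orP [/eqP ->|/hm [j hj <-]].
    by exists i => //=; rewrite leq_maxr.
  by exists j => //=; apply: leq_trans hj _; rewrite leq_maxl.
exists m; apply: lin_range => //; apply: (lin_mono hm).
by apply: hX; exists m.
Qed.

End LinearSpan.

Lemma lin_morph (S T : comNzRingType) (f : {rmorphism S -> T}) B X x :
  lin B X x -> lin (f @` B) (f @` X) (f x).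
Proof.
have [h0 hD hM] := lin_stable (f @` B) (f @` X).
suff h : lin B X `<=` f @^-1` lin (f @` B) (f @` X) by exact: h.
apply: lin_min; last by move=> y hy; apply: lin_gen; exists y.
split; first by rewrite /preimage /= rmorph0.
  by move=> u v hu hv; rewrite /preimage /= rmorphD; exact: hD.
by move=> b u hb hu; rewrite /preimage /= rmorphM; apply: hM => //; exists b.
Qed.

Lemma noeth_image (S T : comNzRingType) (f : {rmorphism S -> T}) B :
  noeth B -> noeth (f @` B).
Proof.
move=> hB X XB; have [|xs hxs hX] := hB (B `&` f @^-1` X); first by move=> x [].
exists (map f xs) => [y /=/mapP [x hx ->]|y Xy]; first by case: (hxs _ hx).
have [x Bx e] := XB _ Xy; rewrite -e.
have hx : lin B [set` xs] x by apply: hX; split=> //; rewrite /preimage /= e.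
have h := @lin_morph _ _ f _ _ _ hx; apply: (lin_mono _ h) => _ [z hz <-]; exact: map_f.
Qed.

Lemma noeth_setT (R : comNzRingType) : noetherian R -> noeth [set: R].
Proof.
move=> hR X _.
have linE Y : lin [set: R] Y = @span R R^o Y.
  apply/seteqP; split.
    apply: lin_min; last exact: (@span_gen R R^o).
    have h := @submodule_span R R^o Y; split; first exact: sub0 h.
      by move=> x y hx hy; exact: (subD h hx hy).
    by move=> b x _ hx; exact: (subZ b h hx).
  apply: (@span_min R R^o); last exact: lin_gen.
  have [h0 hD hM] := lin_stable [set: R] Y; split=> // a u v hu hv.
  by apply: hD => //; apply: hM.
have [n [x hx]] : @fin_gen R R^o (@span R R^o X) by apply: hR; exact: (@submodule_span R R^o).
have hxX i : lin [set: R] X (x i) by rewrite linE hx; apply: (@span_gen R R^o); exists i.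
(* The generators [x] need not lie in [X]; each is replaced by the finitely many members of [X] that
   it is a combination of. *)
have [xs hxs] : exists xs : 'I_n -> seq R,
    forall i, [set` xs i] `<=` X /\ lin [set: R] [set` xs i] (x i).
  apply: (@ex_choice _ _ (fun i xs => [set` xs] `<=` X /\ lin [set: R] [set` xs] (x i))) => i.
  have [xs h1 h2] := lin_finite (hxX i); by exists xs.
exists (flatten [seq xs i | i <- enum 'I_n]).
  by move=> y /= /flattenP [s /mapP [i _ ->]] /(hxs i).1.
apply: subset_trans (@lin_gen _ [set: R] X) _.
rewrite linE hx -linE; apply: lin_trans => _ [i _ <-].
apply: lin_mono (hxs i).2 => y /= hy; apply/flattenP; exists (xs i) => //.
by apply/mapP; exists i; rewrite ?mem_enum.
Qed.

Section HilbertBasis.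
Variables (S : comNzRingType) (B : set S).
Hypotheses (hB : is_subring B) (hN : noeth B).
Implicit Types (f g : {poly S}).

Definition coefs_in : set {poly S} := [set f | forall i, B f`_i].

Lemma coefs_in_subring : is_subring coefs_in.
Proof.
have B0 := subring0 hB; have [B1 BB BM] := hB; split.
- by move=> i; rewrite coef1; case: (i == 0%N).
- by move=> f g hf hg i; rewrite coefB; apply: BB.
- move=> f g hf hg i; rewrite coefM.
  elim/big_ind: _ => // [x y|j _]; [exact: subringD|exact: BM].
Qed.

Lemma coefs_in_Xn n : coefs_in 'X^n.
Proof.
move=> i; rewrite coefXn; have [B1 _ _] := hB; case: (_ == _) => //.
exact: subring0.
Qed.

Lemma coefs_inC c : B c -> coefs_in c%:P.
Proof. by move=> hc i; rewrite coefC; case: (_ == _) => //; exact: subring0. Qed.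

(* Otherwise choose repeatedly an element of least size outside the ideal of
   the previous ones; a relation among leading coefficients lowers the size. *)
Lemma hilbert_basis_ideal (J : set {poly S}) : J `<=` coefs_in -> stable_by coefs_in J ->
  exists2 fs : seq {poly S}, [set` fs] `<=` J & J `<=` lin coefs_in [set` fs].
Proof.
move=> JB hJ; apply: contrapT => hnot; have [J0 JD JM] := hJ.
have step (fs : seq {poly S}) : exists f, [set` fs] `<=` J ->
    [/\ J f, ~ lin coefs_in [set` fs] f &
        forall g, J g -> ~ lin coefs_in [set` fs] g -> (size f <= size g)%N].
  have [hfs|nfs] := pselect ([set` fs] `<=` J); last by exists 0.
  have [f [Jf nf]] : exists f, J f /\ ~ lin coefs_in [set` fs] f.
    apply: contrapT => h; apply: hnot; exists fs => // f Jf; apply: contrapT => nf.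
    by apply: h; exists f.
  pose P n := `[< exists g, [/\ J g, ~ lin coefs_in [set` fs] g & size g = n] >].
  have : exists n, P n by exists (size f); apply/asboolP; exists f.
  case/ex_minnP => n /asboolP [g [Jg ng <-]] hmin; exists g => _; split=> // g' Jg' ng'.
  by apply: hmin; apply/asboolP; exists g'.
have [sel hsel] := choice step.
pose L := fix L n := if n is n'.+1 then rcons (L n') (sel (L n')) else [::].
have LJ n : [set` L n] `<=` J.
  elim: n => [|n IH] //= f /=; rewrite mem_rcons inE => /orP [/eqP ->|/IH //].
  by case: (hsel _ IH).
pose F n := sel (L n).
have LF n : [set` L n] = [set F i | i in [set i | (i < n)%N]].
  elim: n => [|n IH]; first by apply/seteqP; split=> // f [].
  apply/seteqP; split=> f /=.
    rewrite mem_rcons inE => /orP [/eqP ->|hf]; first by exists n => /=.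
    have : [set` L n] f by []. 
    by rewrite IH => -[i /= hi <-]; exists i => //=; apply: ltnW.
  case=> i; rewrite ltnS leq_eqVlt => /orP [/eqP ->|hi] <-; rewrite mem_rcons inE ?eqxx //.
  apply/orP; right; have : [set` L n] (F i) by rewrite IH; exists i.
  by [].
have FJ n : J (F n) by case: (hsel _ (LJ n)).
have nF n : ~ lin coefs_in [set` L n] (F n) by case: (hsel _ (LJ n)).
have sF i m : (i <= m)%N -> (size (F i) <= size (F m))%N.
  move=> im; case: (hsel _ (LJ i)) => _ _; apply => // h; apply: (nF m).
  apply: lin_mono h; rewrite !LF => _ [j /= hj <-]; exists j => //=.
  exact: leq_trans hj im.
have [m [c hc e]] := noeth_sequence hB hN (fun i => JB _ (FJ i) (size (F i)).-1).
(* The power of ['X] raises [F i] to the size of [F m]; by [sF] the subtraction is not truncated.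
   Subtracting the sum of the [h i] cancels the leading coefficient of [F m]. *)
pose h i := c i *: ('X^(size (F m) - size (F i)) * F i).
pose s := \sum_(i < m) h i.
have hs : lin coefs_in [set` L m] s.
  apply: lin_sum => i hi; have [_ _ hM] := lin_stable coefs_in [set` L m].
  rewrite /h -mul_polyC; apply: (hM _ _ (coefs_inC (hc i))); apply: (hM _ _ (coefs_in_Xn _)).
  by apply: lin_gen; rewrite LF; exists i.
have Js : J s by apply: (lin_min hJ (LJ m)).
have Jg : J (F m - s).
  apply: JD => //; rewrite -mulN1r; apply: JM => //.
  by apply: subringN coefs_in_subring _; case: coefs_in_subring.
have F0 i : F i != 0.
  apply/eqP => e0; apply: (nF i); rewrite e0.
  by case: (lin_stable coefs_in [set` L i]).
have ng : ~ lin coefs_in [set` L m] (F m - s).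
  move=> hg; apply: (nF m); rewrite -(subrK s (F m)).
  by case: (lin_stable coefs_in [set` L m]) => _ + _; apply.
have : (size (F m) <= size (F m - s)%R)%N by case: (hsel _ (LJ m)) => _ _; apply.
apply/negP; rewrite -ltnNge.
have sm : (0 < size (F m))%N by rewrite size_poly_gt0.
rewrite -(prednK sm) ltnS; apply/leq_sizeP => j; rewrite leq_eqVlt => /orP [/eqP <-|hj].
  rewrite coefB e /s coef_sum -sumrB big1 // => i _.
  rewrite /h coefZ coefXnM; have := sF i m (ltnW (ltn_ord i)).
  have : (0 < size (F i))%N by rewrite size_poly_gt0.
  move: (size (F i)) (size (F m)) sm => a b a0 b0 ab.
  rewrite (_ : (b.-1 < b - a)%N = false); last by apply/negbTE; lia.
  by rewrite (_ : (b.-1 - (b - a) = a.-1)%N) ?subrr //; lia.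
rewrite coefB nth_default; last by rewrite -(prednK sm).
rewrite /s coef_sum big1 ?subrr // => i _; rewrite /h coefZ coefXnM.
case: ifP => // hij; first by rewrite mulr0.
have := sF i m (ltnW (ltn_ord i)) => hh; rewrite nth_default ?mulr0 //.
by move: hij hj hh sm; move: (size (F i)) (size (F m)) => a b; lia.
Qed.

Definition adjoin (t : S) : set S := [set f.[t] | f in coefs_in].

Lemma adjoin_subring t : is_subring (adjoin t).
Proof.
have [h1 hS hM] := coefs_in_subring; split.
- by exists 1 => //; rewrite hornerC.
- move=> _ _ [f hf <-] [g hg <-]; exists (f - g); first exact: hS.
  by rewrite hornerD hornerN.
- move=> _ _ [f hf <-] [g hg <-]; exists (f * g); first exact: hM.
  by rewrite hornerM.
Qed.

Lemma sub_adjoin t : B `<=` adjoin t.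
Proof. by move=> b hb; exists b%:P; [exact: coefs_inC|rewrite hornerC]. Qed.

Lemma gen_adjoin t : adjoin t t.
Proof. by exists 'X; [have := coefs_in_Xn 1; rewrite expr1|rewrite hornerX]. Qed.

Lemma adjoin_min t (C : set S) : is_subring C -> B `<=` C -> C t -> adjoin t `<=` C.
Proof.
move=> hC BC Ct _ [f hf <-]; rewrite horner_coef; have [C1 _ CM] := hC.
elim: (size f) => [|n IH]; first by rewrite big_ord0; exact: subring0.
rewrite big_ord_recr /=; apply: subringD => //; apply: (CM); first exact: BC.
by elim: n {IH} => [|n IH]; rewrite ?expr0 // exprS; apply: CM.
Qed.

(** The polynomials whose value at [t] lies in the ideal generated by [X] form an ideal, finitely
    generated by [hilbert_basis_ideal]. The value of each generator involves only finitely many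
    members of [X], and these suffice. *)
Theorem hilbert_basis t : noeth (adjoin t).
Proof.
move=> X XB; have [h0 hD hM] := lin_stable (adjoin t) X.
pose J := coefs_in `&` [set f | lin (adjoin t) X f.[t]].
have [||fs hfs hJ] := @hilbert_basis_ideal J; first by move=> f [].
  have c0 := subring0 coefs_in_subring; have [_ _ cM] := coefs_in_subring.
  split; first by split=> //=; rewrite horner0.
    move=> f g [f1 f2] [g1 g2]; split; first exact: (subringD coefs_in_subring).
    by rewrite /= hornerD; apply: hD.
  move=> f g f1 [g1 g2]; split; first exact: cM.
  by rewrite /= hornerM; apply: hM => //; exists f.
have [xs hxs] : exists xs : {poly S} -> seq S, forall f, f \in fs ->
    [set` xs f] `<=` X /\ lin (adjoin t) [set` xs f] f.[t].
  apply: (@ex_choice _ _ (fun f xs => f \in fs ->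
    [set` xs] `<=` X /\ lin (adjoin t) [set` xs] f.[t])) => f; case: (boolP (f \in fs)) => [/hfs [_ /= /lin_finite [xs h1 h2]]|_].
    by exists xs.
  by exists [::].
exists (flatten (map xs fs)).
  by move=> y /= /flattenP [s /mapP [f /hxs [h _] ->]] /h.
move=> x Xx; have [f hf e] := XB _ Xx.
have : lin coefs_in [set` fs] f by apply: hJ; split=> //=; rewrite e; apply: lin_gen.
move/(@lin_morph _ _ (horner_eval t)); rewrite /= /horner_eval e.
apply: (@lin_trans _ (adjoin t)) => _ [g /= hg <-].
apply: lin_mono (hxs g hg).2 => y /= hy; apply/flattenP; exists (xs g) => //.
exact: map_f.
Qed.

End HilbertBasis.

(** * Noetherian local rings *)

Section NoetherianInduction.
Variables (S : comNzRingType) (B : set S).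
Hypothesis hN : noeth B.

(** A failure could be enlarged again and again inside [C]. The union of the resulting strict chain
    is generated by finitely many elements, all present at some stage, where the chain must stop.
    The class [C] allows induction over homogeneous ideals only. *)
Lemma noeth_ind (C : set (set S)) (Pr : set S -> Prop) :
  (forall J, C J -> J `<=` B /\ stable_by B J) ->
  (forall J, C J -> (forall J', C J' -> J `<` J' -> Pr J') -> Pr J) ->
  forall J, C J -> Pr J.
Proof.
move=> hC hI J CJ; apply: contrapT => nJ.
have step (K : set S) : exists K', C K -> ~ Pr K -> [/\ C K', ~ Pr K' & K `<` K'].
  have [CK|nC] := pselect (C K); last by exists K.
  have [PK|nP] := pselect (Pr K); first by exists K.
  have : ~ (forall J', C J' -> K `<` J' -> Pr J') by move=> h; apply: nP; exact: hI.
  move/existsNP => [K' /not_implyP [CK' /not_implyP [h nP']]].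
  by exists K'.
have [nxt hn] := ex_choice step.
pose L n := iter n nxt J.
have hL n : C (L n) /\ ~ Pr (L n).
  by elim: n => [|n [h1 h2]] //; have [] := hn _ h1 h2.
have hs n : L n `<` L n.+1 by have [h1 h2] := hL n; have [] := hn _ h1 h2.
have mono i j : (i <= j)%N -> L i `<=` L j.
  move=> ij; rewrite -(subnKC ij); elim: (j - i)%N => [|k IH]; first by rewrite addn0.
  by rewrite addnS; apply: subset_trans IH (properW _).
have [|xs hxs hX] := hN (X := \bigcup_n L n).
  by move=> x [n _ hx]; exact: (hC _ (hL n).1).1.
have [m hm] : exists m, [set` xs] `<=` L m.
  elim: xs hxs {hX} => [|x xs IH] hxs; first by exists 0%N.
  have [|m hm] := IH; first by move=> y hy; apply: hxs; rewrite /= inE; apply/orP; right.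
  have [n _ hx] : (\bigcup_n L n) x by apply: hxs; rewrite /= inE eqxx.
  exists (maxn m n) => y /=; rewrite inE => /orP [/eqP ->|/hm hy].
    by apply: mono hx; exact: leq_maxr.
  by apply: mono hy; exact: leq_maxl.
have [_] := hs m; apply; apply: (@subset_trans _ (\bigcup_n L n)).
  by move=> x hx; exists m.+1.
by apply: subset_trans hX _; apply: lin_min hm; exact: (hC _ (hL m).1).2.
Qed.

End NoetherianInduction.

Section LocalRing.
Variables (R : comNzRingType) (m : set R).
Hypotheses (hnoeth : noetherian R) (hlocal : local_ring m).

Lemma ideal_stable (J : set R) : ideal J <-> stable_by [set: R] J.
Proof.
split=> [h|[h0 hD hM]].
  split; first exact: sub0 h.
    by move=> x y hx hy; exact: (subD h hx hy).
  by move=> b x _ hx; exact: (subZ b h hx).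
by split=> // a u v hu hv; apply: hD => //; apply: hM.
Qed.

(** Noetherian induction: a proper ideal below no larger proper ideal is maximal, hence is [m];
    otherwise the larger ideal already lies in [m]. *)
Lemma proper_ideal_sub (J : set R) : ideal J -> ~ J 1 -> J `<=` m.
Proof.
have [hm huniq] := hlocal; have hNR := noeth_setT hnoeth.
move=> hJ nJ; have := @noeth_ind _ _ hNR [set J | ideal J /\ ~ J 1] (fun J => J `<=` m).
apply=> // {J hJ nJ}.
  by move=> J [/ideal_stable h _].
move=> J [hJ nJ] IH.
have [[K [hK nK JK]]|nex] := pselect (exists K, [/\ ideal K, ~ K 1 & J `<` K]).
  by apply: subset_trans (IH K _ JK) => //; exact: properW.
suff h : maximal_ideal J by rewrite (huniq J h).
split=> //; first by move=> e; apply: nJ; rewrite e.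
move=> K hK JK; have [K1|nK] := pselect (K 1).
  right; apply/seteqP; split=> // x _; rewrite -[x]mulr1.
  by have [_ _ hM] := (ideal_stable K).1 hK; exact: hM.
left; apply: contrapT => ne; apply: nex; exists K; split=> //; apply: sub_neq_proper => // e.
by apply: ne.
Qed.

Lemma local_unit c : ~ m c -> exists d, d * c = 1.
Proof.
move=> nc; apply: contrapT => nd; apply: nc.
apply: (@proper_ideal_sub [set d * c | d in [set: R]]).
- apply/ideal_stable; split; first by exists 0; rewrite ?mul0r.
    by move=> _ _ [a _ <-] [b _ <-]; exists (a + b); rewrite ?mulrDl.
  by move=> b _ _ [a _ <-]; exists (b * a); rewrite ?mulrA.
- by case=> d _ e; apply: nd; exists d.
- by exists 1; rewrite ?mul1r.
Qed.

Lemma local_ideal : ideal m. Proof. by case: hlocal => -[]. Qed.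

Lemma local_not1 : ~ m 1.
Proof.
move=> h1; have [[hi hne _] _] := hlocal; apply: hne; apply/seteqP; split=> // x _.
by rewrite -[x]mulr1; have [_ _ hM] := (ideal_stable m).1 hi; exact: hM.
Qed.

Lemma localM a b : m b -> m (a * b).
Proof. by move=> hb; have [_ _ hM] := (ideal_stable m).1 local_ideal; exact: hM. Qed.

Lemma local_prime a b : m (a * b) -> m a \/ m b.
Proof.
move=> hab; have [ha|/local_unit [d hd]] := pselect (m a); [by left|right].
by rewrite -[b]mul1r -hd -mulrA; exact: localM.
Qed.

Lemma local_sub1_unit a : m a -> exists d, d * (1 - a) = 1.
Proof.
move=> ha; apply: local_unit => h1; apply: local_not1; rewrite -(subrK a 1).
by have [_ hD _] := (ideal_stable m).1 local_ideal; exact: hD.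
Qed.

(* Nakayama: eliminate the generators one at a time. *)
Lemma nakayama (V : lmodType R) (N U : set V) :
  submodule U -> submodule N -> fin_gen N -> N `<=` addS U (scale_mod m N) -> N `<=` U.
Proof.
move=> hU hN [n [x hx]].
have hxN i : N (x i) by rewrite hx; apply: span_gen; exists i.
have sN : scale_mod m N `<=` [set v | exists2 c : 'I_n -> R,
    (forall i, m (c i)) & v = \sum_i c i *: x i].
  have [m0 mD mM] := (ideal_stable m).1 local_ideal.
  apply: span_min; last first.
    move=> _ [a ha [v Nv <-]]; have : span (range x) v by rewrite -hx.
    move=> /span_ordP [c ->].
    exists (fun i => a * c i); first by move=> i; rewrite mulrC; apply: localM.
    by rewrite scaler_sumr; apply: eq_bigr => i _; rewrite scalerA.
  split; first by exists (fun=> 0) => //; rewrite big1 // => i _; rewrite scale0r.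
  move=> a u v [c hc ->] [c' hc' ->]; exists (fun i => a * c i + c' i).
    by move=> i; apply: mD => //; apply: localM.
  by rewrite scaler_sumr -big_split; apply: eq_bigr => i _; rewrite /= scalerDl scalerA.
move=> hNU.
suff H : forall k, (k <= n)%N ->
    N `<=` addS U (span [set x i | i in [set i : 'I_n | (i < n - k)%N]]).
  move=> v hv; have [u hu [w hw e]] := H n (leqnn n) v hv.
  have sw : span [set x i | i in [set i : 'I_n | (i < n - n)%N]] `<=` [set 0].
    by apply: span_min; [exact: submodule1|move=> y [i]; rewrite /= subnn].
  have w0 : w = 0 := sw w hw.
  by rewrite -e w0 addr0.
elim=> [|k IH] hk.
  move=> v; rewrite subn0 hx => hv; apply: addSr => //.
  by apply: span_mono hv => _ [i _ <-]; exists i => //=; exact: ltn_ord.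
set W := span _; have hW : submodule W by exact: submodule_span.
have hUW := submodule_addS hU hW.
have ltj : (n - k.+1 < n)%N by lia.
pose j := Ordinal ltj.
have split_span : span [set x i | i in [set i : 'I_n | (i < n - k)%N]] `<=`
    [set w | exists a, W (w - a *: x j)].
  apply: span_min; last first.
    move=> _ [i /= hi <-]; have [->|ne] := eqVneq i j.
      by exists 1; rewrite scale1r subrr; exact: sub0.
    exists 0; rewrite scale0r subr0; apply: span_gen; exists i => //=.
    rewrite ltn_neqAle; apply/andP; split; last by lia.
    by apply: contra_neq ne => e; apply: val_inj.
  split; first by exists 0; rewrite scale0r subr0; exact: sub0.
  move=> a u v [b hb] [c hc]; exists (a * b + c).
  rewrite (_ : _ - _ = a *: (u - b *: x j) + (v - c *: x j)); first exact: hW.2.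
  by rewrite scalerBr scalerDl scalerA opprD addrACA.
have IHk := IH (ltnW hk).
(* Modulo [U + W] every generator is a multiple of [x j]. Inserting this in an expression of [x j]
   over [U + m N] collects the coefficients into a single [a] of [m], and [1 - a] is a unit. *)
have xj : exists2 a, m a & addS U W (x j - a *: x j).
  have [m0 mD mM] := (ideal_stable m).1 local_ideal.
  have [u hu [w hw e]] := hNU _ (hxN j).
  have [c hc ew] := sN _ hw.
  have hxi i : exists b, addS U W (x i - b *: x j).
    have [u' hu' [w' /split_span [b hb] e']] := IHk _ (hxN i).
    by exists b; rewrite -e' -addrA; exists u' => //; exists (w' - b *: x j).
  have [b hb] := ex_choice hxi.
  exists (\sum_i c i * b i).
    by apply: (big_ind m) => // i _; rewrite mulrC; apply: localM.
  rewrite -{1}e ew scaler_suml -addrA -sumrB; apply: subD => //.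
    exact: addSl.
  apply: sub_sum => // i _; rewrite -scalerA -scalerBr; exact: subZ.
have [a ha hax] := xj; have [d hd] := local_sub1_unit ha.
have xjUW : addS U W (x j).
  by rewrite -[x j]scale1r -hd -scalerA; apply: subZ => //; rewrite scalerBl scale1r.
move=> v /IHk [u hu [w /split_span [b hb] <-]].
apply: subD => //; first exact: addSl.
rewrite -(subrK (b *: x j) w); apply: subD => //; last exact: subZ.
exact: addSr.
Qed.

End LocalRing.

(** * The grading of the Rees algebra *)

Section Products.
Variables (R : comNzRingType) (p : nat).
Local Notation S := {mpoly R[p]}.
Implicit Types (A B C N U W : set S) (a b z : S).

Lemma mulr_linear z : linear (fun a : S => z * a).
Proof. by move=> c u v; rewrite mulrDr scalerAr. Qed.

Lemma linform_linear : linear (@linform R p).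
Proof.
move=> c u v; rewrite /linform scaler_sumr -big_split /=; apply: eq_bigr => i _.
by rewrite !mxE scalerA scalerDl.
Qed.

Lemma submodule_mul_mod A B : submodule (mul_mod A B).
Proof. exact: submodule_span. Qed.

Lemma mul_mod_gen A B a b : A a -> B b -> mul_mod A B (a * b).
Proof. by move=> ha hb; apply: span_gen; exists a => //; exists b. Qed.

Lemma mul_mod_min A B N : submodule N -> (forall a b, A a -> B b -> N (a * b)) ->
  mul_mod A B `<=` N.
Proof. by move=> hN h; apply: span_min => // _ [a ha [b hb <-]]; exact: h. Qed.

Lemma submodule_colon N z : submodule N -> submodule [set a | N (z * a)].
Proof. by move=> hN; exact: (submodule_preimage (mulr_linear z) hN). Qed.

Lemma submodule_exp_mod W n : submodule (exp_mod W n).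
Proof. by case: n => [|n]; exact: submodule_span. Qed.

Lemma exp_modM W i j a b : exp_mod W i a -> exp_mod W j b -> exp_mod W (i + j) (a * b).
Proof.
move=> ha hb; rewrite mulrC; move: ha.
suff h : exp_mod W i `<=` [set a | exp_mod W (i + j) (b * a)] by exact: h.
elim: i => [|i IH].
  apply: span_min; first by apply: submodule_colon; exact: submodule_exp_mod.
  by move=> _ -> /=; rewrite mulr1.
apply: mul_mod_min; first by apply: submodule_colon; exact: submodule_exp_mod.
by move=> w c hw hc /=; rewrite mulrCA; apply: mul_mod_gen => //; exact: IH.
Qed.

Lemma exp_mod_split W i j : exp_mod W (i + j) = mul_mod (exp_mod W i) (exp_mod W j).
Proof.
apply/seteqP; split; last first.
  by apply: mul_mod_min; [exact: submodule_exp_mod|move=> a b; exact: exp_modM].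
elim: i => [|i IH].
  by move=> b hb; rewrite -[b]mul1r; apply: mul_mod_gen => //; exact: span_gen.
rewrite addSn; apply: mul_mod_min; first exact: submodule_mul_mod.
move=> w c hw /IH; move: c.
suff h : mul_mod (exp_mod W i) (exp_mod W j) `<=`
    [set c | mul_mod (exp_mod W i.+1) (exp_mod W j) (w * c)] by exact: h.
apply: mul_mod_min; first by apply: submodule_colon; exact: submodule_mul_mod.
by move=> a b ha hb /=; rewrite mulrA; apply: mul_mod_gen => //; exact: mul_mod_gen.
Qed.

Lemma exp_mod_exp W i n : exp_mod (exp_mod W i) n = exp_mod W (i * n).
Proof.
elim: n => [|n IH]; first by rewrite muln0.
by rewrite mulnS exp_mod_split -IH.
Qed.

Lemma exp_mod1 W : submodule W -> exp_mod W 1 = W.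
Proof.
move=> hW; apply/seteqP; split; last first.
  by move=> w hw; rewrite -[w]mulr1; apply: mul_mod_gen => //; exact: span_gen.
apply: mul_mod_min => // a b ha; move: b.
suff h : span [set 1] `<=` [set b | W (a * b)] by exact: h.
by apply: span_min; [exact: submodule_colon|move=> _ ->; rewrite /= mulr1].
Qed.

Lemma exp_mod0 W a : exp_mod W 0 a <-> exists c : R, a = c%:A.
Proof.
split=> [|[c ->]]; last by apply: (subZ _ (submodule_span _)); exact: span_gen.
suff h : span [set 1] `<=` [set a : S | exists c : R, a = c%:A] by exact: h.
apply: span_min; last by move=> _ ->; exists 1; rewrite scale1r.
split; first by exists 0; rewrite scale0r.
by move=> c _ _ [d ->] [e ->]; exists (c * d + e); rewrite scalerDl scalerA.
Qed.

Lemma submodule_subset_mul A a N : submodule N -> (forall b, A b -> N (a * b)) ->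
  forall b, span A b -> N (a * b).
Proof.
move=> hN h b hb; suff H : span A `<=` [set b | N (a * b)] by exact: H.
by apply: span_min => //; exact: submodule_colon.
Qed.

End Products.

Section Grading.
Variables (R : comNzRingType) (p : nat) (M : set 'rV[R]_p).
Hypothesis hM : submodule M.
Local Notation S := {mpoly R[p]}.
Local Notation A := (mpow M).
Local Notation T := (rees M).
Local Notation pi n := (@pihomog p R mdeg n).
Implicit Types (a b z : S) (J P : set S).

Lemma submodule_mpow n : submodule (A n). Proof. exact: submodule_exp_mod. Qed.

Lemma mpow1E : A 1 = @linform R p @` M.
Proof. by apply: exp_mod1; apply: submodule_image => //; exact: linform_linear. Qed.

Lemma mpowS n : A n.+1 = mul_mod (A 1) (A n).
Proof. by rewrite /mpow -exp_mod_split. Qed.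

Lemma mpow_homog n a : A n a -> a \is n.-homog.
Proof.
have hsub k : submodule [set a : S | a \is k.-homog].
  split; first exact: dhomog0.
  by move=> c u v hu hv; apply: rpredD => //; apply: rpredZ.
suff h : A n `<=` [set a | a \is n.-homog] by exact: h.
elim: n => [|n IH]; first by apply: span_min => // _ -> /=; exact: dhomog1.
rewrite mpowS; apply: mul_mod_min => //.
move=> u v; rewrite mpow1E => -[w _ <-] /IH hv /=; rewrite -add1n.
apply: dhomogM => //; apply: rpred_sum => i _; apply: rpredZ.
by rewrite dhomogX /= mdeg1.
Qed.

Lemma pi_id n a : A n a -> pi n a = a.
Proof. by move=> /mpow_homog h; exact: pihomog_dE. Qed.

Lemma pi_neq m n a : A m a -> n != m -> pi n a = 0.
Proof. by move=> /mpow_homog h ne; apply: (pihomog_ne0 _ h); rewrite eq_sym. Qed.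

Lemma pi_sum a : exists k, forall l, (k <= l)%N -> a = \sum_(d < l) pi d a.
Proof. by exists (mmeasure mdeg a) => l hl; exact: pihomog_partitionE. Qed.

Lemma pi_homog n a : pi n a \is n.-homog. Proof. exact: pihomogP. Qed.

Lemma piM n a b : pi n (a * b) = \sum_(i < n.+1) pi i a * pi (n - i) b.
Proof.
have [ka hka] := pi_sum a; have [kb hkb] := pi_sum b.
pose l := maxn (maxn ka kb) n.+1.
have la : (ka <= l)%N by rewrite /l; lia.
have lb : (kb <= l)%N by rewrite /l; lia.
have ln : (n.+1 <= l)%N by rewrite /l; lia.
rewrite {1}(hka _ la) {1}(hkb _ lb) mulr_suml raddf_sum /=.
have step (i : 'I_l) : pi n (pi i a * \sum_(d < l) pi d b) =
    if (i < n.+1)%N then pi i a * pi (n - i) b else 0.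
  rewrite mulr_sumr raddf_sum /=.
  have hom (d : 'I_l) : pi i a * pi d b \is (i + d).-homog.
    by apply: dhomogM; exact: pi_homog.
  case: ifP => hi; last first.
    rewrite big1 // => d _; apply: (pihomog_ne0 _ (hom d)); lia.
  have lt : (n - i < l)%N by lia.
  rewrite (bigD1 (Ordinal lt)) //= big1 ?addr0.
    by apply: pihomog_dE; have := hom (Ordinal lt); rewrite /= subnKC.
  move=> d ne; apply: (pihomog_ne0 _ (hom d)).
  apply: contra_neq ne => e; apply: val_inj => /=; lia.
under eq_bigr do rewrite step.
by rewrite -big_mkcond /= (big_ord_widen _ (fun i => pi i a * pi (n - i) b) ln).
Qed.

(** This makes the Rees algebra the direct sum of the [A n]. By [piM] the right-hand side describes
    a subalgebra containing the generators; conversely each [A n] consists of sums of products of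
    generators. *)
Lemma rees_gradedP a : T a <-> forall n, A n (pi n a).
Proof.
have sT : subalgebra T.
  split=> [|B [[_ h _] _]//|u v hu hv B hB].
    split=> [B [[[h _] _ _] _]//|c u v hu hv B hB].
    by case: (hB) => -[hs _ _] _; apply: hs.2; [exact: hu|exact: hv].
  by case: (hB) => -[_ _ h] _; apply: h; [exact: hu|exact: hv].
split.
  suff h : T `<=` [set a | forall n, A n (pi n a)] by exact: h.
  apply: smallest_sub; last first.
    move=> _ [v hv <-] n; have h : A 1 (linform v) by rewrite mpow1E; exists v.
    have [->|ne] := eqVneq n 1%N; first by rewrite pi_id.
    by rewrite (pi_neq h ne); apply: sub0; exact: submodule_mpow.
  split.
  - split; first by move=> n; rewrite raddf0; apply: sub0; exact: submodule_mpow.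
    by move=> c u v hu hv n; rewrite linearP; apply: (submodule_mpow n).2.
  - have h : A 0 1 by exact: span_gen.
    move=> n; have [->|ne] := eqVneq n 0%N; first by rewrite pi_id.
    by rewrite (pi_neq h ne); apply: sub0; exact: submodule_mpow.
  - move=> u v hu hv n; rewrite piM; apply: sub_sum; first exact: submodule_mpow.
    by move=> i _; rewrite -{1}(subnKC (ltnSE (ltn_ord i))); apply: exp_modM; [exact: hu|exact: hv].
move=> ha; have [k hk] := pi_sum a; rewrite (hk k) //.
have [hs h1 hm] := sT.
apply: sub_sum => // i _; move: (ha i); move: (nat_of_ord i) (pi i a) => n b.
suff h : A n `<=` T by exact: h.
elim: n => [|n IH]; first by apply: (span_min hs) => _ ->.
rewrite mpowS; apply: (mul_mod_min hs) => u v; rewrite mpow1E => hu /IH hv; apply: hm => //.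
exact: sub_gen_smallest hu.
Qed.

Lemma mpow_rees n a : A n a -> T a.
Proof.
move=> ha; apply/rees_gradedP => i; have [->|ne] := eqVneq i n; first by rewrite pi_id.
by rewrite (pi_neq ha ne); apply: sub0; exact: submodule_mpow.
Qed.

Lemma pi_mpow n a : T a -> A n (pi n a). Proof. by move/rees_gradedP. Qed.

Lemma rees_subring : is_subring T.
Proof.
have h1 : A 0 1 by exact: span_gen.
split; first exact: (mpow_rees h1).
  move=> u v /rees_gradedP hu /rees_gradedP hv; apply/rees_gradedP => n.
  by rewrite raddfB /=; apply: subB => //; exact: submodule_mpow.
move=> u v /rees_gradedP hu /rees_gradedP hv; apply/rees_gradedP => n.
rewrite piM; apply: sub_sum; first exact: submodule_mpow.
by move=> i _; rewrite -{1}(subnKC (ltnSE (ltn_ord i))); apply: exp_modM; [exact: hu|exact: hv].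
Qed.

Lemma submodule_rees : submodule T.
Proof.
split; first exact: subring0 rees_subring.
move=> c u v /rees_gradedP hu /rees_gradedP hv; apply/rees_gradedP => n.
by rewrite linearP; apply: (submodule_mpow n).2.
Qed.

Lemma rees_scalar c : T (c%:A). Proof. by apply: (@mpow_rees 0); apply/exp_mod0; exists c. Qed.

(** Hilbert's basis theorem is applied once per generator of [M], starting from the constants, which
    are an image of [R]. *)
Lemma noeth_rees : noetherian R -> fin_gen M -> noeth T.
Proof.
move=> hR [n [x hx]].
pose C : set S := [set c%:A | c in [set: R]].
have hC : is_subring C.
  split; first by exists 1; rewrite ?scale1r.
    by move=> _ _ [a _ <-] [b _ <-]; exists (a - b); rewrite ?scalerBl.
  by move=> _ _ [a _ <-] [b _ <-]; exists (a * b); rewrite // -scalerAl mul1r scalerA.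
have nC : noeth C.
  have -> : C = (@mpolyC p R) @` [set: R].
    by apply/seteqP; split=> _ [c _ <-]; exists c => //; rewrite -mul_mpolyC mulr1.
  exact: noeth_image (noeth_setT hR).
(* The recursion runs over [nat]; [insub] finds the generator of index [k'] when [k' < n], and
   otherwise nothing is adjoined. *)
pose B := fix B k := if k is k'.+1 then
  (if insub k' is Some i then adjoin (B k') (linform (x i)) else B k') else C.
have hB k : is_subring (B k) /\ noeth (B k).
  elim: k => [|k [IH1 IH2]] //=; case: insubP => [i _ _|_] //.
  by split; [exact: adjoin_subring|exact: hilbert_basis].
have CB k : C `<=` B k.
  elim: k => [|k IH] //=; case: insubP => [i _ _|_] //.
  by apply: subset_trans IH _; exact: (sub_adjoin (hB k).1).
have xB (i : 'I_n) k : (i < k)%N -> B k (linform (x i)).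
  elim: k => [|k IH] //=; rewrite ltnS leq_eqVlt => /orP [/eqP e|/IH h].
    case: insubP => [j _ ej|]; last by rewrite -e ltn_ord.
    have -> : i = j by apply: val_inj; rewrite ej.
    exact: (gen_adjoin (hB k).1).
  case: insubP => [j _ ej|_] //; exact: (sub_adjoin (hB k).1).
suff -> : T = B n by case: (hB n).
apply/seteqP; split.
  apply: smallest_sub.
    have [[h1 hs hm] _] := hB n; split=> //.
    split; first exact: subring0 (hB n).1.
    move=> c u v hu hv; rewrite -mulr_algl; apply: subringD (hB n).1 _ _ => //.
    by apply: hm => //; apply: CB; exists c.
  move=> _ [v hv <-]; move: hv; rewrite hx => /span_ordP [c ->].
  rewrite (big_morph (@linform R p) (id1 := 0) (op1 := +%R)).
  - elim/big_ind: _ => [|u w|i _]; first exact: subring0 (hB n).1.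
      by apply: subringD; exact: (hB n).1.
    rewrite (linear_funZ (@linform_linear R p)) -mulr_algl; have [[_ _ hm] _] := hB n.
    by apply: (hm); [apply: CB; exists (c i)|exact: xB].
  - exact: linear_funD (@linform_linear R p).
  - exact: linear_fun0 (@linform_linear R p).
suff h k : B k `<=` T by exact: h.
elim: k => [|k IH] /=; first by move=> _ [c _ <-]; exact: rees_scalar.
case: insubP => [i _ _|_] //; apply: (adjoin_min rees_subring IH).
by apply: (@mpow_rees 1); rewrite mpow1E; exists (x i) => //; rewrite hx; apply: span_gen; exists i.
Qed.

End Grading.

(** * Growth bounds and Hilbert polynomials *)

Section GrowthBound.
Variables (R : comNzRingType) (p : nat).
Local Notation S := {mpoly R[p]}.
Implicit Types (z a : S) (zs : seq S) (X Y : set S) (N : nat -> set S).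

(** This is z_1 X + ... + z_r X + Y. Accumulating in the last argument means that removing one [z]
    enlarges [Y], which is the induction step of [growth_bound]. *)
Fixpoint sumz zs X Y : set S :=
  if zs is z :: zs' then sumz zs' X (addS (( *%R z) @` X) Y) else Y.

Lemma submodule_mulz z X : submodule X -> submodule (( *%R z) @` X).
Proof. by move=> hX; apply: (submodule_image (mulr_linear z)). Qed.

Lemma submodule_sumz zs X Y : submodule X -> submodule Y -> submodule (sumz zs X Y).
Proof.
move=> hX; elim: zs Y => [|z zs IH] Y hY //=; apply: IH; apply: submodule_addS => //.
exact: submodule_mulz.
Qed.

Lemma sumz_base zs X Y : submodule X -> Y `<=` sumz zs X Y.
Proof.
move=> hX; elim: zs Y => [|z zs IH] Y //=; apply: subset_trans (IH _).
by apply: addSr; exact: submodule_mulz.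
Qed.

Lemma sumz_gen zs X Y z a : submodule X -> submodule Y -> z \in zs -> X a ->
  sumz zs X Y (z * a).
Proof.
move=> hX; elim: zs Y => [|y zs IH] Y hY //=; rewrite inE => /orP [/eqP ->|hz] ha.
  by apply: sumz_base => //; apply: addSl => //; exists a.
by apply: IH => //; apply: submodule_addS => //; exact: submodule_mulz.
Qed.

(* Multiplication by [z] maps [N n / N' n] onto the kernel of
   [N (n + n0) / N' (n + n0) -> N (n + n0) / (z N n + N' (n + n0))]. *)
Lemma growth_bound zs n0 n1 N N' : (0 < n0)%N ->
  (forall n, submodule (N n)) -> (forall n, submodule (N' n)) ->
  (forall n, N' n `<=` N n) -> (forall n, flen (N n) (N' n)) ->
  (forall z n a, z \in zs -> N n a -> N (n + n0)%N (z * a)) ->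
  (forall z n a, z \in zs -> N' n a -> N' (n + n0)%N (z * a)) ->
  (forall n, (n1 <= n)%N -> N (n + n0)%N `<=` sumz zs (N n) (N' (n + n0)%N)) ->
  cumO (size zs) (fun n => len (N n) (N' n)).
Proof.
move=> n0_gt0 hN; elim: zs N' => [|z zs IH] N' hN' N'N hfl zN zN' hgen /=.
  apply: (@cumO_zero (n1 + n0)) => n hn.
  have e : n = (n - n0 + n0)%N by lia.
  have -> : N n = N' n.
    by apply/seteqP; split=> //; rewrite e; apply: hgen; lia.
  exact: len_refl.
(* The test guards against the truncated [n - n0], which would bring [z * N 0] into degrees below
   [n0]. *)
pose N2 n := if (n0 <= n)%N then addS (( *%R z) @` N (n - n0)%N) (N' n) else N' n.
have hN2 n : submodule (N2 n).
  by rewrite /N2; case: ifP => // _; apply: submodule_addS => //; exact: submodule_mulz.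
have N2E n : N2 (n + n0)%N = addS (( *%R z) @` N n) (N' (n + n0)%N).
  by rewrite /N2 leq_addl addnK.
have N'N2 n : N' n `<=` N2 n.
  by rewrite /N2; case: ifP => _ a ha //; apply: addSr => //; exact: submodule_mulz.
have N2N n : N2 n `<=` N n.
  rewrite /N2; case: ifP => // hn; apply: addS_min => // _ [a ha <-].
  by rewrite -(subnK hn); apply: zN => //; rewrite inE eqxx.
have fl2 n : flen (N n) (N2 n) by exact: flen_top (hfl n).
apply: (@cumO_step n0 0 _ _ (fun n => len (N n) (N2 n))) => //; last first.
  apply: IH => //.
  - by move=> y n a hy; apply: zN; rewrite inE hy orbT.
  - move=> y n a hy; rewrite N2E /N2; case: ifP => hn.
      move=> [_ [b hb <-] [c hc <-]]; rewrite mulrDr mulrCA.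
      exists (z * (y * b)); first by exists (y * b) => //; rewrite -(subnK hn); apply: zN => //; rewrite inE hy orbT.
      by exists (y * c) => //; apply: zN' => //; rewrite inE hy orbT.
    move=> ha; apply: addSr; first exact: submodule_mulz.
    by apply: zN' => //; rewrite inE hy orbT.
  - by move=> n hn; rewrite N2E; exact: hgen.
move=> n _; rewrite (lenD (hN _) (hN2 _) (hN' _) (N'N2 _) (N2N _) (hfl _)) leq_add2l N2E.
have [|_] := @flen_image_le _ _ _ _ (mulr_linear z) (N n) (N' (n + n0)%N) (hN _) (hN' _) (N' n) (hN' _) (N'N n) _ (hfl n).
  by move=> _ [a ha <-]; apply: zN' => //; rewrite inE eqxx.
by [].
Qed.

End GrowthBound.

Section HilbertPolynomial.
Variables (R : comNzRingType) (p : nat) (M : set 'rV[R]_p).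
Hypotheses (hM : submodule M) (hfg : fin_gen M) (hR : noetherian R).
Local Notation S := {mpoly R[p]}.
Local Notation A := (mpow M).
Local Notation T := (rees M).
Local Notation pi n := (@pihomog p R mdeg n).
Implicit Types (z a : S) (zs : seq S) (N : nat -> set S).

Lemma pi_mul_homog d n b a : A d a -> (d <= n)%N -> pi n (b * a) = pi (n - d) b * a.
Proof.
move=> ha hd; have lt : (n - d < n.+1)%N by lia.
rewrite piM (bigD1 (Ordinal lt)) //= subKn // (pi_id hM ha) big1 ?addr0 // => i ne.
rewrite (pi_neq hM ha) ?mulr0 //; apply: contra_neq ne => e; apply: val_inj => /=.
by have := ltn_ord i; lia.
Qed.

(** A graded submodule of the Rees algebra, reindexed so that [N n] sits in degree [n + c]. The
    families attached to coefficient modules use [c = 1]. *)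
Definition graded_fam c N :=
  [/\ forall n, submodule (N n), forall n, N n `<=` A (n + c)%N &
      forall n z a, A 1 z -> N n a -> N n.+1 (z * a)].

Lemma graded_fam_mul c N i j a b : graded_fam c N -> A i b -> N j a -> N (i + j)%N (b * a).
Proof.
move=> [hN _ hz] + ha.
suff h : A i `<=` [set b | N (i + j)%N (a * b)] by move/h; rewrite /= mulrC.
elim: i => [|i IH].
  apply: span_min; first exact: submodule_colon.
  by move=> _ -> /=; rewrite mulr1.
rewrite (mpowS M); apply: mul_mod_min; first exact: submodule_colon.
by move=> u v hu /IH hv /=; rewrite addSn mulrCA; apply: hz.
Qed.

(** The module has finitely many homogeneous generators, of index at most [m]. Beyond [m] their
    coefficients have positive degree, so a factor of degree one can be split off. *)
Lemma graded_fam_gen c N : graded_fam c N ->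
  exists n1, forall n, (n1 <= n)%N -> N n.+1 `<=` mul_mod (A 1) (N n).
Proof.
move=> hN; have [sN NA hz] := hN.
have hT : noeth T := noeth_rees hM hR hfg.
have [|xs hxs hX] := hT (\bigcup_n N n).
  by move=> a [n _ /NA ha]; exact: (mpow_rees hM ha).
have [m hm] : exists m, forall a, a \in xs -> exists2 j, (j <= m)%N & N j a.
  elim: xs hxs {hX} => [|x xs IH] hxs; first by exists 0%N.
  have [|m hm] := IH; first by move=> y hy; apply: hxs; rewrite /= inE; apply/orP; right.
  have [n _ hx] : (\bigcup_n N n) x by apply: hxs; rewrite /= inE eqxx.
  exists (maxn m n) => y; rewrite inE => /orP [/eqP ->|/hm [j hj hy]].
    by exists n => //; exact: leq_maxr.
  by exists j => //; apply: leq_trans hj _; exact: leq_maxl.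
exists m => n mn a ha.
have [T1 TB TM] := rees_subring hM.
have hs k : submodule (mul_mod (A 1) (N k)) by exact: submodule_mul_mod.
(* Quantifying over [b] makes [J] stable under [T], so that only generators need checking; the claim
   is the case [b = 1]. *)
pose J : set S := [set a | forall b, T b -> mul_mod (A 1) (N n) (pi (n.+1 + c) (b * a))].
suff h : lin T [set` xs] `<=` J.
  have := h a _ 1 T1; rewrite mul1r (pi_id hM (NA _ _ ha)); apply.
  by apply: hX; exists n.+1.
apply: lin_min.
  split; first by move=> b _; rewrite mulr0 raddf0; exact: (sub0 (hs n)).
    by move=> u v hu hv b hb; rewrite mulrDr raddfD; apply: (subD (hs n)); [exact: hu|exact: hv].
  by move=> b u hb hu e he; rewrite mulrA; apply: hu; exact: TM.
move=> x /= /hm [j jm hx] b hb.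
rewrite (pi_mul_homog _ (NA _ _ hx)); last by lia.
rewrite (_ : (n.+1 + c - (j + c) = (n - j).+1)%N); last by lia.
have := pi_mpow hM (n - j).+1 hb; rewrite (mpowS M); move: (pi _ b) => b'.
rewrite [b' * x]mulrC; move: b'.
suff h : mul_mod (A 1) (A (n - j)) `<=` [set b | mul_mod (A 1) (N n) (x * b)] by exact: h.
apply: mul_mod_min; first exact: submodule_colon.
move=> u v hu hv /=; rewrite mulrCA; apply: mul_mod_gen => //.
rewrite mulrC (_ : n = n - j + j)%N; last by lia.
exact: (graded_fam_mul hN).
Qed.

(* Induction on the generators [zs] that may act nontrivially on [N / N']:
   [z] kills both the kernel [K / N'] and the cokernel [N / N2] of its action. *)
Lemma hilbert_poly_rec r (x : 'I_r -> S) zs c N N' :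
  A 1 = span (range x) -> (forall z, z \in zs -> A 1 z) ->
  graded_fam c N -> graded_fam c N' -> (forall n, N' n `<=` N n) ->
  (forall n, flen (N n) (N' n)) ->
  (forall i, x i \in zs \/ forall n a, N n a -> N' n.+1 (x i * a)) ->
  exists q : {poly rat}, exists n1, forall n, (n1 <= n)%N ->
    q.[n%:R] = (len (N n) (N' n))%:R.
Proof.
move=> hx; elim: zs N N' => [|z zs IH] N N' hzs hN hN' N'N hfl hkill.
  have [n1 hn1] := graded_fam_gen hN; have [sN NA zN] := hN; have [sN' N'A zN'] := hN'.
  exists 0, n1.+1 => -[|n] // hn; rewrite horner0.
  suff -> : N n.+1 = N' n.+1 by rewrite len_refl.
  apply/seteqP; split=> //; apply: subset_trans (hn1 n hn) _.
  apply: mul_mod_min => // u a hu ha; rewrite mulrC.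
  apply: (submodule_subset_mul (A := range x)) => //; last by rewrite -hx.
  by move=> _ [i _ <-]; case: (hkill i) => // h; rewrite mulrC; apply: h.
have [sN NA zN] := hN; have [sN' N'A zN'] := hN'.
have Az : A 1 z by apply: hzs; rewrite inE eqxx.
pose N2 n := if n is n'.+1 then addS (( *%R z) @` N n') (N' n) else N' 0%N.
pose K n := N n `&` [set a | N' n.+1 (z * a)].
have hN2 : graded_fam c N2.
  split.
  - by case=> [|n] //=; apply: submodule_addS => //; exact: submodule_mulz.
  - case=> [|n] //=; apply: addS_min; [exact: (submodule_mpow M)| |exact: N'A].
    move=> _ [a /NA ha <-]; rewrite addSn -add1n; exact: exp_modM.
  - move=> [|n] y a hy /=.
      by move=> ha; apply: addSr; [exact: submodule_mulz|exact: zN'].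
    move=> [_ [b hb <-] [d hd <-]]; rewrite mulrDr mulrCA.
    exists (z * (y * b)); first by exists (y * b) => //; exact: zN.
    by exists (y * d) => //; exact: zN'.
have hK : graded_fam c K.
  split.
  - by move=> n; apply: submoduleI => //; exact: submodule_colon.
  - by move=> n a [/NA].
  - move=> n y a hy [ha hza]; split; first exact: zN.
    by rewrite /= mulrCA; exact: zN'.
have N'K n : N' n `<=` K n by move=> a ha; split; [exact: N'N|exact: zN'].
have KN n : K n `<=` N n by move=> a [].
have N2N n : N2 n `<=` N n.
  case: n => [|n] //=; apply: addS_min => // _ [a ha <-]; exact: zN.
have N'N2 n : N' n `<=` N2 n.
  by case: n => [|n] //=; apply: addSr; exact: submodule_mulz.
have hzs' y : y \in zs -> A 1 y by move=> hy; apply: hzs; rewrite inE hy orbT.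
have [||qc [nc hqc]] := IH N N2 hzs' hN hN2 N2N.
- by move=> n; exact: flen_top (hfl n).
- move=> i; case: (hkill i) => [|h]; last first.
    by right=> n a ha; apply: N'N2; exact: h.
  rewrite inE => /orP [/eqP ->|]; [right=> n a ha|by left].
  by apply: addSl => //; exists a.
have [||qk [nk hqk]] := IH K N' hzs' hK hN' N'K.
- by move=> n; exact: flen_bot (hfl n).
- move=> i; case: (hkill i) => [|h]; last by right=> n a [ha _]; exact: h.
  by rewrite inE => /orP [/eqP ->|]; [right=> n a []|left].
(* Multiplication by [z] identifies [N n / K n] with [N2 n.+1 / N' n.+1]. So the increment of the
   length function is a cokernel length minus a kernel length, both polynomial by induction. *)
have key n : (len (N n.+1) (N' n.+1) + len (K n) (N' n) =
              len (N n.+1) (N2 n.+1) + len (N n) (N' n))%N.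
  have sK := let: And3 h _ _ := hK in h; have sN2 := let: And3 h _ _ := hN2 in h.
  rewrite (lenD (sN _) (sN2 _) (sN' _) (N'N2 _) (N2N _) (hfl _)).
  rewrite (lenD (sN n) (sK _) (sN' _) (N'K _) (KN _) (hfl _)) -addnA; congr (_ + (_ + _))%N.
  apply: (@len_image _ _ _ _ (mulr_linear z) (N n) (N' n.+1)) => //.
  exact: flen_top (hfl n).
have [|Q hQ] := @hilb_antidiff (fun n => len (N n) (N' n)) (maxn nc nk) (qc \Po ('X + 1) - qk).
  move=> n hn; have e : (qc \Po ('X + 1)).[n%:R] = (len (N n.+1) (N2 n.+1))%:R.
    by rewrite horner_comp hornerD hornerX hornerC natr1 hqc //; lia.
  rewrite hornerD hornerN e hqk; last by lia.
  by have := congr1 (fun k : nat => k%:R : rat) (key n); rewrite !natrD; lra.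
by exists Q, (maxn nc nk).
Qed.

Lemma hilbert_poly c N N' :
  graded_fam c N -> graded_fam c N' -> (forall n, N' n `<=` N n) ->
  (forall n, flen (N n) (N' n)) ->
  exists q : {poly rat}, exists n1, forall n, (n1 <= n)%N ->
    q.[n%:R] = (len (N n) (N' n))%:R.
Proof.
have [r [x hx]] := hfg => hN hN' h hfl.
have e : A 1 = span (range (fun i => linform (x i))).
  rewrite (mpow1E hM) hx -(span_image (@linform_linear R p)); congr (Defs.span _).
  apply/seteqP; split; first by move=> _ [_ [i _ <-] <-]; exists i.
  by move=> _ [i _ <-]; exists (x i) => //; exists i.
apply: (hilbert_poly_rec (zs := [seq linform (x i) | i <- enum 'I_r]) e _ hN hN' h hfl).
  by move=> z /mapP [i _ ->]; rewrite e; apply: span_gen; exists i.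
by move=> i; left; apply/mapP; exists i; rewrite ?mem_enum.
Qed.

End HilbertPolynomial.

(** * Homogeneous primes *)

Section HomogeneousPrimes.
Variables (R : comNzRingType) (p : nat) (M : set 'rV[R]_p).
Hypotheses (hM : submodule M).
Local Notation S := {mpoly R[p]}.
Local Notation A := (mpow M).
Local Notation T := (rees M).
Local Notation pi n := (@pihomog p R mdeg n).
Implicit Types (a b z : S) (J P Q X : set S).

Definition homog_closed J := forall a n, J a -> J (pi n a).

Lemma ideal_inP J : ideal_in T J <-> J `<=` T /\ stable_by T J.
Proof. by split=> [[h1 h2 h3 h4]|[h1 [h2 h3 h4]]]. Qed.

Lemma ideal_in_submodule J : ideal_in T J -> submodule J.
Proof.
case=> JT J0 JD JM; split=> // c u v hu hv; apply: JD => //.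
by rewrite -mulr_algl; apply: JM => //; exact: rees_scalar.
Qed.

Lemma lin_ideal X : X `<=` T -> ideal_in T (lin T X).
Proof.
move=> XT; apply/ideal_inP; split; last exact: lin_stable.
have [h1 h2 h3] := rees_subring hM.
by apply: lin_min => //; split; [exact: subring0 (rees_subring hM)|move=> x y; exact: subringD (rees_subring hM)|].
Qed.

Lemma lin_homog X : X `<=` T -> (forall x n, X x -> lin T X (pi n x)) ->
  homog_closed (lin T X).
Proof.
move=> XT hX; have hs := ideal_in_submodule (lin_ideal XT).
have [h0 hD hMul] := lin_stable T X.
suff h : lin T X `<=` [set a | forall n, lin T X (pi n a)] by move=> a n /h.
apply: lin_min; last by move=> x Xx n; exact: hX.
split; first by move=> n; rewrite raddf0.
  by move=> u v hu hv n; rewrite raddfD; apply: hD; [exact: hu|exact: hv].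
move=> b u hb hu n; rewrite piM; apply: (sub_sum _ hs) => i _; apply: hMul => //.
by apply: (mpow_rees hM); exact: pi_mpow.
Qed.

Lemma lin_homog_gen X : (forall x, X x -> exists d, A d x) ->
  ideal_in T (lin T X) /\ homog_closed (lin T X).
Proof.
move=> hX; have XT : X `<=` T by move=> x /hX [d hd]; exact: (mpow_rees hM hd).
split; first exact: lin_ideal.
apply: lin_homog => // x n Xx; have [d hd] := hX x Xx.
have [->|ne] := eqVneq n d; first by rewrite (pi_id hM hd); exact: lin_gen.
by rewrite (pi_neq hM hd ne); have [] := lin_stable T X.
Qed.

Lemma prime_in_1 P : prime_in T P -> ~ P 1. Proof. by case. Qed.

Lemma prime_in_exp P a n : prime_in T P -> T a -> P (a ^+ n) -> P a.
Proof.
move=> [hI h1 hP] Ta; elim: n => [|n IH]; first by rewrite expr0.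
rewrite exprS => h; case: (hP _ _ Ta _ h) => // .
elim: n {IH h} => [|n IH]; first by rewrite expr0; have [] := rees_subring hM.
by rewrite exprS; have [_ _ hm] := rees_subring hM; exact: hm.
Qed.

(* Multiply the lowest components of [a] and [b] outside [J]. *)
Lemma homog_prime_test J : ideal_in T J -> homog_closed J -> ~ J 1 ->
  (forall i j a b, A i a -> A j b -> J (a * b) -> J a \/ J b) -> prime_in T J.
Proof.
move=> hJ hc n1 htest; split=> // a b Ta Tb Jab.
have hs := ideal_in_submodule hJ; have [JT J0 JD JM] := hJ.
apply: contrapT => /not_orP [na nb].
have low c : T c -> ~ J c -> exists2 i, ~ J (pi i c) & forall j, (j < i)%N -> J (pi j c).
  move=> Tc nc; have : exists i, `[< ~ J (pi i c) >].
    apply: contrapT => h; apply: nc; have [k hk] := pi_sum c; rewrite (hk k) //.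
    apply: (sub_sum _ hs) => i _; apply: contrapT => ni; apply: h; exists i; exact/asboolP.
  case/ex_minnP => i /asboolP ni hmin; exists i => // j ji; apply: contrapT => nj.
  by have := hmin j; rewrite leqNgt ji => /(_ _)/negP; apply; [exact/asboolP|].
have [i ni hi] := low a Ta na; have [j nj hj] := low b Tb nb.
have : J (pi i a * pi j b).
  have := hc _ (i + j)%N Jab; rewrite piM.
  have lt : (i < (i + j).+1)%N by lia.
  rewrite (bigD1 (Ordinal lt)) //= addKn addrC => h.
  apply: (subDr hs _ h); apply: (sub_sum _ hs) => k ne.
  have Tk c n : T c -> T (pi n c) by move=> hc'; apply: (mpow_rees hM); exact: pi_mpow.
  have [ki|ik] := ltnP k i; first by rewrite mulrC; apply: JM; [exact: Tk|exact: hi].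
  apply: JM; first exact: Tk.
  apply: hj; have : (k != i :> nat) by apply: contra_neq ne => e; exact: val_inj.
  by have := ltn_ord k; lia.
by case/(htest i j _ _ (pi_mpow hM i Ta) (pi_mpow hM j Tb)).
Qed.

Hypothesis hT : noeth T.

(** If [J] is proper and not prime, [homog_prime_test] gives homogeneous [a], [b] outside [J] with
    [a * b] in [J]. A prime over [J] contains [J + (a)] or [J + (b)], and the product of these two
    ideals lies in [J]; so the two lists are concatenated. The last clause is the nilpotence, modulo
    [J], of the intersection of the primes. *)
Lemma homog_prime_decomp J : ideal_in T J -> homog_closed J ->
  exists Ps : seq (set S), [/\
    forall P, P \in Ps -> [/\ prime_in T P, homog_closed P & J `<=` P],
    forall Q, prime_in T Q -> J `<=` Q -> exists2 P, P \in Ps & P `<=` Q &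
    forall s : seq S, size s = size Ps ->
      (forall a, a \in s -> T a /\ forall P, P \in Ps -> P a) -> J (\prod_(a <- s) a)].
Proof.
move=> hJ hc; pose Pr J := exists Ps : seq (set S), [/\
    forall P, P \in Ps -> [/\ prime_in T P, homog_closed P & J `<=` P],
    forall Q, prime_in T Q -> J `<=` Q -> exists2 P, P \in Ps & P `<=` Q &
    forall s : seq S, size s = size Ps ->
      (forall a, a \in s -> T a /\ forall P, P \in Ps -> P a) -> J (\prod_(a <- s) a)].
apply: (@noeth_ind _ _ hT [set J | ideal_in T J /\ homog_closed J] Pr) => //.
  by move=> K [/ideal_inP].
move=> {J hJ hc} J [hJ hc] IH; have [JT J0 JD JM] := hJ.
have [J1|n1] := pselect (J 1).
  exists [::]; split=> //; last by case=> // _ _; rewrite big_nil.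
  by move=> Q [_ q1 _] JQ; case: q1; exact: JQ.
have [htest|] := pselect (forall i j a b, A i a -> A j b -> J (a * b) -> J a \/ J b).
  have hP := homog_prime_test hJ hc n1 htest.
  exists [:: J]; split.
  - by move=> P; rewrite inE => /eqP ->; split=> // x.
  - by move=> Q hQ JQ; exists J => //; rewrite inE.
  - case=> // a [] // _ h; rewrite big_seq1; have [_ ] := h a (mem_head _ _).
    by apply; rewrite inE.
move/existsNP => [i /existsNP [j /existsNP [a /existsNP [b]]]].
move/not_implyP => [Aa /not_implyP [Ab /not_implyP [Jab /not_orP [na nb]]]].
have ext c d : A d c -> ~ J c ->
    [/\ ideal_in T (lin T (J `|` [set c])), homog_closed (lin T (J `|` [set c])) &
        J `<` lin T (J `|` [set c])].
  move=> Ac nc; have XT : J `|` [set c] `<=` T.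
    by move=> x [/JT //|->]; exact: (mpow_rees hM Ac).
  split; first exact: lin_ideal.
    apply: lin_homog => // x n [Jx|->]; first by apply: lin_gen; left; exact: hc.
    have [->|ne] := eqVneq n d; first by rewrite (pi_id hM Ac); apply: lin_gen; right.
    by rewrite (pi_neq hM Ac ne); have [] := lin_stable T (J `|` [set c]).
  split; first by move=> x Jx; apply: lin_gen; left.
  by move=> h; apply: nc; apply: h; apply: lin_gen; right.
have [ia ha sa] := ext a i Aa na; have [ib hb sb] := ext b j Ab nb.
have [P1 [h11 h12 h13]] := IH _ (conj ia ha) sa.
have [P2 [h21 h22 h23]] := IH _ (conj ib hb) sb.
have Ta := mpow_rees hM Aa; have Tb := mpow_rees hM Ab.
exists (P1 ++ P2); split.
- move=> P; rewrite mem_cat => /orP [/h11 [q1 q2 q3]|/h21 [q1 q2 q3]]; split=> //.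
    exact: subset_trans (properW sa) q3.
  exact: subset_trans (properW sb) q3.
- move=> Q hQ JQ; have [hQi _ hQp] := hQ.
  have sQ := ((ideal_inP Q).1 hQi).2.
  case: (hQp a b Ta Tb (JQ _ Jab)) => [Qa|Qb].
    have [|P hP PQ] := h12 Q hQ; last by exists P; rewrite ?mem_cat ?hP.
    by apply: lin_min sQ _ => x [/JQ|->].
  have [|P hP PQ] := h22 Q hQ; last by exists P; rewrite ?mem_cat ?hP ?orbT.
  by apply: lin_min sQ _ => x [/JQ|->].
- move=> s; rewrite size_cat => hs hsP.
  rewrite -(cat_take_drop (size P1) s) big_cat /=.
  have l1 : lin T (J `|` [set a]) (\prod_(x <- take (size P1) s) x).
    apply: h13; first by rewrite size_takel // hs leq_addr.
    move=> x /mem_take /hsP [Tx hx]; split=> // P hP; apply: hx.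
    by rewrite mem_cat hP.
  have l2 : lin T (J `|` [set b]) (\prod_(x <- drop (size P1) s) x).
    apply: h23; first by rewrite size_drop hs addKn.
    move=> x /mem_drop /hsP [Tx hx]; split=> // P hP; apply: hx.
    by rewrite mem_cat hP orbT.
  move: (\prod_(x <- take _ s) x) (\prod_(x <- drop _ s) x) l1 l2 => u v l1 l2.
  have [_ _ TM] := rees_subring hM.
  have stab w : T w -> stable_by T [set x | T x /\ J (w * x)].
    move=> Tw; split; first by rewrite /= mulr0; split=> //; exact: subring0 (rees_subring hM).
      move=> x y [Tx hx] [Ty hy]; split; first exact: subringD (rees_subring hM) Tx Ty.
      by rewrite mulrDr; exact: JD.
    move=> x y Tx [Ty hy]; split; first exact: TM.
    by rewrite mulrCA; exact: JM.
  have Tu : T u by have [h _ _ _] := ia; exact: h.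
  have : lin T (J `|` [set b]) `<=` [set x | T x /\ J (u * x)].
    apply: (lin_min (stab u Tu)) => x [Jx|->]; first by split; [exact: JT|exact: JM].
    split=> //; rewrite mulrC.
    have : lin T (J `|` [set a]) `<=` [set x | T x /\ J (b * x)].
      apply: (lin_min (stab b Tb)) => y [Jy|->]; first by split; [exact: JT|exact: JM].
      by split=> //; rewrite mulrC.
    by move/(_ _ l1) => [].
  by move/(_ _ l2) => [].
Qed.

(** The filtration by degree. A prime that is not homogeneous is not the sum of its components, but
    its growth can still be read on [P] cut down to [fil n]. *)
Definition fil n : set S := [set a | T a /\ forall i, (n < i)%N -> pi i a = 0].

Lemma submodule_fil n : submodule (fil n).
Proof.
have hs := submodule_rees hM; split.
  by split=> [|i _]; [exact: sub0|rewrite raddf0].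
move=> c u v [Tu hu] [Tv hv]; split; first exact: hs.2.
by move=> i hi; rewrite linearP /= hu // hv // scaler0 addr0.
Qed.

Lemma fil_mono n k : (n <= k)%N -> fil n `<=` fil k.
Proof. by move=> nk a [Ta ha]; split=> // i hi; apply: ha; exact: leq_ltn_trans hi. Qed.

Lemma fil_exists a : T a -> exists n, fil n a.
Proof.
move=> Ta; have [k hk] := pi_sum a; exists k; split=> // i ki.
rewrite [X in pi i X](hk k) // raddf_sum big1 // => j _ /=.
by apply: (pihomog_ne0 _ (pi_homog j a)); have := ltn_ord j; lia.
Qed.

Lemma filM i j a b : fil i a -> fil j b -> fil (i + j)%N (a * b).
Proof.
move=> [Ta ha] [Tb hb]; split; first by have [_ _ h] := rees_subring hM; exact: h.
move=> n hn; rewrite piM big1 // => k _.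
have [ik|ki] := ltnP i k; first by rewrite ha ?mul0r.
by rewrite hb ?mulr0 //; lia.
Qed.

(* For [f] in [Q] but not in the prime [P], multiplication by [f] embeds a shift
   of [T / P] into [Q / P]: the growth of [T / P] sums up that of [T / Q]. *)
Lemma prime_chain_growth P r (C : set (set S)) : (forall Q, C Q -> prime_in T Q) ->
  uchain C P r -> exists e, forall n, exists x,
    uchain (ival (fil (e * n)) (P `&` fil (e * n))) x 'C(n, r).
Proof.
move=> hC; elim=> {P r} [P /hC hP|P Q r /hC hP PQ hQr [e he]].
  have [hPi P1 _] := hP; have hPs := ideal_in_submodule hPi.
  (* One strict step is enough as ['C(n, 0) = 1], and degree 0 provides it because 1 lies outside
     [P]; hence the slope 0. *)
  exists 0%N => n; rewrite bin0 mul0n; exists (P `&` fil 0).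
  have f1 : fil 0 1.
    have h : A 0 1 by exact: span_gen.
    split; first exact: (mpow_rees hM h).
    by move=> i hi; rewrite (pi_neq hM h) //; lia.
  apply: (@UChainS _ _ _ (fil 0)).
  - by split; [exact: submoduleI (submodule_fil 0)|move=> x|move=> x []].
  - by split; [move=> x []|move=> h; apply: P1; case: (h _ f1)].
  - by apply: UChain0; split; [exact: submodule_fil|move=> x []|].
have hQ := hC _ (uchain_mem hQr).
have [hPi P1 hPp] := hP; have hPs := ideal_in_submodule hPi.
have [hQi _ _] := hQ; have hQs := ideal_in_submodule hQi.
have [f [Qf nPf]] : exists f, Q f /\ ~ P f.
  apply: contrapT => h; case: PQ => _; apply=> x Qx; apply: contrapT => nx.
  by apply: h; exists x.
have Tf : T f by have [h _ _ _] := hQi; exact: h.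
(* The slope [e] serves the chains modulo [Q], while [d] bounds the degree of [f], so that [f] maps
   [fil (e2 * n)] into [fil (e2 * n.+1)]. *)
have [d hd] := fil_exists Tf; pose e2 := maxn e d.
exists e2; elim=> [|n [x hx]].
  rewrite bin0n muln0; exists (fil 0); apply: UChain0.
  by split; [exact: submodule_fil|move=> x []|].
set N := (e2 * n.+1)%N.
have hfN : submodule (fil N) by exact: submodule_fil.
have [y hy] : exists y, uchain (ival (fil N) (Q `&` fil N)) y 'C(n, r).
  have [y hy] := he n.+1.
  have le : (e * n.+1 <= N)%N by rewrite leq_mul2r leq_maxl orbT.
  have hid : linear (fun x : S => x) by [].
  have e0 : fil (e * n.+1) `&` (fun x : S => x) @^-1` (Q `&` fil N) = Q `&` fil (e * n.+1).
    apply/seteqP; split=> [z [h1 [h2 _]]|z [h1 h2]] //; split=> //; split=> //.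
    exact: fil_mono h2.
  have h := @uchain_image _ _ _ _ hid _ _ (submodule_fil (e * n.+1)) (submoduleI hQs hfN) y 'C(n.+1, r).
  rewrite e0 in h; have {}h := h hy.
  exists (addS ((fun x : S => x) @` y) (Q `&` fil N)).
  apply: uchain_trunc (uchain_sub _ h); first exact: leq_bin2l.
  apply: ival_sub => //; apply: addS_min => //.
  by move=> _ [z hz <-]; exact: fil_mono hz.
have [w hw] : exists w, uchain (ival (Q `&` fil N) (P `&` fil N)) w 'C(n, r.+1).
  have e0 : fil (e2 * n) `&` ( *%R f) @^-1` (P `&` fil N) = P `&` fil (e2 * n).
    have NE : N = (e2 + e2 * n)%N by rewrite /N mulnS.
    have de2 : fil e2 f by apply: fil_mono hd; exact: leq_maxr.
    apply/seteqP; split=> z.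
      move=> [h1 [h2 _]]; split=> //; case: (hPp f z Tf _ h2) => //.
      by case: h1.
    move=> [h1 h2]; split=> //; split; last by rewrite NE; exact: filM.
    by have [_ _ _ PM] := hPi; exact: PM.
  have h := @uchain_image _ _ _ _ (mulr_linear f) _ _ (submodule_fil (e2 * n)) (submoduleI hPs hfN) x 'C(n, r.+1).
  rewrite e0 in h; have {}h := h hx.
  exists (addS ( *%R f @` x) (P `&` fil N)).
  apply: (uchain_sub _ h); apply: ival_sub => //; apply: addS_min.
  - exact: submoduleI.
  - move=> _ [z hz <-]; split; first by rewrite mulrC; have [_ _ _ QM] := hQi; apply: QM => //; case: hz.
    by rewrite /N mulnS; apply: filM => //; apply: fil_mono hd; exact: leq_maxr.
  - by move=> z [h1 h2]; split=> //; apply: (properW PQ).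
(* Pascal's rule: [w] starts the image under [f] of the chain modulo [P] at stage [n], and above it
   comes the chain modulo [Q]. *)
exists w; rewrite binS; apply: (uchain_cat _ _ hw hy); first by move=> z [].
by move=> z [h1 h2]; split=> //; exact: (properW PQ).
Qed.

(** Passing from [fil n] to [fil n.+1] only adds [A n.+1], which contributes at most the length of
    its own piece modulo [J]. *)
Lemma len_fil J n : ideal_in T J -> homog_closed J ->
  (forall i, flen (A i) (J `&` A i)) ->
  flen (fil n) (J `&` fil n) /\
  (len (fil n) (J `&` fil n) <= \sum_(i < n.+1) len (A i) (J `&` A i))%N.
Proof.
move=> hJ hc hfl; have hJs := ideal_in_submodule hJ.
elim: n => [|n [IH1 IH2]].
  have -> : fil 0 = A 0.
    apply/seteqP; split=> [a [Ta ha]|a ha].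
      have [k hk] := pi_sum a; rewrite (hk k.+1) // big_ord_recl big1 ?addr0.
        exact: pi_mpow.
      by move=> i _; exact: ha.
    split; first exact: (mpow_rees hM ha).
    by move=> i hi; rewrite (pi_neq hM ha) //; lia.
  by rewrite big_ord1; split.
set B := addS (fil n) (J `&` fil n.+1).
have hf k := submodule_fil k.
have hJf k := submoduleI hJs (hf k).
have hB : submodule B by exact: submodule_addS.
have hA k := submodule_mpow M k.
have hJA k := submoduleI hJs (hA k).
have JB : J `&` fil n.+1 `<=` B by exact: addSr.
have BF : B `<=` fil n.+1 by apply: addS_min => //; exact: fil_mono.
have hid : linear (fun x : S => x) by [].
have [||fl1 le1] := @flen_image_le _ _ _ _ hid (fil n) (J `&` fil n.+1) (hf n) (hJf _) (J `&` fil n) (hJf n) _ _ IH1.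
- by move=> x [].
- by move=> _ [x [h1 h2] <-]; split=> //; exact: fil_mono h2.
have AF k : A k `<=` fil k.
  move=> a ha; split; first exact: (mpow_rees hM ha).
  by move=> i hi; rewrite (pi_neq hM ha) //; lia.
have [||fl2 le2] := @flen_image_le _ _ _ _ hid (A n.+1) B (hA _) hB (J `&` A n.+1) (hJA _) _ _ (hfl n.+1).
- by move=> x [].
- by move=> _ [x [h1 h2] <-]; apply: JB; split=> //; exact: AF.
have e1 : addS ((fun x : S => x) @` fil n) (J `&` fil n.+1) = B by rewrite image_id.
have e2 : addS ((fun x : S => x) @` A n.+1) B = fil n.+1.
  rewrite image_id; apply/seteqP; split; first by apply: addS_min => //; exact: AF.
  move=> a [Ta ha]; exists (pi n.+1 a); first exact: pi_mpow.
  exists (a - pi n.+1 a); last by rewrite addrC subrK.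
  apply: addSl => //; split.
    apply: (subB (submodule_rees hM)) => //; apply: (mpow_rees hM); exact: pi_mpow.
  move=> i hi; rewrite raddfB /=; have [->|ne] := eqVneq i n.+1.
    by rewrite pihomog_id subrr.
  rewrite ha; last by lia.
  by rewrite (pi_neq hM (pi_mpow hM n.+1 Ta)) ?subr0.
rewrite e1 in fl1 le1; rewrite e2 in fl2 le2.
have fl : flen (fil n.+1) (J `&` fil n.+1) by exact: flen_trans fl2 fl1.
split=> //; rewrite (lenD _ hB _ _ _ fl) // big_ord_recr /= addnC leq_add //.
exact: leq_trans le1 IH2.
Qed.

(** The binomial lower bound for [T / P] meets the upper bound for [T / J]. The chain may consist of
    arbitrary primes; only [J] is homogeneous. *)
Lemma prime_chain_le J P r t : ideal_in T J -> homog_closed J ->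
  (forall i, flen (A i) (J `&` A i)) -> cumO t (fun i => len (A i) (J `&` A i)) ->
  uchain [set P | prime_in T P /\ J `<=` P] P r -> (r <= t)%N.
Proof.
move=> hJ hc hfl [C hC] hP; have hJs := ideal_in_submodule hJ.
have [[hPi _ _] JP] := uchain_mem hP; have hPs := ideal_in_submodule hPi.
have [|e he] := @prime_chain_growth P r [set P | prime_in T P /\ J `<=` P] _ hP.
  by move=> Q [].
apply: (@binomial_growth r t e C) => n; have [x hx] := he n.
have [fl le] := len_fil (e * n) hJ hc hfl.
apply: leq_trans (hC (e * n).+1); apply: leq_trans le.
apply: (@len_max _ _ _ _ x) => //; first exact: submodule_fil.
  by apply: submoduleI => //; exact: submodule_fil.
by apply: uchain_sub hx; apply: ival_sub => // y [h1 h2]; split=> //; exact: JP.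
Qed.

End HomogeneousPrimes.

(** * Systems of parameters *)

Section SystemsOfParameters.
Variables (R : comNzRingType) (m : set R) (p : nat) (M : set 'rV[R]_p).
Hypotheses (hR : noetherian R) (hlocal : local_ring m).
Hypotheses (hM : submodule M) (hfg : fin_gen M).
Local Notation S := {mpoly R[p]}.
Local Notation A := (mpow M).
Local Notation T := (rees M).
Local Notation pi n := (@pihomog p R mdeg n).
Implicit Types (a b z : S) (J P Q X : set S).

Let hT : noeth T := noeth_rees hM hR hfg.

Lemma homog_outside J P : homog_closed J -> J `<=` T -> submodule P -> ~ (J `<=` P) ->
  exists n a, [/\ A n a, J a & ~ P a].
Proof.
move=> hc JT hP nJP; apply: contrapT => h; apply: nJP => a Ja.
have [k hk] := pi_sum a; rewrite (hk k) //; apply: (sub_sum _ hP) => i _.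
apply: contrapT => ni; apply: h; exists (i : nat), (pi i a); split=> //; last exact: hc.
by apply: pi_mpow => //; exact: JT.
Qed.

Lemma mpowX n a e : A n a -> A (n * e)%N (a ^+ e).
Proof.
move=> ha; elim: e => [|e IH]; first by rewrite muln0 expr0; exact: span_gen.
by rewrite mulnS exprS; exact: exp_modM.
Qed.

Lemma ideal_inX J a e : ideal_in T J -> J a -> (0 < e)%N -> J (a ^+ e).
Proof.
move=> [JT J0 JD JM] Ja; case: e => // e _; rewrite exprSr; apply: (JM) => //.
have [T1 _ TM] := rees_subring hM.
by elim: e => [|e IH]; rewrite ?expr0 // exprS; apply: TM => //; exact: JT.
Qed.

(* If [x] avoids all primes but [Q], take [y] outside [Q] in the ideal and in
   all the other primes; then [x ^ deg y + y ^ deg x] avoids them all. *)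
Lemma homog_prime_avoidance (I : set S) (Ps : seq (set S)) :
  ideal_in T I -> homog_closed I ->
  (forall P, P \in Ps -> [/\ prime_in T P, homog_closed P, ~ (I `<=` P) &
     exists n b, [/\ (0 < n)%N, A n b & ~ P b]]) ->
  exists n a, [/\ (0 < n)%N, A n a, I a & forall P, P \in Ps -> ~ P a].
Proof.
move=> hI hc; have [IT I0 ID IM] := hI.
have [k] := ubnP (size Ps); elim: k => // k IH in Ps *; rewrite ltnS => hk hPs.
case: Ps hk hPs => [|Q Ps] hk hPs.
  by exists 1%N, 0; split=> //; apply: sub0; exact: submodule_mpow.
(* A prime contained in another member of the list is dropped, since avoiding the larger one avoids
   it. As [rem] deletes one occurrence, repetitions are removed as well, and the rest of the proof
   has incomparable primes. *)
have [[P [Q' [hP hQ' PQ']]]|nex] := pselect (exists P Q',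
    [/\ P \in Q :: Ps, Q' \in rem P (Q :: Ps) & P `<=` Q']).
  have [||n [a [n0 Aa Ia ha]]] := IH (rem P (Q :: Ps)).
  - by rewrite size_rem //= -ltnS; move: hk => /=; lia.
  - by move=> P' hP'; apply: hPs; exact: mem_rem hP'.
  exists n, a; split=> // P' hP'; have [->|ne] := eqVneq P' P.
    by move=> /PQ'; exact: ha.
  apply: ha; have := perm_to_rem hP => /perm_mem/(_ P').
  by rewrite hP' inE (negPf ne).
have [||n [x [n0 Ax Ix hx]]] := IH Ps; first by move: hk => /=; lia.
  by move=> P hP; apply: hPs; rewrite inE hP orbT.
have [hQ hcQ nIQ [nb [b [nb0 Ab nb']]]] := hPs Q (mem_head _ _).
have [hQi Q1 hQp] := hQ; have hQs := ideal_in_submodule hM hQi.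
have [Qx|nQx] := pselect (Q x); last first.
  by exists n, x; split=> // P; rewrite inE => /orP [/eqP ->|/hx].
have hP P : P \in Ps -> [/\ prime_in T P, homog_closed P & ~ (P `<=` Q)].
  move=> hP; have [|h1 h2 _ _] := hPs P; first by rewrite inE hP orbT.
  split=> // PQ; have [e|ne] := eqVneq P Q.
    by apply: nex; exists P, P; split=> //=; rewrite ?inE ?hP ?orbT // e eqxx -e.
  apply: nex; exists P, Q; split=> //=; first by rewrite inE hP orbT.
  by rewrite eq_sym (negPf ne) mem_head.
have [n1 [y1 [Ay1 Iy1 nQy1]]] := homog_outside hc IT hQs nIQ.
have [n2 [y2 [Ay2 hy2 nQy2]]] : exists n2 y2, [/\ A n2 y2, forall P, P \in Ps -> P y2 & ~ Q y2].
  have {}hP := hP; clear -hP hQ hM hQs hQp; elim: Ps hP => [|P Ps IH] hP.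
    by exists 0%N, 1; split=> //; [exact: span_gen|exact: prime_in_1 hQ].
  have [|n2 [y2 [h1 h2 h3]]] := IH; first by move=> P' hP'; apply: hP; rewrite inE hP' orbT.
  have [hPp hPc nPQ] := hP P (mem_head _ _).
  have [PT P0 PD PM] : ideal_in T P by case: hPp.
  have [n3 [y3 [g1 g2 g3]]] := homog_outside hPc PT hQs nPQ.
  have T2 := mpow_rees hM h1; have T3 := mpow_rees hM g1.
  exists (n3 + n2)%N, (y3 * y2); split; first exact: exp_modM.
    move=> P'; rewrite inE => /orP [/eqP ->|hP']; first by rewrite mulrC; exact: PM.
    have [|[[_ _ _ P'M] _ _] _ _] := hP P'; first by rewrite inE hP' orbT.
    by apply: P'M => //; exact: h2.
  by move=> /(hQp _ _ T3 T2) [].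
(* The factor [b], of positive degree and outside [Q], makes the degree [e] positive, so that
   [x ^+ e] stays in every ideal containing [x]. *)
pose y := y1 * (y2 * b); pose e := (n1 + (n2 + nb))%N.
have Ay : A e y by rewrite /y /e; apply: exp_modM => //; exact: exp_modM.
have Ty1 := mpow_rees hM Ay1; have Ty2 := mpow_rees hM Ay2; have Tb := mpow_rees hM Ab.
have Ty := mpow_rees hM Ay; have Tx := mpow_rees hM Ax.
have [T1 _ TM] := rees_subring hM.
have Iy : I y by rewrite /y mulrC; apply: (IM) => //; exact: TM.
have nQy : ~ Q y.
  move=> /(hQp _ _ Ty1 (TM _ _ Ty2 Tb)) [//|/(hQp _ _ Ty2 Tb)].
  by case.
have e0 : (0 < e)%N by rewrite /e; lia.
have Az : A (n * e)%N (x ^+ e + y ^+ n).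
  apply: (subD (submodule_mpow M _)); first exact: mpowX.
  by rewrite mulnC; exact: mpowX.
exists (n * e)%N, (x ^+ e + y ^+ n); split=> //.
- by rewrite muln_gt0 n0.
- by apply: ID; exact: ideal_inX.
move=> P; rewrite inE => /orP [/eqP ->|hPin] hz.
  apply: nQy; apply: (prime_in_exp hM hQ Ty (n := n)).
  by apply: (subDr hQs _ hz); apply: ideal_inX.
have [hPp _ _] := hP P hPin; have hPi : ideal_in T P by case: hPp.
apply: (hx P hPin); apply: (prime_in_exp hM hPp Tx (n := e)).
apply: (subDr (ideal_in_submodule hM hPi) (u := y ^+ n)); last by rewrite addrC.
apply: ideal_inX => //; have [PT P0 PD PM] := hPi.
by rewrite /y mulrA mulrAC; apply: (PM); [exact: TM|exact: hy2].
Qed.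

Definition hprimes : set (set S) :=
  [set P | [/\ prime_in T P, homog_closed P & forall c, m c -> P (c%:A)]].

(** The homogeneous maximal ideal: [m] in degree 0 and everything in positive degrees. It is the
    largest member of [hprimes]. *)
Definition irrelevant : set S := [set a | T a /\ exists2 c, m c & pi 0 a = c%:A].

Lemma scalar_inj (c d : R) : c%:A = d%:A :> S -> c = d.
Proof. by rewrite -!mul_mpolyC !mulr1 => /eqP; rewrite mpolyC_eq => /eqP. Qed.

Lemma mpow0P a : A 0 a <-> exists c : R, a = c%:A. Proof. exact: exp_mod0. Qed.

Lemma irrelevant_pos n a : (0 < n)%N -> A n a -> irrelevant a.
Proof.
move=> n0 ha; split; first exact: (mpow_rees hM ha).
exists 0; first exact: (sub0 (local_ideal hlocal)).
by rewrite (pi_neq hM ha) ?scale0r // neq_ltn n0.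
Qed.

Lemma irrelevant_hprime : hprimes irrelevant.
Proof.
have hm := local_ideal hlocal; have [m0 mD mM] := (ideal_stable m).1 hm.
have A0 c : A 0 (c%:A) by apply/mpow0P; exists c.
have hid : ideal_in T irrelevant.
  split; first by move=> a [].
  - by split; [exact: subring0 (rees_subring hM)|exists 0 => //; rewrite raddf0 scale0r].
  - move=> a b [Ta [c hc ea]] [Tb [d hd eb]]; split; first exact: (subringD (rees_subring hM)).
    by exists (c + d); [exact: mD|rewrite raddfD /= ea eb scalerDl].
  - move=> a b Ta [Tb [c hc eb]]; split; first by have [_ _ h] := rees_subring hM; exact: h.
    have /mpow0P [d ed] := pi_mpow hM 0 Ta.
    exists (d * c); first exact: mM.
    by rewrite piM big_ord1 /= ed eb -scalerAl mul1r scalerA.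
have hcl : homog_closed irrelevant.
  move=> a n [Ta [c hc ea]]; split; first by apply: (mpow_rees hM); exact: pi_mpow.
  case: n => [|n]; first by exists c => //; rewrite pihomog_id.
  exists 0 => //; rewrite scale0r; exact: (pi_neq hM (pi_mpow hM n.+1 Ta)).
split=> //; last first.
  move=> c hc; split; first exact: rees_scalar.
  by exists c => //; rewrite (pi_id hM (A0 c)).
apply: (homog_prime_test hM) => //.
  move=> [_ [c hc]]; have := A0 1; rewrite scale1r => h1; rewrite (pi_id hM h1) => e1.
  by apply: (local_not1 hlocal); rewrite (@scalar_inj 1 c) // scale1r.
move=> [|i] [|j] a b ha hb hab; try by [left; exact: (irrelevant_pos _ ha)|right; exact: (irrelevant_pos _ hb)].
have [_ [c hc]] := hab.
move/mpow0P: (ha) => [d ed]; move/mpow0P: (hb) => [e ee].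
rewrite ed ee -scalerAl mul1r scalerA (pi_id hM (A0 _)) => /scalar_inj e1.
have hde : m (d * e) by rewrite e1.
have [hd|he] := local_prime hR hlocal hde.
  by left; split; [rewrite -ed; exact: (mpow_rees hM ha)|exists d => //; rewrite (pi_id hM (A0 d))].
by right; split; [rewrite -ee; exact: (mpow_rees hM hb)|exists e => //; rewrite (pi_id hM (A0 e))].
Qed.

Lemma hprime_sub_irrelevant P : hprimes P -> P `<=` irrelevant.
Proof.
move=> [[[PT P0 PD PM] P1 _] hc _] a Pa; split; first exact: PT.
have /mpow0P [c ec] := pi_mpow hM 0 (PT _ Pa); exists c => //.
apply: contrapT => /(local_unit hR hlocal) [d hd]; apply: P1.
have := PM _ _ (rees_scalar hM d) (hc _ 0%N Pa).
by rewrite ec -scalerAl mul1r scalerA hd scale1r.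
Qed.

Lemma hprime_irrelevant P : hprimes P ->
  (forall n a, (0 < n)%N -> A n a -> P a) -> P = irrelevant.
Proof.
move=> hP hpos; apply/seteqP; split; first exact: hprime_sub_irrelevant.
have [[hPi _ _] _ hPm] := hP; have hPs := ideal_in_submodule hM hPi.
move=> a [Ta [c hc ea]]; have [k hk] := pi_sum a; rewrite (hk k) //.
apply: (sub_sum _ hPs) => -[[|i] hi] _ /=; first by rewrite ea; exact: hPm.
exact: (hpos i.+1 _ _ (pi_mpow hM _ Ta)).
Qed.

(** A bound on the dimension of the fiber ring modulo [X], measured by homogeneous primes only. *)
Definition coheight_le X r := forall P q, X `<=` P -> uchain hprimes P q -> (q <= r)%N.

Definition mT X : set S := lin T (X `|` [set c%:A | c in m]).

Lemma mT_homog X : (forall x, X x -> exists d, A d x) ->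
  ideal_in T (mT X) /\ homog_closed (mT X).
Proof.
move=> hX; apply: (lin_homog_gen hM) => x [/hX //|[c _ <-]].
by exists 0%N; apply/mpow0P; exists c.
Qed.

Lemma mT_hprimes X P : prime_in T P -> homog_closed P -> mT X `<=` P -> hprimes P.
Proof.
by move=> h1 h2 h3; split=> // c hc; apply: h3; apply: lin_gen; right; exists c.
Qed.

Lemma mT_sub X P : hprimes P -> X `<=` P -> mT X `<=` P.
Proof.
move=> [[hPi _ _] _ hPm] XP; have [_ sP] := (ideal_inP M P).1 hPi.
by apply: (lin_min sP) => x [/XP //|[c hc <-]]; exact: hPm.
Qed.

(** A prime over [X] that starts a chain of length [r.+1] must belong to the finite list of
    [homog_prime_decomp], since a listed prime strictly below would start a longer chain. It
    suffices that [a] avoid these. Avoidance asks for an element of positive degree outside each of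
    them; that could fail only for [irrelevant], which starts no chain of positive length. *)
Lemma coheight_step X r (I : set S) : (forall x, X x -> exists d, A d x) ->
  coheight_le X r.+1 -> ideal_in T I -> homog_closed I ->
  (forall P, X `<=` P -> uchain hprimes P r.+1 -> ~ (I `<=` P)) ->
  exists n a, [/\ (0 < n)%N, A n a, I a & coheight_le (X `|` [set a]) r].
Proof.
move=> hX hr hI hIc hch; have [hJ hJc] := mT_homog hX.
have [Ps [hPs1 hPs2 _]] := homog_prime_decomp hM hT hJ hJc.
have XJ : X `<=` mT X by move=> x Xx; apply: lin_gen; left.
pose Ps' := [seq P <- Ps | `[< uchain hprimes P r.+1 >]].
have [|n [a [n0 Aa Ia ha]]] := @homog_prime_avoidance I Ps' hI hIc.
  move=> P; rewrite mem_filter => /andP [/asboolP hPc /hPs1 [hP hPh JP]].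
  have XP := subset_trans XJ JP.
  split=> //; first exact: hch.
  apply: contrapT => hn; have hPp := uchain_mem hPc.
  have PI : P = irrelevant.
    apply: hprime_irrelevant => // n b n0 Ab; apply: contrapT => nb.
    by apply: hn; exists n, b.
  inversion hPc as [|x Q n hx PQ hQ e1 e2].
  case: PQ => _; apply; rewrite PI; apply: hprime_sub_irrelevant.
  exact: uchain_mem hQ.
exists n, a; split=> // P q XP hPq.
have XP' : X `<=` P by move=> x Xx; apply: XP; left.
have hqr := hr P q XP' hPq; move: hqr; rewrite leq_eqVlt => /orP [/eqP eq|//].
have hPp := uchain_mem hPq; have [hPpr _ _] := hPp.
have [P0 hP0 P0P] := hPs2 P hPpr (mT_sub hPp XP').
have [q1 q2 q3] := hPs1 _ hP0.
have [e|ne] := pselect (P0 = P).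
  have : P0 \in Ps' by rewrite mem_filter hP0 andbT; apply/asboolP; rewrite e -eq.
  by move/ha; case; rewrite e; apply: XP; right.
have : uchain hprimes P0 q.+1.
  apply: (UChainS _ _ hPq); first exact: mT_hprimes q3.
  exact: sub_neq_proper.
move/(hr _ _ (subset_trans XJ q3)); by rewrite eq ltnn.
Qed.

Variable s : nat.
Hypothesis hdim : coheight_le set0 s.

(** The parameter of index [j] is taken in [I] if [j < k] and in [T] afterwards. In the first case
    the primes to avoid start chains of length [s - j > s - k], so they cannot contain [I]. *)
Lemma choose_parameters (I : set S) k : ideal_in T I -> homog_closed I -> (k <= s)%N ->
  (forall P q, I `<=` P -> uchain hprimes P q -> (q <= s - k)%N) ->
  exists x : nat -> S, exists d : nat -> nat, [/\
    forall i, (i < s)%N -> (0 < d i)%N /\ A (d i) (x i),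
    forall i, (i < k)%N -> I (x i) &
    coheight_le [set x i | i in [set i | (i < s)%N]] 0].
Proof.
move=> hI hIc ks hIk.
suff H : forall j, (j <= s)%N -> exists x : nat -> S, exists d : nat -> nat, [/\
    forall i, (i < j)%N -> (0 < d i)%N /\ A (d i) (x i),
    forall i, (i < j)%N -> (i < k)%N -> I (x i) &
    coheight_le [set x i | i in [set i | (i < j)%N]] (s - j)].
  have [x [d [h1 h2 h3]]] := H s (leqnn s); exists x, d; split=> //.
    by move=> i ik; apply: h2 => //; exact: leq_trans ks.
  by rewrite subnn in h3.
elim=> [|j IH] hj.
  exists (fun=> 0), (fun=> 0%N); split=> // P q _ hq; rewrite subn0.
  by apply: hdim hq => x.
have [x [d [h1 h2 h3]]] := IH (ltnW hj).
pose X := [set x i | i in [set i | (i < j)%N]].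
have hX a : X a -> exists d, A d a by case=> i /h1 [_ h] <-; exists (d i).
have sj : (s - j = (s - j.+1).+1)%N by lia.
have hTi : ideal_in T T.
  have [T1 TB TM] := rees_subring hM.
  by split=> //; [exact: subring0 (rees_subring hM)|move=> a b; exact: subringD (rees_subring hM)].
have hTc : homog_closed T by move=> a n Ta; apply: (mpow_rees hM); exact: pi_mpow.
have [I' [hI' hIc' hII hch]] : exists I', [/\ ideal_in T I', homog_closed I',
    (j < k)%N -> I' `<=` I & forall P, X `<=` P -> uchain hprimes P (s - j.+1).+1 -> ~ (I' `<=` P)].
  have [jk|kj] := ltnP j k.
    exists I; split=> // [_ a //|P XP hP IP].
    by have := hIk P _ IP hP; lia.
  exists T; split=> // P XP hP TP.
  have [hPp _ _] := uchain_mem hP; apply: (prime_in_1 hPp); apply: TP.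
  by have [] := rees_subring hM.
rewrite sj in h3.
have [n [a [n0 Aa Ia ha]]] := coheight_step hX h3 hI' hIc' hch.
exists (fun i => if (i == j)%N then a else x i), (fun i => if (i == j)%N then n else d i).
split.
- move=> i; rewrite ltnS leq_eqVlt => /orP [/eqP ->|hi]; first by rewrite eqxx.
  by rewrite (ltn_eqF hi); exact: h1.
- move=> i; rewrite ltnS leq_eqVlt => /orP [/eqP ->|hi] hik; first by rewrite eqxx; exact: hII.
  by rewrite (ltn_eqF hi); exact: h2.
- move=> P q XP hP; apply: ha hP => y [[i /= hi <-]|->].
    by apply: XP; exists i; rewrite ?(ltn_eqF hi) //=; exact: ltnW.
  by apply: XP; exists j; rewrite ?eqxx /=.
Qed.

(** A prime contains a power of an element only if it contains the element, so the parameters may be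
    raised to the common degree [D], the product of their degrees. *)
Lemma choose_parameters_same_degree (I : set S) k : ideal_in T I -> homog_closed I -> (k <= s)%N ->
  (forall P q, I `<=` P -> uchain hprimes P q -> (q <= s - k)%N) ->
  exists D, exists x : 'I_s -> S, [/\ (0 < D)%N,
    forall i, A D (x i), forall i : 'I_s, (i < k)%N -> I (x i) &
    coheight_le (range x) 0].
Proof.
move=> hI hIc ks hIk; have [x [d [h1 h2 h3]]] := choose_parameters hI hIc ks hIk.
pose D := (\prod_(i < s) d i)%N.
have D0 : (0 < D)%N by rewrite prodn_gt0 // => i; case: (h1 i (ltn_ord i)).
have e0 (i : 'I_s) : (d i * (D %/ d i) = D)%N.
  by rewrite mulnC divnK // /D (bigD1 i) //= dvdn_mulr.
have e1 (i : 'I_s) : (0 < D %/ d i)%N.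
  by move: D0; rewrite -{1}(e0 i) muln_gt0 => /andP [].
exists D, (fun i : 'I_s => x i ^+ (D %/ d i)); split=> //.
- by move=> i; rewrite -{1}(e0 i); apply: mpowX; case: (h1 i (ltn_ord i)).
- by move=> i ik; apply: ideal_inX => //; exact: h2.
- move=> P q XP hP; apply: h3 (hP) => _ [i /= hi <-].
  have [hPp _ _] := uchain_mem hP; have [_ Ax] := h1 i hi.
  apply: (prime_in_exp hM hPp (mpow_rees hM Ax) (n := (D %/ d i)%N)).
  by apply: XP; exists (Ordinal hi).
Qed.

Lemma exp_mod_prod (W N : set S) n : submodule N ->
  (forall t : seq S, size t = n -> (forall a, a \in t -> W a) -> N (\prod_(a <- t) a)) ->
  exp_mod W n `<=` N.
Proof.
elim: n N => [|n IH] N hN h.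
  by apply: span_min => // _ ->; have := h [::] erefl; rewrite big_nil; apply.
apply: mul_mod_min => // w c hw; move: c.
suff H : exp_mod W n `<=` [set c | N (w * c)] by exact: H.
apply: IH; first exact: submodule_colon.
move=> t ht hW /=; have := h (w :: t); rewrite /= ht big_cons; apply=> // a.
by rewrite inE => /orP [/eqP ->|/hW].
Qed.

(** All primes listed over [mT X] equal [irrelevant], which contains [A 1]. By the nilpotence clause
    a product of [size Ps] elements of degree one then lies in [mT X]. *)
Lemma coheight0_power X : (forall x, X x -> exists d, A d x) -> coheight_le X 0 ->
  exists q, forall n, (q <= n)%N -> A n `<=` mT X.
Proof.
move=> hX h0; have [hJ hJc] := mT_homog hX.
have [Ps [hPs1 _ hPs3]] := homog_prime_decomp hM hT hJ hJc.
have XJ : X `<=` mT X by move=> x Xx; apply: lin_gen; left.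
have PI P : P \in Ps -> P = irrelevant.
  move=> /hPs1 [q1 q2 q3]; have hP := mT_hprimes q1 q2 q3.
  apply: contrapT => ne.
  have : uchain hprimes P 1.
    apply: (UChainS hP); last by apply: UChain0; exact: irrelevant_hprime.
    by apply: sub_neq_proper => //; exact: hprime_sub_irrelevant.
  by move/(h0 _ _ (subset_trans XJ q3)).
have hJs := ideal_in_submodule hM hJ.
exists (size Ps) => n hn; rewrite -(subnK hn) /mpow exp_mod_split.
apply: mul_mod_min => // a b ha hb; have [_ _ _ JM] := hJ.
apply: JM; first exact: (mpow_rees hM ha).
move: b hb; apply: exp_mod_prod => // t ht hW; apply: hPs3 => // c /hW hc.
have A1c : A 1 c by rewrite (mpow1E hM).
split; first exact: (mpow_rees hM A1c).
by move=> P /PI ->; exact: (irrelevant_pos _ A1c).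
Qed.

(** Together with [coheight0_power] this gives the hypothesis of Nakayama's lemma in degree [n]. The
    quantified [b] makes the tested set stable under [T], as in [graded_fam_gen]. *)
Lemma mT_component D X n : (forall x, X x -> A D x) -> (D <= n)%N ->
  A n `&` mT X `<=` addS (mul_mod (span X) (A (n - D))) (scale_mod m (A n)).
Proof.
move=> hX Dn a [Aa]; set N := addS _ _.
have hN : submodule N.
  by apply: submodule_addS; exact: submodule_span.
have [T1 _ TM] := rees_subring hM.
suff h : mT X `<=` [set a | forall b, T b -> N (pi n (b * a))].
  by move/h/(_ 1 T1); rewrite mul1r (pi_id hM Aa).
apply: lin_min.
  split; first by move=> b _; rewrite mulr0 raddf0; exact: (sub0 hN).
    by move=> u v hu hv b hb; rewrite mulrDr raddfD; apply: (subD hN); [exact: hu|exact: hv].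
  by move=> b u hb hu e he; rewrite mulrA; apply: hu; exact: TM.
move=> x [Xx|[c hc <-]] b Tb.
  rewrite (pi_mul_homog hM _ (hX _ Xx) Dn) mulrC; apply: addSl; first exact: submodule_span.
  by apply: mul_mod_gen; [exact: span_gen|exact: pi_mpow].
rewrite mulrC mulr_algl linearZ /=; apply: addSr; first exact: submodule_span.
by apply: span_gen; exists c => //; exists (pi n b) => //; exact: pi_mpow.
Qed.

End SystemsOfParameters.

(** * Finite length and the Fitting ideal *)

Section FiniteLength.
Variables (R : comNzRingType) (V : lmodType R).
Implicit Types (B N U X Y : set V) (x : V).

Lemma scalel_linear x : linear (fun c : R^o => c *: x).
Proof. by move=> a u v; rewrite scalerDl scalerA. Qed.

Lemma len_addS X Y B : submodule X -> submodule Y -> submodule B ->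
  B `<=` X -> B `<=` Y -> flen X B -> flen Y B ->
  flen (addS X Y) B /\ (len (addS X Y) B <= len X B + len Y B)%N.
Proof.
move=> hX hY hB BX BY fX fY; have hid : linear (fun x : V => x) by [].
have [|f1 l1] := @flen_image_le _ _ _ _ hid X Y hX hY B hB BX _ fX.
  by rewrite image_id.
rewrite image_id in f1 l1; have hXY := submodule_addS hX hY.
have YXY : Y `<=` addS X Y by exact: addSr.
have f2 := flen_trans hXY hY hB BY YXY f1 fY; split=> //.
by rewrite (lenD hXY hY hB BY YXY f2) leq_add2r.
Qed.

Definition cyclic_sum (xs : seq V) B := foldr (fun x Y => addS (range (fun c => c *: x)) Y) B xs.

Lemma submodule_cyclic x : submodule (range (fun c => c *: x)).
Proof. exact: (submodule_image (scalel_linear x) (@submoduleT R R^o)). Qed.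

Lemma submodule_cyclic_sum xs B : submodule B -> submodule (cyclic_sum xs B).
Proof.
move=> hB; elim: xs => [|x xs IH] //=; apply: submodule_addS => //.
exact: submodule_cyclic.
Qed.

Lemma cyclic_sum_base xs B : B `<=` cyclic_sum xs B.
Proof.
elim: xs => [|x xs IH] //=; apply: subset_trans IH _; apply: addSr.
exact: submodule_cyclic.
Qed.

Lemma cyclic_sum_gen xs B x : submodule B -> x \in xs -> cyclic_sum xs B x.
Proof.
move=> hB; elim: xs => [|y xs IH] //=; rewrite inE => /orP [/eqP ->|/IH h].
  by apply: addSl; [exact: submodule_cyclic_sum|exists 1; rewrite ?scale1r].
by apply: addSr => //; exact: submodule_cyclic.
Qed.

Lemma span_cyclic_sum xs B : submodule B -> addS (span [set` xs]) B `<=` cyclic_sum xs B.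
Proof.
move=> hB; have hC := submodule_cyclic_sum xs hB.
apply: addS_min => //; last exact: cyclic_sum_base.
by apply: span_min => // x; exact: cyclic_sum_gen.
Qed.

Variable c : set R.
Hypotheses (hc : ideal c) (fc : @flen R R^o [set: R] c).

Lemma len_cyclic_sum xs B : submodule B -> (forall x a, x \in xs -> c a -> B (a *: x)) ->
  flen (cyclic_sum xs B) B /\
  (len (cyclic_sum xs B) B <= size xs * @len R R^o [set: R] c)%N.
Proof.
move=> hB; elim: xs => [|x xs IH] h /=; first by split; [exact: flen_refl|rewrite len_refl].
have [|f1 l1] := IH; first by move=> y a hy; apply: h; rewrite inE hy orbT.
have hC := submodule_cyclic_sum xs hB; have hx := submodule_cyclic x.
have BC := @cyclic_sum_base xs B.
have [||f2 l2] := @flen_image_le _ _ _ _ (scalel_linear x) [set: R] (cyclic_sum xs B)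
  (@submoduleT R R^o) hC c hc _ _ fc.
- by [].
- by move=> _ [a ha <-]; apply: BC; apply: h; rewrite ?mem_head.
have hCC := submodule_addS hx hC.
have CCC : cyclic_sum xs B `<=` addS (range (fun a => a *: x)) (cyclic_sum xs B) by exact: addSr.
have f3 := flen_trans hCC hC hB BC CCC f2 f1; split=> //.
by rewrite (lenD hCC hC hB BC CCC f3) mulSn leq_add.
Qed.

Lemma len_span xs B : submodule B -> (forall x a, x \in xs -> c a -> B (a *: x)) ->
  flen (addS (span [set` xs]) B) B /\
  (len (addS (span [set` xs]) B) B <= size xs * @len R R^o [set: R] c)%N.
Proof.
move=> hB h; have [f1 l1] := len_cyclic_sum hB h.
have hsp : submodule (span [set` xs]) by exact: submodule_span.
have hC := submodule_cyclic_sum xs hB; have le := @span_cyclic_sum xs B hB.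
split; first exact: flen_bot le f1.
apply: leq_trans l1; apply: len_mono => //; first exact: submodule_addS.
exact: addSr.
Qed.

Lemma fin_genP N : fin_gen N <-> exists xs : seq V, N = span [set` xs].
Proof.
split=> [[n [x ->]]|[xs ->]].
  exists [seq x i | i <- enum 'I_n]; congr (Defs.span _); apply/seteqP; split.
    by move=> _ [i _ <-] /=; apply: map_f; rewrite mem_enum.
  by move=> y /= /mapP [i _ ->]; exists i.
exists (size xs), (tnth (in_tuple xs)); congr (Defs.span _); apply/seteqP; split.
  by move=> y /= /(tnthP (in_tuple xs)) [i ->]; exists i.
by move=> _ [i _ <-] /=; exact: (mem_tnth i (in_tuple xs)).
Qed.

Lemma flen_scale_mod N : submodule N -> fin_gen N -> flen N (scale_mod c N).
Proof.
move=> hN /fin_genP [xs hxs]; have hS : submodule (scale_mod c N) by exact: submodule_span.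
have [|f _] := @len_span xs (scale_mod c N) hS.
  move=> x a hx ha; apply: span_gen; exists a => //; exists x => //.
  by rewrite hxs; exact: span_gen.
apply: flen_bot f; rewrite -hxs; exact: addSl.
Qed.

(** Adding to [B] an element of [N] outside it lowers the remaining length by at least one. Once [N]
    is exhausted, zeros pad the list to size exactly [t]. *)
Lemma generators_of_len N B t : submodule N -> submodule B -> B `<=` N -> flen N B ->
  (len N B <= t)%N ->
  exists zs : seq V, [/\ size zs = t, forall z, z \in zs -> N z &
    N `<=` addS (span [set` zs]) B].
Proof.
move=> hN; elim: t B => [|t IH] B hB BN fl ht.
  exists [::]; split=> //; have [NB|ne] := pselect (N `<=` B).
    by apply: subset_trans NB _; apply: addSr; exact: submodule_span.
  have : (len B B < len N B)%N by apply: len_proper.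
  by rewrite ltnNge (leq_trans ht).
have [NB|ne] := pselect (N `<=` B).
  exists (nseq t.+1 0); split; first by rewrite size_nseq.
    by move=> z /nseqP [-> _]; exact: sub0.
  by apply: subset_trans NB _; apply: addSr; exact: submodule_span.
have [z [Nz nBz]] : exists z, N z /\ ~ B z.
  by apply: contrapT => h; apply: ne => z Nz; apply: contrapT => nz; apply: h; exists z.
pose B' := addS (range (fun a => a *: z)) B.
have hz := submodule_cyclic z; have hB' : submodule B' by exact: submodule_addS.
have Bz : B' z by apply: addSl => //; exists 1; rewrite ?scale1r.
have BB' : B `<=` B' by exact: addSr.
have B'N : B' `<=` N by apply: addS_min => // _ [a _ <-]; exact: subZ.
have [|zs [hs hzN hgen]] := IH B' hB' B'N (flen_top BB' fl).
- rewrite -ltnS; apply: leq_trans ht.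
  rewrite [ltnRHS](lenD hN hB' hB BB' B'N fl) -[ltnLHS]addn0 ltn_add2l.
  have := @len_proper _ _ B' B B hB' hB hB; rewrite len_refl //; apply.
  + by [].
  + by split=> // h; apply: nBz; exact: h.
  + exact: flen_bot fl.
exists (z :: zs); split; first by rewrite /= hs.
  by move=> y; rewrite inE => /orP [/eqP ->|/hzN].
have hsp : submodule (span [set` z :: zs]) by exact: submodule_span.
apply: subset_trans hgen _; apply: addS_min; first exact: submodule_addS.
  move=> y hy; apply: addSl => //; apply: span_mono hy => w /= hw.
  by rewrite inE hw orbT.
apply: addS_min; [exact: submodule_addS| |exact: addSr].
move=> _ [a _ <-]; apply: addSl => //; apply: (subZ _ hsp); apply: span_gen.
by rewrite /= mem_head.
Qed.

End FiniteLength.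

Section ResidueField.
Variables (R : comNzRingType) (m : set R).
Hypotheses (hR : noetherian R) (hlocal : local_ring m).

Lemma len_residue : @flen R R^o [set: R] m /\ (@len R R^o [set: R] m <= 1)%N.
Proof.
have [[hm hne hmax] _] := hlocal.
have h : @len_le R R^o [set: R] m 1.
  move=> x n; case=> // y z {}n [hy my _] yz hz; rewrite ltnS.
  have [hzs mz _] := uchain_mem hz; case: (hmax z hzs mz) => e.
    by case: yz => _; case; rewrite e.
  case: hz e => // u v k _ uv _ eu; case: uv => _; case; rewrite eu.
  by [].
have fl : @flen R R^o [set: R] m by exists 1%N.
by split=> //; apply/len_leP => //; exact: submoduleT.
Qed.

End ResidueField.

Section Fitting.
Variables (R : comNzRingType) (p : nat) (M : set 'rV[R]_p).
Hypotheses (hR : noetherian R) (hM : submodule M).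
Hypothesis (hlen : flen [set: 'rV[R]_p] M).

Lemma ideal_fin_gen (J : set R) : ideal J -> @fin_gen R R^o J.
Proof. exact: hR. Qed.

Let cond : set R := [set a | forall v : 'rV[R]_p, M (a *: v)].

Let hcond : ideal cond.
Proof.
split; first by move=> v; rewrite scale0r; exact: sub0.
by move=> a u w hu hw v; rewrite scalerDl -scalerA; apply: hM.2; [exact: hu|exact: hw].
Qed.

(** [cond] is the annihilator of [F / M]. It is reached through the ideals [cj j] annihilating the
    first [j] basis vectors; each successive quotient embeds in [F / M] by acting on the next basis
    vector. *)
Lemma flen_conductor : @flen R R^o [set: R] cond.
Proof.
pose e (i : 'I_p) : 'rV[R]_p := delta_mx 0 i.
pose cj j : set R := [set a | forall i : 'I_p, (i < j)%N -> M (a *: e i)].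
have hcj j : ideal (cj j).
  split; first by move=> i _; rewrite scale0r; exact: sub0.
  by move=> a u w hu hw i hi; rewrite scalerDl -scalerA; apply: hM.2; [exact: hu|exact: hw].
suff h j : (j <= p)%N -> @flen R R^o [set: R] (cj j).
  suff -> : cond = cj p by exact: h.
  apply/seteqP; split=> a ha; first by move=> i _; exact: ha.
  move=> v; rewrite (row_sum_delta v) scaler_sumr; apply: sub_sum => // i _.
  by rewrite scalerA mulrC -scalerA; apply: subZ => //; exact: ha.
elim: j => [|j IH] hj.
  have -> : cj 0%N = [set: R] by apply/seteqP; split.
  exact: flen_refl.
have lt : (j < p)%N by [].
have sub : cj j.+1 `<=` cj j by move=> a ha i hi; apply: ha; exact: ltnW.
have e0 : cj j.+1 = cj j `&` (fun a : R^o => a *: e (Ordinal lt)) @^-1` M.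
  apply/seteqP; split=> a; first by move=> ha; split; [exact: sub|exact: ha].
  move=> [h1 h2] i; rewrite ltnS leq_eqVlt => /orP [/eqP ei|/h1 //].
  by have -> : i = Ordinal lt by exact: val_inj.
have fl : @flen R R^o (cj j) (cj j.+1).
  rewrite e0; apply/(flen_image (scalel_linear (e (Ordinal lt))) (hcj j) hM).
  exact: flen_bot hlen.
have hsub : cj j `<=` [set: R] by [].
exact: (@flen_trans R R^o _ _ _ (@submoduleT R R^o) (hcj j) (hcj j.+1) sub hsub (IH (ltnW hj)) fl).
Qed.

(** A diagonal matrix with entries in [cond] has its rows in [M], and its determinant is the
    product. So the Fitting ideal contains the [p]-th power of the annihilator. *)
Lemma fitting0_prod (t : seq R) : size t = p -> (forall a, a \in t -> cond a) ->
  fitting0 M (\prod_(a <- t) a).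
Proof.
move=> ht hc; apply: (@span_gen R R^o); exists (diag_mx (\row_(i < p) t`_i)).
  move=> i; rewrite row_diag_mx mxE; apply: hc; apply: mem_nth; rewrite ht; exact: ltn_ord.
rewrite det_diag (big_nth 0) ht big_mkord; apply: eq_bigr => i _; by rewrite mxE.
Qed.

(** Each power [pw n] of [cond] is finitely generated, so [pw n / pw n.+1] has finite length over
    [R / cond]. Hence [R / pw p] has finite length, and [fitting0_prod] puts [pw p] inside the
    Fitting ideal. *)
Lemma flen_fitting0 : @flen R R^o [set: R] (fitting0 M).
Proof.
pose pw n := iter n (@scale_mod R R^o cond) [set: R].
have hpw n : ideal (pw n) by case: n => [|n]; [exact: (@submoduleT R R^o)|exact: (@submodule_span R R^o)].
have hprod n (N : set R) : ideal N ->
    (forall t : seq R, size t = n -> (forall a, a \in t -> cond a) ->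
      forall b, N (b * \prod_(a <- t) a)) -> pw n `<=` N.
  elim: n N => [|n IH] N hN h.
    by move=> b _; have := h [::] erefl _ b; rewrite big_nil mulr1; apply.
  apply: (@span_min R R^o) => // _ [a ha [b hb <-]].
  have hN' : ideal [set b | N (a * b)].
    split; first by rewrite /= mulr0; exact: (sub0 hN).
    move=> d u w hu hw /=; rewrite mulrDr -[a * (d *: u)]/(a * (d * u)) mulrCA.
    exact: (hN.2 d _ _ hu hw).
  apply: (IH _ hN') hb => t ht hct d /=.
  have := h (a :: t); rewrite /= ht big_cons => /(_ erefl _ d); rewrite mulrCA; apply.
  by move=> x; rewrite inE => /orP [/eqP ->|/hct].
have hF : ideal (fitting0 M) by exact: (@submodule_span R R^o).
have pF : pw p `<=` fitting0 M.
  apply: hprod => // t ht hct b; apply: (subZ b hF); exact: fitting0_prod.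
apply: (flen_top pF); elim: (p) => [|n IH]; first exact: flen_refl.
have sub : pw n.+1 `<=` pw n.
  by apply: (@span_min R R^o _ _ (hpw n)) => _ [a ha [b hb <-]]; exact: (subZ a (hpw n) hb).
have fl : @flen R R^o (pw n) (pw n.+1).
  exact: (@flen_scale_mod R R^o cond hcond flen_conductor (pw n) (hpw n) (ideal_fin_gen (hpw n))).
have hsub : pw n `<=` [set: R] by [].
exact: (@flen_trans R R^o _ _ _ (@submoduleT R R^o) (hpw n) (hpw n.+1) sub hsub IH fl).
Qed.

End Fitting.

(** * Minimal reductions *)

Section Reductions.
Variables (R : comNzRingType) (m : set R) (p : nat) (M : set 'rV[R]_p).
Hypotheses (hR : noetherian R) (hlocal : local_ring m).
Hypotheses (hM : submodule M) (hfg : fin_gen M).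
Local Notation S := {mpoly R[p]}.
Local Notation A := (mpow M).
Local Notation T := (rees M).
Local Notation pi n := (@pihomog p R mdeg n).
Implicit Types (a b z : S) (J P Q X U : set S).

Lemma fin_gen_mul_mod X U : fin_gen X -> fin_gen U -> fin_gen (mul_mod X U).
Proof.
move=> /fin_genP [xs ->] /fin_genP [us ->]; apply/fin_genP.
pose zs := [seq x * u | x <- xs, u <- us]; exists zs; set W := span [set` zs].
have hW : submodule W by exact: submodule_span.
apply/seteqP; split; last first.
  apply: span_min; first exact: submodule_mul_mod.
  by move=> y /= /allpairsP [[x u] /= [hx hu ->]]; apply: mul_mod_gen; exact: span_gen.
apply: (mul_mod_min hW) => a b ha; apply: (submodule_subset_mul hW) => u hu.
rewrite mulrC; apply: (submodule_subset_mul hW) ha => x hx.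
by rewrite mulrC; apply: span_gen => /=; apply/allpairsP; exists (x, u).
Qed.

Lemma fin_gen_mpow n : fin_gen (A n).
Proof.
have h0 : fin_gen (A 0).
  apply/fin_genP; exists [:: 1]; congr (Defs.span _).
  by apply/seteqP; split=> x /=; rewrite inE => /eqP.
have h1 : fin_gen (A 1).
  rewrite (mpow1E hM); move/fin_genP: hfg => [xs ->]; apply/fin_genP.
  exists [seq linform x | x <- xs]; rewrite -(span_image (@linform_linear R p)).
  congr (Defs.span _); apply/seteqP; split; first by move=> _ [x hx <-]; exact: map_f.
  by move=> y /= /mapP [x hx ->]; exists x.
by elim: n => [|n IH] //; rewrite mpowS; exact: fin_gen_mul_mod.
Qed.

(** The definition speaks only of degrees that are multiples of [D]. Multiplying one such equality
    by [A (n - D * N)] reaches all large degrees. *)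
Lemma reduction_shift D U : reduction (A D) U ->
  exists n1, forall n, (n1 <= n)%N -> A (n + D) = mul_mod U (A n).
Proof.
move=> [hU UA [N hN]]; exists (D * N)%N => n hn.
have e := hN N (leqnn N); rewrite !exp_mod_exp -/(mpow M _) in e.
apply/seteqP; split; last first.
  by apply: mul_mod_min; [exact: submodule_mpow|move=> a b /UA ha hb; rewrite addnC; exact: exp_modM].
have -> : A (n + D) = mul_mod (A (n - D * N)) (mul_mod U (A (D * N))).
  by rewrite e -exp_mod_split mulnS; congr (exp_mod _ _); lia.
set W := mul_mod U (A n); have hW : submodule W by exact: submodule_mul_mod.
apply: (mul_mod_min hW) => a b ha; move: b.
suff h : mul_mod U (A (D * N)) `<=` [set b | W (a * b)] by exact: h.
apply: mul_mod_min; first exact: submodule_colon.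
move=> u c hu hc /=; rewrite mulrCA; apply: mul_mod_gen => //.
by rewrite -(subnK hn); exact: exp_modM.
Qed.

Let hres := len_residue hlocal.
Let hm := local_ideal hlocal.

Lemma scale_modM z N N' c : submodule N' -> (forall a, N a -> N' (z * a)) ->
  scale_mod (V := S) c N `<=` [set a | scale_mod c N' (z * a)].
Proof.
move=> hN' h; apply: span_min; first by apply: submodule_colon; exact: submodule_span.
by move=> _ [a ha [v hv <-]] /=; rewrite -scalerAr; apply: span_gen; exists a => //; exists (z * v) => //; exact: h.
Qed.

Lemma scale_mod_sub (V : lmodType R) c (N : set V) : submodule N -> scale_mod c N `<=` N.
Proof. by move=> hN; apply: (span_min hN) => _ [a _ [v hv <-]]; exact: subZ. Qed.

Section Spread.
Variable s : nat.
Hypothesis hs : max_chain [set P | prime_in T P /\ scale_mod m T `<=` P] s.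

Lemma spread_coheight : coheight_le m M set0 s.
Proof.
move=> P q _ hP; case: hs => _; apply; apply/has_chainP; exists P.
apply: uchain_sub hP => Q [[hQi q1 q2] _ hQm]; split=> //.
have hQs := ideal_in_submodule hM hQi; have [QT Q0 QD QM] := hQi.
apply: (span_min hQs) => _ [c hc [v Tv <-]].
by rewrite -mulr_algl mulrC; apply: QM => //; exact: hQm.
Qed.

(** By [growth_bound] the pieces [A n / m A n] have growth exponent at most [t], whereas a chain of
    length [s] of primes over [m T] forces [s <= t]. Generation is asked only modulo [m], the form
    in which a smaller reduction provides it. *)
Lemma spread_le_generators D t (zs : seq S) n1 : (0 < D)%N -> size zs = t ->
  (forall z, z \in zs -> A D z) ->
  (forall n, (n1 <= n)%N -> A (n + D) `<=` sumz zs (A n) (scale_mod m (A (n + D)))) ->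
  (s <= t)%N.
Proof.
move=> D0 <- hz hgen; pose N' n := scale_mod m (A n).
have hA n := submodule_mpow M n.
have hN' n : submodule (N' n) by exact: submodule_span.
have N'A n : N' n `<=` A n by exact: scale_mod_sub.
have fl n : flen (A n) (N' n).
  by apply: flen_scale_mod; [exact: hm|exact: hres.1|exact: hA|exact: fin_gen_mpow].
have hc : cumO (size zs) (fun n => len (A n) (N' n)).
  apply: (growth_bound D0 hA hN' N'A fl (n1 := n1)) => //.
    by move=> z n a hz' ha; rewrite addnC; apply: exp_modM => //; exact: hz.
  move=> z n a hz' ha; apply: (scale_modM (z := z) (hA _)) ha => b hb.
  by rewrite addnC; apply: exp_modM => //; exact: hz.
have [hJ hJc] := @mT_homog _ m _ _ hM set0 (fun x (h : set0 x) => match h with end).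
have sub n : N' n `<=` mT m M set0 `&` A n.
  move=> a ha; split; last exact: N'A.
  move: a ha; apply: span_min; first exact: ideal_in_submodule hJ.
  move=> _ [c hc' [v hv <-]]; rewrite -mulr_algl mulrC; have [_ _ _ JM] := hJ.
  apply: JM; first exact: (mpow_rees hM hv).
  by apply: lin_gen; right; exists c.
have hJA n : submodule (mT m M set0 `&` A n).
  by apply: submoduleI => //; exact: ideal_in_submodule hJ.
have fl' n : flen (A n) (mT m M set0 `&` A n) by exact: flen_top (fl n).
have [/has_chainP [P hP] _] := hs.
apply: (prime_chain_le hM hJ hJc fl' (P := P)).
  apply: (cumO_le (n1 := 0) _ hc) => n _; exact: len_mono.
apply: uchain_sub hP => Q [hQ mQ]; split=> //.
have [hQi _ _] := hQ; have [_ sQ] := (ideal_inP M Q).1 hQi.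
apply: (lin_min sQ) => x [//|[c hc' <-]]; apply: mQ; apply: span_gen.
by exists c => //; exists 1 => //; have [] := rees_subring hM.
Qed.

Lemma coheight0_minimal_reduction D (x : 'I_s -> S) : (0 < D)%N -> (0 < s)%N ->
  (forall i, A D (x i)) -> coheight_le m M (range x) 0 ->
  minimal_reduction (A D) (span (range x)).
Proof.
move=> D0 s0 hx h0; set U := span (range x).
have hA n := submodule_mpow M n.
have hU : submodule U by exact: submodule_span.
have UA : U `<=` A D by apply: (span_min (hA D)) => _ [i _ <-].
have hX a : range x a -> exists d, A d a by move=> [i _ <-]; exists D.
split.
  split=> //.
  have [q hq] := coheight0_power hR hlocal hM hfg hX h0.
  exists q => n hn; rewrite !exp_mod_exp -/(mpow M _) -/(mpow M _).
  apply/seteqP; split.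
    by apply: (mul_mod_min (hA _)) => a b /UA ha hb; rewrite mulnS; exact: exp_modM.
  have Dn : (D <= D * n.+1)%N by rewrite leq_pmulr.
  have qn : (q <= D * n.+1)%N by apply: leq_trans hn _; nia.
  have e : (D * n.+1 - D = D * n)%N by rewrite mulnS addKn.
  rewrite -e; apply: (nakayama hR hlocal); first exact: submodule_mul_mod.
  - exact: hA.
  - exact: fin_gen_mpow.
  - move=> a ha; apply: (mT_component hM _ Dn); first by move=> _ [i _ <-].
    by split=> //; exact: hq qn _ ha.
(* A reduction [U'] strictly inside [U] might a priori need many generators, so its image in
   [U / m U] is used. By Nakayama this image is proper, hence has length at most [s.-1], and that
   many elements generate [U'] modulo [m U]. *)
move=> U' hU' U'U; apply: contrapT => ne.
have [hU's U'A _] := hU'; have [n1 hn1] := reduction_shift hU'.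
have fU : fin_gen U by exists s, x.
pose B := scale_mod m U; pose N := addS U' B.
have hB : submodule B by exact: submodule_span.
have hN : submodule N by exact: submodule_addS.
have BU : B `<=` U by exact: scale_mod_sub.
have BN : B `<=` N by exact: addSr.
have NU : N `<=` U by exact: addS_min.
have NpU : N `<` U.
  apply: sub_neq_proper => // e; apply: ne; apply/seteqP; split=> //.
  by apply: (nakayama hR hlocal) => //; rewrite -/B -/N e.
have [xs [sxs hxs]] : exists xs : seq S, size xs = s /\ U = span [set` xs].
  exists [seq x i | i <- enum 'I_s]; split; first by rewrite size_map size_enum_ord.
  congr (Defs.span _); apply/seteqP; split.
    by move=> _ [i _ <-] /=; apply: map_f; rewrite mem_enum.
  by move=> y /= /mapP [i _ ->]; exists i.
have [fUB lUB] : flen U B /\ (len U B <= s)%N.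
  have [|f l] := @len_span _ _ m hm hres.1 xs B hB.
    by move=> y c hy hc; apply: span_gen; exists c => //; exists y => //; rewrite hxs; exact: span_gen.
  rewrite -hxs in f l; have hUB : submodule (addS U B) by exact: submodule_addS.
  split; first by apply: flen_bot f; exact: addSl.
  apply: (@leq_trans (len (addS U B) B)); first by apply: len_mono => //; exact: addSl.
  apply: leq_trans l _; rewrite sxs -[leqRHS]muln1 leq_mul2l hres.2 orbT.
  by [].
have lNB : (len N B <= s.-1)%N.
  by rewrite -ltnS prednK //; apply: leq_trans lUB; exact: len_proper.
have [zs [szs hzs hgen]] := generators_of_len hN hB BN (flen_bot NU fUB) lNB.
have : (s <= s.-1)%N; last by rewrite leqNgt prednK ?leqnn.
apply: (@spread_le_generators D _ zs n1) => //; first by move=> z /hzs /NU /UA.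
move=> n hn; rewrite (hn1 n hn); set W := sumz _ _ _.
have hmA : submodule (scale_mod m (mul_mod U' (A n))) by exact: submodule_span.
have hW : submodule W by exact: submodule_sumz.
apply: (mul_mod_min hW) => u a hu ha.
have [z hz [b hb <-]] : addS (span [set` zs]) B u by apply: hgen; exact: addSl.
rewrite mulrDl; apply: subD => //.
  rewrite mulrC; apply: (submodule_subset_mul hW) hz => y hy.
  by rewrite mulrC; apply: sumz_gen.
apply: sumz_base => //; rewrite -(hn1 n hn) addnC mulrC.
apply: (scale_modM (z := a) (N := U)) => // c hc.
by rewrite mulrC; apply: exp_modM => //; exact: UA.
Qed.

End Spread.

End Reductions.

(** * Coefficient modules *)

Section CoefficientModules.
Variables (R : comNzRingType) (m : set R) (p : nat) (M : set 'rV[R]_p).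
Hypotheses (hR : noetherian R) (hlocal : local_ring m).
Hypotheses (hM : submodule M) (hfg : fin_gen M).
Hypothesis hlen : flen [set: 'rV[R]_p] M.
Local Notation F := 'rV[R]_p.
Local Notation S := {mpoly R[p]}.
Local Notation A := (mpow M).
Local Notation T := (rees M).
Local Notation I := (fitting0 M).
Local Notation pi n := (@pihomog p R mdeg n).
Local Notation lf := (@linform R p).
Implicit Types (a b z : S) (y : F) (L : set F).

(* [IA n] and [LA L n] sit in degree [n + 1]. *)
Local Notation IA n := (scale_mod (V := S) I (A n.+1)).
Local Notation LA L n := (mul_mod (lf @` L) (A n)).

Let hA n : submodule (A n) := submodule_mpow M n.
Let hIA n : submodule (IA n). Proof. exact: submodule_span. Qed.
Let IAA n : IA n `<=` A n.+1. Proof. exact: scale_mod_sub. Qed.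

Lemma flen_IA n : flen (A n.+1) (IA n).
Proof.
apply: flen_scale_mod; [exact: (@submodule_span R R^o)|exact: flen_fitting0|exact: hA|].
exact: fin_gen_mpow.
Qed.

Lemma graded_fam_IA : graded_fam M 1 (fun n => IA n).
Proof.
split; first by [].
  by move=> n; rewrite addn1; exact: IAA.
move=> n z a hz; apply: (scale_modM (z := z) (hA n.+2)) => b hb.
by rewrite -add1n; exact: exp_modM.
Qed.

Lemma linform_mem y : M y -> A 1 (lf y).
Proof. by move=> hy; rewrite (mpow1E hM); exists y. Qed.

Lemma graded_fam_LA L : submodule L -> L `<=` M -> graded_fam M 1 (fun n => LA L n).
Proof.
move=> hL LM; split; first by move=> n; exact: submodule_mul_mod.
  move=> n; rewrite addn1; apply: (mul_mod_min (hA _)) => _ b [y /LM hy <-] hb.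
  by rewrite -add1n; apply: exp_modM => //; exact: linform_mem.
move=> n z a hz; suff h : LA L n `<=` [set a | LA L n.+1 (z * a)] by exact: h.
apply: mul_mod_min; first by apply: submodule_colon; exact: submodule_mul_mod.
move=> u b hu hb /=; rewrite mulrCA; apply: mul_mod_gen => //.
by rewrite -add1n; exact: exp_modM.
Qed.

Lemma IA_sub_LA L n : submodule L -> scale_mod I M `<=` L -> IA n `<=` LA L n.
Proof.
move=> hL IL; have hW : submodule (LA L n) by exact: submodule_mul_mod.
apply: (span_min hW) => _ [c hc [v + <-]]; rewrite mpowS; move: v.
suff h : mul_mod (A 1) (A n) `<=` [set v | LA L n (c *: v)] by exact: h.
apply: mul_mod_min.
  split; first by rewrite /= scaler0; exact: sub0 hW.
  by move=> d u v hu hv /=; rewrite scalerDr scalerA mulrC -scalerA; apply: hW.2.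
move=> u b; rewrite (mpow1E hM) => -[w hw <-] hb /=; rewrite scalerAl.
apply: mul_mod_gen => //; exists (c *: w); last by rewrite (linear_funZ (@linform_linear R p)).
by apply: IL; apply: span_gen; exists c => //; exists w.
Qed.

Lemma LA_sub L n : L `<=` M -> LA L n `<=` A n.+1.
Proof.
move=> LM; apply: (mul_mod_min (hA _)) => _ b [y /LM hy <-] hb.
by rewrite -add1n; apply: exp_modM => //; exact: linform_mem.
Qed.

Lemma flen_LA L n : L `<=` M -> flen (LA L n) (IA n).
Proof. by move=> LM; apply: flen_bot (flen_IA n); exact: LA_sub. Qed.

Lemma cumO_shift t (h : nat -> nat) : cumO t h -> cumO t (fun n => h n.+1).
Proof.
move=> [C hC]; exists (C * 2 ^ t)%N => n.
apply: (@leq_trans (C * n.+2 ^ t)); last by rewrite -mulnA -expnMn leq_mul2l leq_expn_base ?orbT //; lia.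
by apply: leq_trans (hC n.+1); rewrite big_ord_recl leq_addl.
Qed.

Lemma cumO_unshift t (h : nat -> nat) : cumO t (fun n => h n.+1) -> cumO t h.
Proof.
move=> [C hC]; exists (h 0%N + C)%N => -[|n]; first by rewrite big_ord0.
rewrite big_ord_recl mulnDl leq_add //; first by rewrite leq_pmulr // expn_gt0.
by apply: leq_trans (hC n) _; rewrite leq_mul2l leq_expn_base ?orbT.
Qed.

(** The size is the degree plus one, with the zero polynomial at degree -1; for [k = s] the bound
    leaves only zero. *)
Lemma pdegree_le (q : {poly rat}) s k : (k <= s)%N ->
  (pdegree q <= s%:Z - (k%:Z + 1)) = (size q <= s - k)%N.
Proof. by rewrite /pdegree => ks; apply/idP/idP; lia. Qed.

(** [hilbert_poly] supplies the polynomial for every such [L], so the degree condition reduces to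
    growth, through [hilb_cumO] in one direction and [hilb_degree] in the other. *)
Lemma coef_candidateP s k L : (k <= s)%N ->
  coef_candidate s k M L <->
  [/\ submodule L, scale_mod I M `<=` L, L `<=` M &
      cumO (s - k) (fun n => len (LA L n) (IA n))].
Proof.
move=> ks; pose h n := len (LA L n.-1) (scale_mod (V := S) I (A n)).
split=> [[hL IL LM [q [N hq] dq]]|[hL IL LM hc]]; split=> //.
  apply: (@cumO_shift _ h); apply: (@hilb_cumO h N q).
    by move=> n /hq [l /len_eq <- ->].
  by rewrite -pdegree_le.
have [q [n1 hq]] := hilbert_poly hM hfg hR (graded_fam_LA hL LM) graded_fam_IA
  (fun n => IA_sub_LA hL IL) (fun n => flen_LA n LM).
(* The families start in degree 1, one step behind the indexing of [length_poly]; the value of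
   [n.-1] at 0 is harmless because only large [n] count. *)
pose q2 := q \Po ('X - 1).
have hq2 n : (n1.+1 <= n)%N -> q2.[n%:R] = (h n)%:R.
  case: n => // n hn; rewrite horner_comp hornerD hornerN hornerX hornerC -natr1 addrK.
  by rewrite hq.
exists q2; last first.
  by rewrite pdegree_le //; apply: (hilb_degree hq2); exact: (@cumO_unshift _ h).
exists n1.+1 => n hn; exists (h n); last exact: hq2.
case: n hn => // n _; apply: lenP; [exact: submodule_mul_mod|exact: hIA| |exact: flen_LA].
exact: IA_sub_LA.
Qed.

Definition YA y n : set S := addS (( *%R (lf y)) @` A n) (IA n).

Lemma submodule_YA y n : submodule (YA y n).
Proof. by apply: submodule_addS => //; exact: submodule_mulz. Qed.

Lemma IA_sub_YA y n : IA n `<=` YA y n.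
Proof. by apply: addSr; exact: submodule_mulz. Qed.

Lemma YA_sub y n : M y -> YA y n `<=` A n.+1.
Proof.
move=> hy; apply: (addS_min (hA _)) => // _ [a ha <-].
by rewrite -add1n; apply: exp_modM => //; exact: linform_mem.
Qed.

Lemma flen_YA y n : M y -> flen (YA y n) (IA n).
Proof. by move=> hy; apply: flen_bot (flen_IA n); exact: YA_sub. Qed.

Lemma linform_fitting y n : scale_mod I M y -> ( *%R (lf y)) @` A n `<=` IA n.
Proof.
move=> hy _ [a ha <-]; move: y hy.
suff h : scale_mod I M `<=` [set y | IA n (lf y * a)] by exact: h.
have hl : linear (fun y => lf y * a).
  by move=> c u v; rewrite (@linform_linear R p) mulrDl scalerAl.
apply: span_min; first exact: (submodule_preimage hl).
move=> _ [c hc [w hw <-]] /=; rewrite (linear_funZ (@linform_linear R p)) -scalerAl.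
apply: span_gen; exists c => //; exists (lf w * a) => //.
by rewrite -add1n; apply: exp_modM => //; exact: linform_mem.
Qed.

Definition small_growth t : set F :=
  [set y | M y /\ cumO t (fun n => len (YA y n) (IA n))].

Lemma submodule_small_growth t : submodule (small_growth t).
Proof.
split.
  split; first exact: sub0.
  apply: (@cumO_le 0 _ _ (fun _ => 0%N)); last by exists 0%N => n; rewrite big1.
  move=> n _; suff -> : YA 0 n = IA n by rewrite len_refl.
  apply/seteqP; split; last exact: IA_sub_YA.
  apply: addS_min => //; apply: linform_fitting; exact: (sub0 (submodule_span _)).
move=> c u v [Mu hu] [Mv hv]; split; first exact: hM.2.
apply: (cumO_le (n1 := 0) _ (cumO_add hu hv)) => n _.
have [f l] := len_addS (submodule_YA u n) (submodule_YA v n) (hIA n)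
  (@IA_sub_YA u n) (@IA_sub_YA v n) (flen_YA n Mu) (flen_YA n Mv).
have hUV : submodule (addS (YA u n) (YA v n)) by apply: submodule_addS; exact: submodule_YA.
have IUV : IA n `<=` addS (YA u n) (YA v n).
  by apply: subset_trans (@IA_sub_YA u n) _; apply: addSl; exact: submodule_YA.
apply: leq_trans l; apply: len_mono => //; [exact: submodule_YA|exact: IA_sub_YA|].
apply: (addS_min hUV) => // _ [a ha <-].
rewrite (@linform_linear R p) mulrDl -scalerAl; exists (c *: (lf u * a)).
  by apply: (subZ _ (submodule_YA u n)); apply: addSl => //; exists a.
by exists (lf v * a) => //; apply: addSl => //; exists a.
Qed.

Lemma fitting_small_growth t : scale_mod I M `<=` small_growth t.
Proof.
move=> y hy; split; first exact: (scale_mod_sub (c := I) hM hy).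
apply: (@cumO_le 0 _ _ (fun _ => 0%N)); last by exists 0%N => n; rewrite big1.
move=> n _; suff -> : YA y n = IA n by rewrite len_refl.
apply/seteqP; split; last exact: IA_sub_YA.
by apply: addS_min => //; exact: linform_fitting.
Qed.

(** Finite generation of [L] is read off from the Noetherian ring [T]: in degree one, the
    coefficients of generators of degree one reduce to constants. *)
Lemma linform_fin_gen L : submodule L -> L `<=` M ->
  exists ys : seq F, (forall y, y \in ys -> L y) /\ lf @` L `<=` span [set lf y | y in [set` ys]].
Proof.
move=> hL LM; have hT := noeth_rees hM hR hfg.
have [|xs hxs hX] := hT (lf @` L).
  by move=> _ [y /LM hy <-]; exact: (mpow_rees hM (linform_mem hy)).
have [ys hys] : exists ys : seq F, (forall y, y \in ys -> L y) /\ [set` xs] `<=` [set lf y | y in [set` ys]].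
  elim: xs hxs {hX} => [|x xs IH] hxs; first by exists [::].
  have [|ys [h1 h2]] := IH; first by move=> a ha; apply: hxs; rewrite /= inE; apply/orP; right.
  have [y hy e] : (lf @` L) x by apply: hxs; rewrite /= inE eqxx.
  exists (y :: ys); split; first by move=> w; rewrite inE => /orP [/eqP ->|/h1].
  move=> a /=; rewrite inE => /orP [/eqP ->|/h2 [w /= hw <-]].
    by exists y => //=; rewrite mem_head.
  by exists w => //=; rewrite inE hw orbT.
exists ys; split; first by case: hys.
move=> _ [y hy <-]; set W := span _; have hW : submodule W by exact: submodule_span.
have [T1 _ TM] := rees_subring hM.
have h : lin T [set` xs] `<=` [set a | forall b, T b -> W (pi 1 (b * a))].
  apply: lin_min.
    split; first by move=> b _; rewrite mulr0 raddf0; exact: (sub0 hW).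
      by move=> u v hu hv b hb; rewrite mulrDr raddfD; apply: (subD hW); [exact: hu|exact: hv].
    by move=> b u hb hu e he; rewrite mulrA; apply: hu; exact: TM.
  move=> x /hys.2 [w hw <-] b Tb; have Mw : M w by apply: LM; case: hys => h _; exact: h.
  rewrite (pi_mul_homog hM b (linform_mem Mw) (leqnn 1)) subnn.
  have [c ->] := (exp_mod0 (lf @` M) _).1 (pi_mpow hM 0 Tb).
  by rewrite mulr_algl; apply: (subZ _ hW); apply: span_gen; exists w.
have hy1 : lin T [set` xs] (lf y) by apply: hX; exists y.
by have := h _ hy1 1 T1; rewrite mul1r (pi_id hM (linform_mem (LM _ hy))).
Qed.

(** With finitely many generators [ys] of [L], the module [LA L n] lies in the sum of the [YA y n],
    whose length is subadditive. Finiteness matters, since growth bounds only add up finitely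
    often. *)
Lemma cumO_small_growth t L : submodule L -> scale_mod I M `<=` L -> L `<=` small_growth t ->
  cumO t (fun n => len (LA L n) (IA n)).
Proof.
move=> hL IL Lt; have LM : L `<=` M by move=> y /Lt [].
have [ys [hys hgen]] := linform_fin_gen hL LM.
pose W n := foldr (fun y Y => addS (YA y n) Y) (IA n) ys.
have H : (forall n, [/\ submodule (W n), IA n `<=` W n & flen (W n) (IA n)]) /\
         cumO t (fun n => len (W n) (IA n)).
  rewrite /W; elim: ys hys {hgen W} => [|y ys IH] hys /=.
    split; first by move=> n; split=> //; exact: flen_refl.
    apply: (@cumO_le 0 _ _ (fun _ => 0%N)); last by exists 0%N => n; rewrite big1.
    by move=> n _; rewrite len_refl.
  have [|h1 h2] := IH; first by move=> w hw; apply: hys; rewrite inE hw orbT.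
  have [My hy] : small_growth t y by apply: Lt; apply: hys; rewrite mem_head.
  have hl n := let: And3 hW IW fW := h1 n in len_addS (submodule_YA y n) hW (hIA n) (@IA_sub_YA y n) IW (flen_YA n My) fW.
  split.
    move=> n; have [hW IW fW] := h1 n; have [f _] := hl n; split=> //.
      by apply: submodule_addS => //; exact: submodule_YA.
    by apply: subset_trans IW _; apply: addSr; exact: submodule_YA.
  by apply: (cumO_le (n1 := 0) _ (cumO_add hy h2)) => n _; have [] := hl n.
have [h1 h2] := H; apply: (cumO_le (n1 := 0) _ h2) => n _; have [hW IW fW] := h1 n.
apply: len_mono => //; [exact: submodule_mul_mod|exact: IA_sub_LA|].
have hy y a : y \in ys -> A n a -> W n (lf y * a).
  move=> hin ha; rewrite /W; elim: (ys) hin => [|w vs IH] //=.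
  have hF : submodule (foldr (fun y Y => addS (YA y n) Y) (IA n) vs).
    elim: vs {IH} => [|x us IH] /=; first exact: submodule_span.
    by apply: submodule_addS => //; exact: submodule_YA.
  rewrite inE => /orP [/eqP ->|/IH h].
    by apply: addSl => //; apply: addSl; [exact: submodule_span|exists a].
  by apply: addSr => //; exact: submodule_YA.
apply: (mul_mod_min hW) => u a /hgen hu ha; rewrite mulrC.
apply: (submodule_subset_mul hW) hu => _ [y hin <-]; rewrite mulrC; exact: hy.
Qed.

(** Maximality holds because [YA y n] lies in [LA L n] as soon as [y] lies in a candidate [L], so
    [y] inherits the growth bound of [L]. *)
Lemma small_growth_coef_module s k : (k <= s)%N ->
  is_coef_module s k M (small_growth (s - k)).
Proof.
move=> ks; split.
  apply/coef_candidateP => //; split.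
  - exact: submodule_small_growth.
  - exact: fitting_small_growth.
  - by move=> y [].
  - by apply: cumO_small_growth => //; [exact: submodule_small_growth|exact: fitting_small_growth].
move=> L /(coef_candidateP _ ks) [hL IL LM hc] y Ly; have My := LM _ Ly; split=> //.
apply: (cumO_le (n1 := 0) _ hc) => n _.
have hW : submodule (LA L n) by exact: submodule_mul_mod.
apply: len_mono => //; [exact: submodule_YA|exact: IA_sub_YA| |exact: flen_LA].
apply: (addS_min hW); last exact: IA_sub_LA.
by move=> _ [a ha <-]; apply: mul_mod_gen => //; exists y.
Qed.

(** The annihilator of [y] modulo the Fitting ideal. Testing each component separately makes it
    homogeneous by construction. *)
Definition rees_ann y : set S := [set a | T a /\ forall n, IA n (lf y * pi n a)].

Lemma rees_ann_homog y : M y -> ideal_in T (rees_ann y) /\ homog_closed (rees_ann y).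
Proof.
move=> My; split.
  split; first by move=> a [].
  - split; first exact: sub0 (submodule_rees hM).
    by move=> n; rewrite raddf0 mulr0; exact: (sub0 (hIA n)).
  - move=> a b [Ta ha] [Tb hb]; split; first exact: (subD (submodule_rees hM)).
    by move=> n; rewrite raddfD mulrDr; apply: (subD (hIA n)).
  - move=> b a Tb [Ta ha]; split; first by have [_ _ h] := rees_subring hM; exact: h.
    move=> n; rewrite piM mulr_sumr; apply: (sub_sum _ (hIA n)) => i _.
    rewrite mulrCA; have e : n = (i + (n - i))%N by rewrite subnKC // -ltnS.
    have := graded_fam_mul graded_fam_IA (pi_mpow hM i Tb) (ha (n - i)%N).
    by rewrite -e.
move=> a n [Ta ha]; have An := pi_mpow hM n Ta; split; first exact: (mpow_rees hM An).
move=> k; have [->|ne] := eqVneq k n; first by rewrite pihomog_id.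
by rewrite (pi_neq hM An ne) mulr0; exact: (sub0 (hIA k)).
Qed.

Lemma rees_ann_component y n : rees_ann y `&` A n = A n `&` ( *%R (lf y)) @^-1` IA n.
Proof.
apply/seteqP; split=> a.
  by move=> [[Ta ha] An]; split=> //; have := ha n; rewrite (pi_id hM An).
move=> [An hn]; split=> //; split; first exact: (mpow_rees hM An).
move=> k; have [->|ne] := eqVneq k n; first by rewrite (pi_id hM An).
by rewrite (pi_neq hM An ne) mulr0; exact: (sub0 (hIA k)).
Qed.

(** Multiplication by [y] identifies [A n / (rees_ann y)_n] with [YA y n / IA n], so the growth
    attached to [y] is that of [T] modulo [rees_ann y], and [prime_chain_le] applies. *)
Lemma rees_ann_coheight y t P q : small_growth t y -> rees_ann y `<=` P ->
  uchain (hprimes m M) P q -> (q <= t)%N.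
Proof.
move=> [My hy] yP hP; have [hJ hJc] := rees_ann_homog My.
have fl n : flen (A n) (rees_ann y `&` A n).
  by rewrite rees_ann_component; apply/(flen_image (mulr_linear (lf y))) => //; exact: flen_YA.
apply: (prime_chain_le hM hJ hJc fl (P := P)).
  apply: (cumO_le (n1 := 0) _ hy) => n _.
  rewrite [leqRHS](len_image (mulr_linear (lf y)) (hA n) (hIA n)); first by rewrite rees_ann_component.
  by rewrite -rees_ann_component.
apply: uchain_sub (uchain_above hP) => Q [[hQ _ _] PQ]; split=> //.
exact: subset_trans PQ.
Qed.

Variables (s k : nat).
Hypothesis hs : analytic_spread m M s.
Hypotheses (s_gt0 : (0 < s)%N) (ks : (k <= s)%N).

Lemma small_growth_colon y : small_growth (s - k) y ->
  exists n0, exists x : 'I_s -> S, [/\ (0 < n0)%N, generates_min_reduction (A n0) x &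
    colonF (scale_mod I (A n0.+1)) k x y].
Proof.
move=> hy; have [My _] := hy; have [hJ hJc] := rees_ann_homog My.
have [D [x [D0 hx hxk h0]]] := choose_parameters_same_degree hR hlocal hM hfg
  (spread_coheight hM hs) hJ hJc ks (fun P q => @rees_ann_coheight y (s - k) P q hy).
exists D, x; split=> //; first split=> //.
  exact: (coheight0_minimal_reduction hR hlocal hM hfg hs).
move=> i /hxk [Tx hxi]; have := hxi D; by rewrite (pi_id hM (hx i)).
Qed.

Lemma colon_small_growth y n0 (x : 'I_s -> S) : M y -> (0 < n0)%N ->
  generates_min_reduction (A n0) x -> colonF (scale_mod I (A n0.+1)) k x y ->
  small_growth (s - k) y.
Proof.
move=> My n0_gt0 [hx [hred _]] hcol; split=> //.
have [n1 hn1] := reduction_shift hred.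
(* The [s - k] generators not covered by the colon condition; their number is the growth exponent
   delivered by [growth_bound]. *)
pose zs := map x [seq i : 'I_s <- enum 'I_s | (k <= i)%N].
have hzs z : z \in zs -> A n0 z by move=> /mapP [i _ ->].
have szs : size zs = (s - k)%N.
  rewrite size_map size_filter -(count_map val (leq k)) val_enum_ord -(subnKC ks) iotaD count_cat.
  have -> : count (leq k) (iota 0 k) = 0%N.
    by apply/eqP; rewrite -leqn0 leqNgt -has_count; apply/hasPn => i; rewrite mem_iota /= -ltnNge.
  have : all (leq k) (iota k (s - k)) by apply/allP => i; rewrite mem_iota => /andP [].
  by rewrite all_count size_iota add0n addKn => /eqP.
rewrite -szs; apply: (growth_bound n0_gt0 (n1 := n1)).
- by move=> n; exact: submodule_YA.
- exact: hIA.
- by move=> n; exact: IA_sub_YA.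
- by move=> n; exact: flen_YA.
- move=> z n _ /hzs hz [_ [a ha <-] [b hb <-]]; rewrite mulrDr mulrCA.
  exists (lf y * (z * a)); first by exists (z * a) => //; rewrite addnC; exact: exp_modM.
  exists (z * b) => //; rewrite addnC; exact: (graded_fam_mul graded_fam_IA).
- by move=> z n a /hzs hz ha; rewrite addnC; exact: (graded_fam_mul graded_fam_IA).
move=> n hn; set W := sumz _ _ _.
have hW : submodule W by apply: submodule_sumz => //; exact: submodule_YA.
have IW : IA (n + n0) `<=` W by apply: sumz_base; exact: submodule_YA.
apply: (addS_min hW) => // _ [a + <-]; rewrite (hn1 n hn); move: a.
suff h : mul_mod (span (range x)) (A n) `<=` [set a | W (lf y * a)] by exact: h.
apply: mul_mod_min; first exact: submodule_colon.
move=> u a hu ha /=; rewrite mulrCA mulrC; apply: (submodule_subset_mul hW) hu => _ [i _ <-].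
(* For [i < k] the colon condition puts [y * x i] in degree [n0.+1] of the Fitting multiples,
   already part of the base of [W]; the other [x i] belong to [zs]. *)
have [ik|ki] := ltnP i k.
  apply: IW; rewrite -mulrA mulrCA; apply: (graded_fam_mul graded_fam_IA ha).
  exact: hcol.
rewrite mulrC; apply: sumz_gen => //; first exact: submodule_YA.
  by apply: map_f; rewrite mem_filter ki mem_enum.
by apply: addSl => //; exists a.
Qed.

End CoefficientModules.

Theorem theorem4p5 (R : comNzRingType) (m : set R) (d p s k : nat)
    (M : set 'rV[R]_p)
    (hnoeth : noetherian R) (hlocal : local_ring m) (hdim : krull_dim R d)
    (hres : infinite_residue_field m)
    (hp : (0 < p)%N)
    (hM : submodule M) (hfg : fin_gen M)
    (hlen : exists l, length_quot [set: 'rV[R]_p] M l)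
    (hs : analytic_spread m M s) (hs1 : (1 <= s)%N)
    (hk : (1 <= k <= s)%N) :
  coef_module s k M =
  \bigcup_(nx in [set nx : nat * ('I_s -> {mpoly R[p]}) |
                  (1 <= nx.1)%N /\
                  generates_min_reduction (mpow M nx.1) nx.2])
    (M `&` colonF (scale_mod (fitting0 M) (mpow M nx.1.+1)) k nx.2).
Proof.
have [_ ks] := andP hk.
have hfl : flen [set: 'rV[R]_p] M by have [l /length_quot_flen] := hlen.
rewrite (coef_moduleE (small_growth_coef_module hnoeth hM hfg hfl ks)).
apply/seteqP; split=> y.
  move=> hy; have [n0 [x [n0_gt0 hx hc]]] :=
    small_growth_colon hnoeth hlocal hM hfg hfl hs hs1 ks hy.
  by exists (n0, x) => //; split=> //; case: hy.
move=> [[n0 x] [/= n0_gt0 hx] [My hc]].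
exact: (colon_small_growth hnoeth hM hfg hfl ks My n0_gt0 hx hc).
Qed.
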